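(* Let $(X,\mathbb X)$ be a $\gamma$-H\''older continuous rough path in $\mathbb R^n$ on $[0,1]$ with $\gamma>\frac13$, let $A$ be a rough path in $\mathbb R^n$ controlled by $X$, let $B:[0,1]\to\mathbb R$ be a $\gamma$-H\''older continuous function, and set $$Z_t=\int_0^t A_s\,dX_s+\int_0^t B_s\,ds,\qquad t\in[0,1].$$ Then, if $X$ is $\theta$-H\''older rough for some $\theta<2\gamma$, there exist constants $r>0$ and $q>0$ such that $$\|A\|_\infty+\|B\|_\infty\le M\,L_\theta(X)^{-q}\,\|Z\|_\infty^r$$ for a constant $M$ depending polynomially on the $\gamma$-H\''older ``norms'' of $X$, $A$ and $B$. Furthermore, if $X$ is the rough path canonically associated to ($n$-dimensional) fractional Brownian motion with Hurst parameter $H\le\frac12$, then $\mathbb E\,L_\theta(X)^{-p}<\infty$ for every $\theta>H$ and every $p>0$.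
   Context: For $f$ on $[0,1]$ write $\delta f_{st}=f_t-f_s$, $\|f\|_\infty=\sup_t|f_t|$, $\|f\|_\gamma=\sup_{s\ne t}|\delta f_{st}|/|t-s|^\gamma$, $\|f\|_{\mathcal C^\gamma}=\|f\|_\infty+\|f\|_\gamma$; for a continuous $R:[0,1]^2\to\mathbb R^k$ vanishing on the diagonal, $\|R\|_{2\gamma}=\sup_{s\ne t}|R_{st}|/|t-s|^{2\gamma}$. A $\gamma$-H\''older rough path, $\gamma\in(\frac13,\frac12]$, is a pair $(X,\mathbb X)$ with $X:[0,1]\to\mathbb R^n$ and $\mathbb X:[0,1]^2\to\mathbb R^{n\times n}$ continuous, $\mathbb X_{st}^{ij}-\mathbb X_{ut}^{ij}-\mathbb X_{su}^{ij}=\delta X^i_{su}\,\delta X^j_{ut}$ for all $s,u,t,i,j$, and $\|(X,\mathbb X)\|_\gamma:=\|X\|_\gamma+\|\mathbb X\|_{2\gamma}<\infty$. A path $A$ (together with its derivative process $A'$) is controlled by $X$ if $A,A'$ are $\gamma$-H\''older and $R^A_{st}:=\delta A_{st}-A'_s\,\delta X_{st}$ satisfies $\|R^A\|_{2\gamma}<\infty$; set $\|(A,A')\|_{X,\gamma}=|A_0|+\|A'\|_{\mathcal C^\gamma}+\|R^A\|_{2\gamma}$. The integral is $\int_0^tA_s\,dX_s=\lim_{|P|\to0}\sum_{[u,v]\in P}\big(\sum_jA^j_u\,\delta X^j_{uv}+\sum_{j,k}(A'_u)^{jk}\,\mathbb X^{kj}_{uv}\big)$ over partitions $P$ of $[0,t]$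 (the limit exists). ``$M$ depends polynomially on the $\gamma$-H\''older norms of $X$, $A$, $B$'' means that $M$ is bounded by a polynomial in $\|(X,\mathbb X)\|_\gamma$, $\|(A,A')\|_{X,\gamma}$ and $\|B\|_{\mathcal C^\gamma}$. A path $X$ in $\mathbb R^n$ on $[0,T]$ (here $T=1$) is $\theta$-H\''older rough, $\theta\in(0,1)$, if there is a constant $L>0$ such that for every $s\in[0,T]$, every $\varepsilon\in(0,T/2]$ and every $\phi\in\mathbb R^n$ with $\|\phi\|=1$ there exists $t\in[0,T]$ with $|t-s|\le\varepsilon$ and $|\langle\phi,\delta X_{st}\rangle|>L\varepsilon^\theta$. The largest such $L$ (the supremum; $0$ if there is none) is denoted $L_\theta(X)$, the modulus of $\theta$-H\''older roughness. It depends only on the path $X$ and not on $\mathbb X$. Fractional Brownian motion with Hurst parameter $H$ is the $n$-dimensional centered Gaussian process with i.i.d. components, $X_0=0$, and $\mathbb E|X^i_t-X^i_s|^2=|t-s|^{2H}$ for each component. For $H>\frac13$ its canonical rough path is the limit of the lifts (by iterated integrals) of smooth approximations. *)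

(* Defs.v *)
From HB Require Import structures.
From mathcomp Require Import all_boot all_order all_algebra.
From mathcomp Require Import all_classical all_reals all_analysis.

Set Implicit Arguments.
Unset Strict Implicit.
Unset Printing Implicit Defensive.

Import Order.TTheory GRing.Theory Num.Theory.
Import numFieldNormedType.Exports.

Local Open Scope classical_set_scope.
Local Open Scope ring_scope.

(* Paths are functions on all of R of which only the restriction to [0, 1]
   matters.  Norms take values in \bar R, so that "finite" is "< +oo". *)

Section norms.
Context {R : realType}.

(* The Euclidean (Frobenius) norm; the norm `|M| of the library is the maximum
   norm. *)
Definition enorm (m n : nat) (M : 'M[R]_(m, n)) : R :=
  Num.sqrt (\sum_i \sum_j M i j ^+ 2).

Definition dotv (n : nat) (u v : 'cV[R]_n) : R := \sum_i u i 0 * v i 0.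

(* N is the norm on the codomain V. *)
Definition sup_norm (V : Type) (N : V -> R) (f : R -> V) : \bar R :=
  ereal_sup [set (N (f t))%:E | t in `[0, 1]].

Definition holder2 (V : Type) (N : V -> R) (g : R) (F : R -> R -> V) : \bar R :=
  ereal_sup [set (N (F p.1 p.2) / `|p.2 - p.1| `^ g)%:E | p in
    [set p : R * R | [/\ p.1 \in `[0, 1], p.2 \in `[0, 1] & p.1 != p.2]]].

Definition holder (V : zmodType) (N : V -> R) (g : R) (f : R -> V) : \bar R :=
  holder2 N g (fun s t => f t - f s).

Definition holder_norm (V : zmodType) (N : V -> R) (g : R) (f : R -> V)
  : \bar R := (sup_norm N f + holder N g f)%E.

End norms.

Section rough_paths.
Context {R : realType} {n : nat}.
Implicit Types (X Y A : R -> 'cV[R]_n) (XX : R -> R -> 'M[R]_n).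

Definition rough_path_norm (g : R) X XX : \bar R :=
  (holder (@enorm R n 1) g X + holder2 (@enorm R n n) (2 * g) XX)%E.

Definition rough_path_dist (g : R) X XX Y (YY : R -> R -> 'M[R]_n) : \bar R :=
  let path_diff t := Y t - X t in
  let area_diff s t := YY s t - XX s t in
  (holder_norm (@enorm R n 1) g path_diff
   + holder2 (@enorm R n n) (2 * g) area_diff)%E.

Record is_rough_path (g : R) X XX : Prop := IsRoughPath {
  rp_exponent : 3^-1 < g <= 2^-1 ;
  rp_path_continuous : {within `[0, 1], continuous X} ;
  rp_area_continuous :
    {within `[0, 1] `*` `[0, 1], continuous (fun p : R * R => XX p.1 p.2)} ;
  rp_chen : forall s u t : R, s \in `[0, 1] -> u \in `[0, 1] -> t \in `[0, 1] ->
    forall i j, XX s t i j - XX u t i j - XX s u i j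
                = (X u - X s) i 0 * (X t - X u) j 0 ;
  rp_norm_finite : (rough_path_norm g X XX < +oo)%E }.

Definition remainder X A (A' : R -> 'M[R]_n) (s t : R) : 'cV[R]_n :=
  (A t - A s) - A' s *m (X t - X s).

Record is_controlled (g : R) X A (A' : R -> 'M[R]_n) : Prop := IsControlled {
  controlled_path : (holder (@enorm R n 1) g A < +oo)%E ;
  controlled_derivative : (holder (@enorm R n n) g A' < +oo)%E ;
  controlled_remainder :
    (holder2 (@enorm R n 1) (2 * g) (remainder X A A') < +oo)%E }.

Definition controlled_norm (g : R) X A (A' : R -> 'M[R]_n) : \bar R :=
  ((enorm (A 0))%:E + holder_norm (@enorm R n n) g A'
   + holder2 (@enorm R n 1) (2 * g) (remainder X A A'))%E.

(* A partition 0 = t_0 < t_1 < ... < t_k = t is the sequence t_1, ..., t_k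
   (see itv_partition); its intervals are the pairs (t_l, t_(l+1)). *)
Definition itv_pairs (s : seq R) : seq (R * R) := zip (0 :: s) s.

Definition rough_sum X XX A (A' : R -> 'M[R]_n) (s : seq R) : R :=
  \sum_(p <- itv_pairs s)
    (\sum_j A p.1 j 0 * (X p.2 - X p.1) j 0
     + \sum_j \sum_k A' p.1 j k * XX p.1 p.2 k j).

(* The filter of partitions of [0, t] with mesh tending to 0. *)
Definition mesh_filter (t : R) : set_system (seq R) :=
  [set Q | exists2 d : R, 0 < d &
    forall s, itv_partition 0 t s ->
      (forall p, p \in itv_pairs s -> p.2 - p.1 < d) -> Q s].

Definition rough_integral X XX A (A' : R -> 'M[R]_n) (t : R) : R :=
  lim (rough_sum X XX A A' s @[s --> mesh_filter t]).

(* The process Z_t = int_0^t A_s dX_s + int_0^t B_s ds. *)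
Definition rough_process X XX A (A' : R -> 'M[R]_n) (B : R -> R) (t : R) : R :=
  rough_integral X XX A A' t + \int[lebesgue_measure]_(s in `[0, t]) B s.

Definition holder_rough_with (theta L : R) X : Prop :=
  forall (s eps : R) (phi : 'cV[R]_n), s \in `[0, 1] -> 0 < eps <= 2^-1 ->
    enorm phi = 1 ->
    exists t : R, [/\ t \in `[0, 1], `|t - s| <= eps
                & L * eps `^ theta < `|dotv phi (X t - X s)|].

Definition holder_rough (theta : R) X : Prop :=
  exists2 L, 0 < L & holder_rough_with theta L X.

(* The element 0 of the set makes the supremum 0 when X is not rough. *)
Definition roughness (theta : R) X : \bar R :=
  ereal_sup (0%E |` [set L%:E | L in
    [set L : R | 0 < L /\ holder_rough_with theta L X]]).

(* The iterated integral of a smooth path, oriented when t < s. *)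
Definition smooth_lift X (s t : R) : 'M[R]_n :=
  let dens i j u := (X u i 0 - X s i 0) * derive1 (fun v => X v j 0) u in
  \matrix_(i, j)
    if s <= t then \int[lebesgue_measure]_(u in `[s, t]) dens i j u
    else - \int[lebesgue_measure]_(u in `[t, s]) dens i j u.

Record is_mollifier (rho : R -> R) : Prop := IsMollifier {
  mollifier_smooth : forall k x, derivable (derive1n k rho) x 1 ;
  mollifier_support : exists K, forall x, K < `|x| -> rho x = 0 ;
  mollifier_ge0 : forall x, 0 <= rho x ;
  mollifier_mass : \int[lebesgue_measure]_x rho x = 1 }.

(* Convolution of X with e^-1 rho (./e), where X is extended from [0, 1] to R
   by the constants X_0 and X_1. *)
Definition mollify (rho : R -> R) (e : R) X (t : R) : 'cV[R]_n :=
  \col_i \int[lebesgue_measure]_u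
    (e^-1 * rho ((t - u) / e) * X (Num.max 0 (Num.min u 1)) i 0).

End rough_paths.

Section fractional_brownian_motion.
Context {R : realType} {n : nat} {d : measure_display} {T : measurableType d}.
Variable P : probability T R.
Implicit Types (X : T -> R -> 'cV[R]_n) (XX : T -> R -> R -> 'M[R]_n).

(* The degenerate law (variance 0) is allowed; normal_prob m 0 is not the
   Dirac mass at m. *)
Definition centered_gaussian (Y : T -> R) : Prop :=
  exists sigma : R, forall B : set R, measurable B ->
    P (Y @^-1` B) = if sigma == 0 then \d_(0 : R) B else normal_prob 0 sigma B.

Definition centered_gaussian_process X : Prop :=
  forall (k : nat) (t : 'I_k -> R) (a : 'I_k -> 'cV[R]_n),
    (forall l, t l \in `[0, 1]) ->
    centered_gaussian (fun w => \sum_l dotv (a l) (X w (t l))).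

(* The sigma-algebra generated by the i-th component. *)
Definition component_sigma X (i : 'I_n) : set (set T) :=
  <<s [set E | exists (t : R) (B : set R), [/\ t \in `[0, 1], measurable B
                 & E = (fun w => X w t i 0) @^-1` B]] >>.

Definition independent_components X : Prop :=
  forall E : 'I_n -> set T, (forall i, component_sigma X i (E i)) ->
    P (\bigcap_i E i) = (\prod_(i < n) P (E i))%E.

Definition identically_distributed_components X : Prop :=
  forall (i j : 'I_n) (k : nat) (t : 'I_k -> R) (B : 'I_k -> set R),
    (forall l, t l \in `[0, 1]) -> (forall l, measurable (B l)) ->
    P (\bigcap_l ((fun w => X w (t l) i 0) @^-1` B l))
    = P (\bigcap_l ((fun w => X w (t l) j 0) @^-1` B l)).

Record is_fbm (H : R) X : Prop := IsFbm {
  fbm_measurable : forall (t : R) i, t \in `[0, 1] ->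
    measurable_fun setT (fun w => X w t i 0) ;
  fbm_gaussian : centered_gaussian_process X ;
  fbm_independent : independent_components X ;
  fbm_identically_distributed : identically_distributed_components X ;
  fbm_start : {ae P, forall w, X w 0 = 0} ;
  fbm_variance : forall (s t : R) i, s \in `[0, 1] -> t \in `[0, 1] ->
    ('E_P[(fun w => `|X w t i 0 - X w s i 0| ^+ 2)%R])%E
    = (`|t - s| `^ (2 * H))%:E }.

(* The limit of the lifts of smooth approximations is taken almost surely along
   the mollifications at scale 2^-m, in every gamma-Hoelder rough path distance
   with 1/3 < gamma < H. *)
Record is_canonical_fbm_rough_path (H : R) X XX : Prop :=
  IsCanonicalFbmRoughPath {
  canonical_fbm : is_fbm H X ;
  canonical_measurable : forall (s t : R) i j, s \in `[0, 1] -> t \in `[0, 1] ->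
    measurable_fun setT (fun w => XX w s t i j) ;
  canonical_rough_path : forall g, 3^-1 < g < H -> forall w,
    is_rough_path g (X w) (XX w) ;
  canonical_limit : forall rho g, is_mollifier rho -> 3^-1 < g < H ->
    {ae P, forall w,
      (let Xm := mollify rho (2 ^- m) (X w) in
       rough_path_dist g (X w) (XX w) Xm (smooth_lift Xm))
       @[m --> \oo] --> 0%E} }.

End fractional_brownian_motion.

(* Main.v *)
Require Import Defs.
From HB Require Import structures.
From mathcomp Require Import all_boot all_order all_algebra.
From mathcomp Require Import all_classical all_reals all_analysis.
From mathcomp Require Import measurable_realfun.
From mathcomp Require Import ring lra.
From mathcomp Require mpoly.

Import Order.TTheory GRing.Theory Num.Theory.
Import numFieldNormedType.Exports.

Local Open Scope classical_set_scope.
Local Open Scope ring_scope.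

Set Implicit Arguments.
Unset Strict Implicit.
Unset Printing Implicit Defensive.

(** Analytic half.  The defining sums of the rough integral are sums of a germ whose
    defect is of order 3 gamma > 1, so by sewing they converge, and the integral over
    [s, t] is the germ up to |t - s|^(3 gamma).  Hence the increment of the process
    over [s, t] is A_s (X_t - X_s) up to order 2 gamma, and smallness of the process
    forces A_s (X_t - X_s) to be small for all t near s.  Roughness provides, at every
    scale eps, a time t at which this product is at least L eps^theta |A_s|; since
    theta < 2 gamma, optimizing over eps bounds |A_s| by a power of the norm of the
    process (rough_interpolation, A_small).  The same argument applied to the
    increments of A, which are A' (X_t - X_s) up to order 2 gamma, bounds A'.  Cutting
    [0, t] into N pieces then bounds the rough integral (sewn_small), hence the drift
    integral, and B is recovered by a difference quotient (B_small).  Each step costs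
    a factor in the exponent and a power of one constant Q, linear in the inverse of
    the modulus L and polynomial in the norms (rough_norris).

    Probabilistic half.  Fix k equally spaced increments of fractional Brownian motion
    of step h.  For H <= 1/2 their covariance matrix has nonpositive entries off the
    diagonal and positive row sums, hence is at least lam h^(2 H) times the identity
    (incr_cov_coercive); by independence of the components this holds for the
    increments tested against any unit direction.  A Gaussian vector with such a
    covariance stays in the cube of side y h^H with probability at most
    (C y)^k (small_ball_le): as exp(- x^2 / 2) is an average of characters, this
    follows from a bound on the characteristic function.  As k is arbitrary, the
    estimate survives a union over a grid of directions of
    size polynomial in 1 / y (fbm_inf_small_ball).

    If the modulus of theta-roughness is below x, then on some dyadic interval of
    length b some direction has all its increments below a multiple of x b^theta
    (rough_of_increments).  Since theta > H this threshold is x b^(theta - H) relative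
    to the natural size b^H, so the probabilities are summable over all dyadic
    intervals and P(L < x) is bounded by any power of x (fbm_roughness_tail); this
    gives all inverse moments (inverse_moment_of_tail).  The modulus is a supremum
    over uncountable families; by Hoelder continuity of the paths its superlevel
    sets are described by rational times, rational radii and integer directions,
    which gives measurability (roughness_gtP). *)

(** * Powers *)

Lemma sqr_norm_real (R : realType) (x : R) : `|x| ^+ 2 = x ^+ 2.
Proof. by rewrite real_normK// num_real. Qed.

Lemma powR_anti (R : realType) (x p q : R) : 0 <= x <= 1 -> 0 < p -> p <= q ->
  x `^ q <= x `^ p.
Proof.
move=> /andP[x0 x1] p0 pq; move: x0; rewrite le_eqVlt => /predU1P[<-|x0].
  by rewrite !powR0// gt_eqF// (lt_le_trans p0).
by apply: ger_powR => //; rewrite x0 x1.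
Qed.

Lemma powR_mono (R : realType) (x y p : R) : 0 <= p -> 0 <= x -> x <= y -> x `^ p <= y `^ p.
Proof.
by move=> p0 x0 xy; rewrite ge0_ler_powR// nnegrE (le_trans x0).
Qed.

Lemma powR_le1 (R : realType) (x p : R) : 0 <= p -> 0 <= x -> x <= 1 -> x `^ p <= 1.
Proof. by move=> p0 x0 x1; have := powR_mono p0 x0 x1; rewrite powR1. Qed.

(** * Sewing *)

Section sewing.
Context {R : realType}.
Implicit Types (s r : seq R) (a b t u v : R).

Definition partition_sum (Xi : R -> R -> R) a s : R :=
  \sum_(p <- zip (a :: s) s) Xi p.1 p.2.

Lemma partition_sum_nil Xi a : partition_sum Xi a [::] = 0.
Proof. by rewrite /partition_sum big_nil. Qed.

Lemma partition_sum_cons Xi a b s :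
  partition_sum Xi a (b :: s) = Xi a b + partition_sum Xi b s.
Proof. by rewrite /partition_sum /= big_cons. Qed.

Lemma partition_sum_cat Xi a s r : partition_sum Xi a (s ++ r) =
  partition_sum Xi a s + partition_sum Xi (last a s) r.
Proof.
elim: s a => [|b s IH] a /=; first by rewrite partition_sum_nil add0r.
by rewrite !partition_sum_cons IH addrA.
Qed.

Lemma path_last_ge a s : path <=%R a s -> a <= last a s.
Proof.
by elim: s a => //= b s IH a /andP[ab /IH]; exact: le_trans.
Qed.

Lemma path_le_last a s z : path <=%R a s -> z \in s -> z <= last a s.
Proof.
elim: s a => //= b s IH a /andP[ab pbs]; rewrite inE => /predU1P[->|].
  exact: path_last_ge.
exact: IH.
Qed.

Lemma split_path_at a s m : path <=%R a s -> a <= m -> m < last a s ->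
  exists s1 v s2, s = s1 ++ v :: s2 /\ last a s1 <= m < v.
Proof.
elim: s a => [|b s IH] a /=; first by move=> _ am /lt_geF; rewrite am.
case/andP=> ab pbs am ml; have [bm|mb] := leP b m; last first.
  by exists [::], b, s; rewrite /= am mb.
have [s1 [v [s2 [-> H]]]] := IH _ pbs bm ml.
by exists (b :: s1), v, s2.
Qed.

(** The solution C of C = 2^(1 - alpha) C + 2, the recursion that the error
    constant satisfies under bisection. *)
Definition sewing_const (alpha : R) : R := 2 / (1 - 2 `^ (1 - alpha)).

Lemma sewing_const_denom_gt0 (alpha : R) : 1 < alpha -> 0 < 1 - 2 `^ (1 - alpha).
Proof.
move=> a1; rewrite subr_gt0 -[X in _ < X](powRr0 2).
rewrite /powR pnatr_eq0/= ltr_expR mul0r.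
rewrite nmulr_rlt0 ?subr_lt0// ln_gt0//; lra.
Qed.

Lemma sewing_const_ge2 (alpha : R) : 1 < alpha -> 2 <= sewing_const alpha.
Proof.
move=> a1; rewrite /sewing_const ler_pdivlMr; last exact: sewing_const_denom_gt0.
have := powR_ge0 2 (1 - alpha); lra.
Qed.

Variables (Xi : R -> R -> R) (K alpha : R).
Hypothesis alpha1 : 1 < alpha.
Hypothesis K0 : 0 <= K.
Hypothesis Xi_defect : forall a u b, 0 <= a -> a <= u -> u <= b -> b <= 1 ->
  `|Xi a b - Xi a u - Xi u b| <= K * (b - a) `^ alpha.

Local Notation C := (sewing_const alpha * K).

Let C0 : 0 <= C.
Proof.
rewrite mulr_ge0//; have := sewing_const_ge2 alpha1; lra.
Qed.

Let alpha0 : alpha != 0. Proof. by apply/eqP => a0; move: alpha1; lra. Qed.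

Let alpha_ge0 : 0 <= alpha. Proof. by move: alpha1; lra. Qed.

Lemma defect_diag a : 0 <= a <= 1 -> Xi a a = 0.
Proof.
case/andP=> a0 a1; have := Xi_defect a0 (lexx _) (lexx _) a1.
rewrite !subrr powR0// mulr0 sub0r normrN normr_le0; exact/eqP.
Qed.

Lemma partition_sum_loop a s : 0 <= a <= 1 -> path <=%R a s -> last a s = a ->
  partition_sum Xi a s = 0.
Proof.
move=> a01; elim: s => [|c s IHs] /=; first by rewrite partition_sum_nil.
case/andP => ac pcs lcs.
have ca : c = a.
  by apply/eqP; rewrite eq_le ac -[X in _ <= X]lcs path_last_ge.
rewrite partition_sum_cons ca defect_diag ?a01// add0r.
by apply: IHs; rewrite -?ca// lcs ca.
Qed.

Lemma sewing_const_fixpoint : C * (2 `^ (1 - alpha)) + 2 * K = C.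
Proof.
have := sewing_const_denom_gt0 alpha1; rewrite /sewing_const.
move: (2 `^ _) => x x1; have x10 : 1 - x != 0 by rewrite gt_eqF.
by field.
Qed.

(** Instead of removing points one at a time, the partition is cut at the
    subinterval that contains the midpoint: both outer pieces have at most half
    the length, and 2 * 2^-alpha < 1 absorbs the error. *)
Lemma sewing_partition a s b : 0 <= a -> b <= 1 -> path <=%R a s ->
  last a s = b -> `|partition_sum Xi a s - Xi a b| <= C * (b - a) `^ alpha.
Proof.
have [k] := ubnP (size s); elim: k a s b => // k IH a s b.
rewrite ltnS => sk a0 b1 pas lasb.
have ab : a <= b by rewrite -lasb path_last_ge.
move: (ab); rewrite le_eqVlt => /predU1P[eab|ltab].
  have a1 : a <= 1 by rewrite eab.
  rewrite -eab subrr powR0// mulr0 defect_diag ?a0 ?a1// subr0.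
  by rewrite partition_sum_loop ?a0 ?a1 ?normr0// lasb eab.
pose m := (a + b) / 2.
have am : a <= m by rewrite /m; lra.
have mb : m < last a s by rewrite lasb /m; lra.
have [s1 [v [s2 [es /andP[um mv]]]]] := split_path_at pas am mb.
rewrite es partition_sum_cat partition_sum_cons.
move: pas lasb; rewrite es last_cat cat_path /= => /and3P[p1 uv p2] l2.
set u := last a s1 in um uv p1 *.
have au : a <= u by exact: path_last_ge.
have ub : u <= b by rewrite (le_trans uv)// -l2 path_last_ge.
have vb : v <= b by rewrite -l2 path_last_ge.
have s1k : (size s1 < k)%N.
  by rewrite (leq_trans _ sk)// es size_cat /= addnS ltnS leq_addr.
have s2k : (size s2 < k)%N.
  by rewrite (leq_trans _ sk)// es size_cat /= addnS ltnS leq_addl.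
have u1 : u <= 1 by lra.
have v0 : 0 <= v by lra.
have H1 := IH _ _ _ s1k a0 u1 p1 erefl.
have H2 := IH _ _ _ s2k v0 b1 p2 l2.
have D1 : `|Xi a b - Xi a u - Xi u b| <= K * (b - a) `^ alpha.
  by apply: Xi_defect => //; rewrite (le_trans uv).
have D2 : `|Xi u b - Xi u v - Xi v b| <= K * (b - a) `^ alpha.
  apply: (le_trans (Xi_defect _ _ _ _)) => //; first by rewrite (le_trans a0).
  by rewrite ler_wpM2l// powR_mono// ?subr_ge0// lerD2l lerN2.
have half x : 0 <= x -> x <= (b - a) / 2 ->
    C * x `^ alpha <= C * (2 `^ (1 - alpha)) / 2 * (b - a) `^ alpha.
  move=> x0 xab; rewrite -[leRHS]mulrA -[leRHS]mulrA ler_wpM2l//.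
  apply: (@le_trans _ _ (((b - a) / 2) `^ alpha)).
    exact: powR_mono.
  rewrite powRM; [|lra|lra].
  rewrite powRB ?powRr1 ?pnatr_eq0 ?implybT// [leLHS]mulrC mulrA ler_wpM2r ?powR_ge0//.
  by rewrite -powR_inv1// -powRrM mulN1r powRN mulrAC powR_inv1// divff ?mul1r.
have {}H1 := le_trans H1 (half _ _ _).
have {}H2 := le_trans H2 (half _ _ _).
have {}H1 : `|partition_sum Xi a s1 - Xi a u| <=
    C * 2 `^ (1 - alpha) / 2 * (b - a) `^ alpha.
  by apply: H1; move: um; rewrite /m; lra.
have {}H2 : `|partition_sum Xi v s2 - Xi v b| <=
    C * 2 `^ (1 - alpha) / 2 * (b - a) `^ alpha.
  by apply: H2; move: mv; rewrite /m; lra.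
have -> : C * (b - a) `^ alpha = (C * 2 `^ (1 - alpha) / 2 * (b - a) `^ alpha)
    + (C * 2 `^ (1 - alpha) / 2 * (b - a) `^ alpha)
    + K * (b - a) `^ alpha + K * (b - a) `^ alpha.
  by rewrite -[in LHS]sewing_const_fixpoint; field.
move: H1 H2 D1 D2; rewrite -/u.
move: (C * 2 `^ _ / _ * _) (K * _ `^ _) => x y.
move: (partition_sum Xi a s1) (partition_sum Xi v s2) => S1 S2.
rewrite !ler_norml; lra.
Qed.

(** The error that sewing_partition allows when each interval of the partition
    is subdivided further. *)
Definition gauge a s : R :=
  partition_sum (fun u v => C * (v - u) `^ alpha) a s.

Lemma sewing_refine a s r : 0 <= a -> last a s <= 1 ->
  path <%R a s -> path <=%R a r -> {subset s <= r} -> last a r = last a s ->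
  `|partition_sum Xi a r - partition_sum Xi a s| <= gauge a s.
Proof.
elim: s a r => [|y s IH] a r /= a0 l1 ps pr sr lr.
  rewrite partition_sum_nil subr0 /gauge partition_sum_nil.
  have := sewing_partition a0 l1 pr lr.
  by rewrite defect_diag ?a0// subr0 subrr powR0// mulr0.
case/andP: ps => ay pys.
have yr : y \in r by apply: sr; rewrite mem_head.
move: pr sr lr; case/splitPr: yr => r1 r2.
rewrite -cat_rcons cat_path last_cat last_rcons => /andP[p1 p2] sr lr.
have y1 : y <= 1.
  apply: le_trans l1; apply: path_last_ge.
  by apply: sub_path pys => ? ? /ltW.
rewrite partition_sum_cat partition_sum_cons last_rcons.
have H1 := sewing_partition a0 y1 p1 (last_rcons _ _ _).
have sr2 : {subset s <= r2}.
  move=> z zs; have yz : y < z.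
    by move: pys; rewrite lt_path_sortedE => /andP[/allP/(_ _ zs)].
  have : z \in rcons r1 y ++ r2 by apply: sr; rewrite inE zs orbT.
  rewrite mem_cat => /orP[|//] zr1; exfalso.
  have : z <= y.
    by have := path_le_last p1 zr1; rewrite last_rcons.
  by rewrite leNgt yz.
have y0 : 0 <= y by rewrite (le_trans a0)// ltW.
have H2 := IH _ _ y0 l1 pys p2 sr2 lr.
rewrite /gauge partition_sum_cons -/(gauge y s).
apply: (le_trans _ (lerD H1 H2)).
rewrite opprD addrACA; exact: ler_normD.
Qed.

Definition fine_partition a b d s : Prop :=
  itv_partition a b s /\ forall p, p \in zip (a :: s) s -> p.2 - p.1 < d.

Lemma zip_consecutive_cat a s r : zip (a :: s ++ r) (s ++ r) =
  zip (a :: s) s ++ zip (last a s :: r) r.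
Proof. by elim: s a => //= b s IH a; rewrite IH. Qed.

Lemma fine_partition_exists a b d : a <= b -> 0 < d ->
  exists s, fine_partition a b d s.
Proof.
move=> ab d0; set N := Num.bound ((b - a) / (d / 2)).
have d20 : 0 < d / 2 by rewrite divr_gt0.
have : b - a <= N%:R * (d / 2).
  rewrite /N -ler_pdivrMr//; apply/ltW; apply: le_lt_trans (archi_boundP _).
    by [].
  by rewrite divr_ge0 ?subr_ge0 // ltW.
move: N => N; elim: N a ab => [|N IH] a ab; move: (ab); rewrite le_eqVlt => /predU1P[->|ltab].
- by exists [::]; split => //; split => /=.
- by rewrite mul0r subr_le0 leNgt ltab.
- by exists [::]; split => //; split => /=.
rewrite -natr1 mulrDl mul1r => H.
have [bd|db] := leP b (a + d / 2).
  exists [:: b]; split; first by split; rewrite /= ?ltab.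
  by move=> p; rewrite /= inE => /eqP -> /=; lra.
have [||s [[ps ls] fs]] := IH (a + d / 2); [lra|lra|].
exists (a + d / 2 :: s); split.
  by split => //=; rewrite ps andbT; lra.
move=> p; rewrite /= inE => /predU1P[-> /=|]; first by lra.
exact: fs.
Qed.

Lemma itv_partition_le_path a b s : itv_partition a b s -> path <=%R a s.
Proof. by case=> ps _; apply: sub_path ps => ? ? /ltW. Qed.

(** Since alpha > 1, each term is the length of an interval times a positive power
    of the mesh, and the lengths add up to b - a. *)
Lemma gauge_le a b d s : fine_partition a b d s ->
  gauge a s <= C * d `^ (alpha - 1) * (b - a).
Proof.
case=> ps; have := itv_partition_le_path ps; case: ps => _ /eqP <- {b}.
rewrite /gauge; elim: s a => [|b s IH] a /=.
  by rewrite partition_sum_nil subrr mulr0.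
case/andP => ab pbs fs; rewrite partition_sum_cons.
have bad : b - a < d by apply: (fs (a, b)); rewrite mem_head.
have -> : last b s - a = (b - a) + (last b s - b) by ring.
rewrite mulrDr lerD//; last first.
  by apply: IH => // p ps; apply: fs; rewrite inE ps orbT.
rewrite -[leRHS]mulrA ler_wpM2l// -mulr_powRB1 ?subr_ge0//; last first.
  by move: alpha1; lra.
rewrite mulrC ler_wpM2r ?subr_ge0//; apply: powR_mono.
- by move: alpha1; lra.
- by rewrite subr_ge0.
- exact: ltW.
Qed.

(** Both sums are compared with the sum over the common refinement. *)
Lemma partition_sums_close a b d s r : 0 <= a -> b <= 1 ->
  fine_partition a b d s -> fine_partition a b d r ->
  `|partition_sum Xi a s - partition_sum Xi a r|
    <= 2 * (C * d `^ (alpha - 1) * (b - a)).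
Proof.
move=> a0 b1 fs fr; pose q := sort <=%R (s ++ r).
have [ps ls] := fs.1; have [pr lr] := fr.1.
have ps' := itv_partition_le_path fs.1; have pr' := itv_partition_le_path fr.1.
have pq : path <=%R a q.
  rewrite path_sortedE; last exact: le_trans.
  rewrite (sort_sorted (@le_total _ _)) andbT all_sort all_cat; move: ps' pr'.
  by rewrite !(path_sortedE le_trans) => /andP[-> _] /andP[-> _].
have lq : last a q = b.
  apply/eqP; rewrite eq_le; apply/andP; split.
    have : last a q \in a :: q by exact: mem_last.
    rewrite inE => /predU1P[->|]; first by rewrite -(eqP ls) path_last_ge.
    rewrite mem_sort mem_cat => /orP[|] H.
      by rewrite -(eqP ls) path_le_last.
    by rewrite -(eqP lr) path_le_last.
  have : b \in a :: s by rewrite -(eqP ls) mem_last.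
  rewrite inE => /predU1P[->|H]; first exact: path_last_ge.
  by rewrite path_le_last// mem_sort mem_cat H.
have H w : fine_partition a b d w -> {subset w <= q} ->
    `|partition_sum Xi a q - partition_sum Xi a w|
      <= C * d `^ (alpha - 1) * (b - a).
  move=> fw wq; apply: le_trans (gauge_le fw).
  case: (fw.1) => pw /eqP lw.
  by apply: sewing_refine => //; rewrite ?lw.
have H1 := H _ fs; have H2 := H _ fr.
have {}H1 : `|partition_sum Xi a q - partition_sum Xi a s|
      <= C * d `^ (alpha - 1) * (b - a).
  by apply: H1 => z zs; rewrite mem_sort mem_cat zs.
have {}H2 : `|partition_sum Xi a q - partition_sum Xi a r|
      <= C * d `^ (alpha - 1) * (b - a).
  by apply: H2 => z zs; rewrite mem_sort mem_cat zs orbT.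
move: H1 H2; rewrite !ler_norml; lra.
Qed.

Lemma mesh_filter_proper t : 0 <= t -> ProperFilter (mesh_filter t).
Proof.
move=> t0; apply: Build_ProperFilter_ex.
  move=> Q [d d0 HQ]; have [s [ps fs]] := fine_partition_exists t0 d0.
  by exists s; apply: HQ.
split.
- by exists 1.
- move=> Q Q' [d d0 HQ] [d' d'0 HQ']; exists (Num.min d d').
    by rewrite lt_min d0.
  move=> s ps fs; split; [apply: HQ|apply: HQ'] => // p /fs;
    by rewrite lt_min => /andP[].
- by move=> Q Q' QQ' [d d0 HQ]; exists d => // s ps /(HQ _ ps)/QQ'.
Qed.

Lemma mesh_error_small (M e : R) : 0 <= M -> 0 < e ->
  exists2 d : R, 0 < d & M * d `^ (alpha - 1) < e.
Proof.
move=> M0 e0; have a10 : 0 < alpha - 1 by move: alpha1; lra.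
exists ((e / (M + 1)) `^ (alpha - 1)^-1).
  by rewrite powR_gt0// divr_gt0//; lra.
rewrite -powRrM mulVf ?gt_eqF// powRr1; last by rewrite divr_ge0 ?addr_ge0// ltW.
rewrite mulrCA -[X in _ < X]mulr1 (ltr_pM2l e0) ltr_pdivrMr; lra.
Qed.

Definition sewn t : R := lim (partition_sum Xi 0 s @[s --> mesh_filter t]).

(** The sums are Cauchy along the mesh filter by partition_sums_close. *)
Lemma sewn_cvg t : 0 <= t <= 1 ->
  partition_sum Xi 0 s @[s --> mesh_filter t] --> sewn t.
Proof.
case/andP=> t0 t1; have FF := mesh_filter_proper t0.
apply/(@cauchy_cvgP _ _ _).
apply: cauchy_exP => e e0.
have [|d d0 He] := @mesh_error_small (2 * (C * t)) e _ e0.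
  by rewrite mulr_ge0// mulr_ge0.
have [s fs] := fine_partition_exists t0 d0.
exists (partition_sum Xi 0 s); exists d => // r pr fr.
apply: le_lt_trans He.
have fr' : fine_partition 0 t d r by split.
have := partition_sums_close (lexx 0) t1 fs fr'.
by rewrite subr0 -!mulrA (mulrC t).
Qed.

Lemma sewn_approx t e : 0 <= t <= 1 -> 0 < e -> exists2 d : R, 0 < d &
  forall s, fine_partition 0 t d s -> `|sewn t - partition_sum Xi 0 s| < e.
Proof.
move=> t01 e0; case/andP: (t01) => t0 t1; have FF := mesh_filter_proper t0.
have /cvgrPdist_lt/(_ _ e0)[d d0 H] := sewn_cvg t01.
by exists d => // s [ps fs]; exact: H.
Qed.

(** A fine partition of [0, a] followed by a fine partition of [a, t] is a fine
    partition of [0, t], so the difference of the two limits is approximated by a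
    sum over [a, t] alone, to which sewing_partition applies. *)
Lemma sewn_estimate a t : 0 <= a -> a <= t -> t <= 1 ->
  `|sewn t - sewn a - Xi a t| <= C * (t - a) `^ alpha.
Proof.
move=> a0 at1 t1; apply/ler_addgt0Pr => e e0.
have e20 : 0 < e / 2 by rewrite divr_gt0.
have a01 : 0 <= a <= 1 by rewrite a0 (le_trans at1).
have t01 : 0 <= t <= 1 by rewrite t1 (le_trans a0).
have [d1 d10 H1] := sewn_approx a01 e20.
have [d2 d20 H2] := sewn_approx t01 e20.
pose d := Num.min d1 d2.
have d0 : 0 < d by rewrite lt_min d10.
have [q [[pq lq] fq]] := fine_partition_exists a0 d0.
have [r [[pr lr] fr]] := fine_partition_exists at1 d0.
have {}H1 := H1 q; have {}H2 := H2 (q ++ r).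
have {}H1 : `|sewn a - partition_sum Xi 0 q| < e / 2.
  by apply: H1; split => // p /fq; rewrite lt_min => /andP[].
have {}H2 : `|sewn t - partition_sum Xi 0 (q ++ r)| < e / 2.
  apply: H2; split.
    by split; rewrite ?cat_path ?last_cat ?(eqP lq) ?pq.
  move=> p; rewrite zip_consecutive_cat (eqP lq) mem_cat => /orP[/fq|/fr];
    by rewrite lt_min => /andP[].
have H3 := sewing_partition a0 t1 (itv_partition_le_path (conj pr lr)) (eqP lr).
move: H1 H2 H3; rewrite partition_sum_cat (eqP lq) !ltr_norml !ler_norml.
move: (sewn t) (sewn a) (partition_sum _ _ _) (partition_sum _ _ _) => x y z z'.
lra.
Qed.

Lemma sewn0 : sewn 0 = 0.
Proof.
have H : forall e, 0 < e -> `|sewn 0| <= e.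
  move=> e e0; have [|d d0 H] := @sewn_approx 0 e _ e0; first by rewrite lexx ler01.
  have := H [::]; rewrite partition_sum_nil subr0 => K'; apply/ltW/K'.
  by split => //; split => /=.
apply/eqP; rewrite -normr_le0; apply/ler_addgt0Pr => e e0.
by rewrite add0r H.
Qed.

End sewing.

(** * The quantitative Norris argument *)

Section germ.
Context {R : realType} {n : nat}.
Variables (X A : R -> 'cV[R]_n) (XX : R -> R -> 'M[R]_n) (A' : R -> 'M[R]_n).

(** The compensated summand of the rough integral, so that rough_integral unfolds
    to the sewn function of this germ. *)
Definition germ (u v : R) : R :=
  \sum_j A u j 0 * (X v - X u) j 0 + \sum_j \sum_k A' u j k * XX u v k j.

Hypothesis chen : forall s u t : R,
  s \in `[0, 1] -> u \in `[0, 1] -> t \in `[0, 1] ->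
  forall i j, XX s t i j - XX u t i j - XX s u i j
              = (X u - X s) i 0 * (X t - X u) j 0.

(** By Chen's relation the terms of second order cancel; what is left pairs a
    remainder with an increment of X, or an increment of A' with the area, and is
    of order 3 gamma > 1. *)
Lemma germ_defect s u t :
  s \in `[0, 1] -> u \in `[0, 1] -> t \in `[0, 1] ->
  germ s t - germ s u - germ u t =
  - (\sum_j remainder X A A' s u j 0 * (X t - X u) j 0
     + \sum_j \sum_k (A' u j k - A' s j k) * XX u t k j).
Proof.
move=> s01 u01 t01; rewrite /germ -!big_split/= -!sumrB -sumrN.
apply: eq_bigr => j _.
have -> : remainder X A A' s u j 0 =
    A u j 0 - A s j 0 - \sum_k A' s j k * (X u - X s) k 0.
  by rewrite /remainder !mxE.
have E : \sum_k A' s j k * XX s t k j = \sum_k A' s j k * XX s u k j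
    + \sum_k A' u j k * XX u t k j
    - \sum_k (A' u j k - A' s j k) * XX u t k j
    + (\sum_k A' s j k * (X u - X s) k 0) * (X t - X u) j 0.
  rewrite mulr_suml -sumrN -!big_split/=; apply: eq_bigr => k _.
  rewrite -mulrA -chen//; ring.
rewrite E !mxE; ring.
Qed.

End germ.

Lemma norm_sum_le (R : realType) (n : nat) (F : 'I_n -> R) (M : R) :
  (forall i, `|F i| <= M) -> `|\sum_i F i| <= n%:R * M.
Proof.
move=> H; apply: le_trans (ler_norm_sum _ _ _) _.
apply: le_trans (ler_sum _ (fun i _ => H i)) _.
by rewrite sumr_const card_ord mulr_natl.
Qed.

(** Balancing the two terms at eps = y^(1/(a+b)); when this exceeds 1/2, the a
    priori bound x <= D takes over because y is then bounded below. *)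
Lemma interpolation (R : realType) (x y D a b : R) : 0 <= x -> 0 <= y ->
  0 <= a -> 0 < b <= 1 -> x <= D ->
  (forall eps, 0 < eps <= 2^-1 -> x <= D * (y * eps `^ (- a) + eps `^ b)) ->
  x <= 2 * D * y `^ (b / (a + b)).
Proof.
move=> x0 y0 a0 /andP[b0 b1] xD H.
have D0 : 0 <= D by rewrite (le_trans x0).
have ab0 : 0 < a + b by lra.
move: y0; rewrite le_eqVlt => /predU1P[y0|y0].
  rewrite -y0 powR0; last by rewrite mulf_neq0 ?invr_eq0 ?gt_eqF.
  rewrite mulr0; apply/ler_addgt0Pr => e e0; rewrite add0r.
  pose eps := Num.min 2^-1 ((e / (D + 1)) `^ b^-1).
  have D1 : 0 < D + 1 by lra.
  have eps0 : 0 < eps.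
    by rewrite lt_min invr_gt0 ltr0n/= powR_gt0// divr_gt0.
  have : 0 < eps <= 2^-1 by rewrite eps0 ge_min lexx.
  move/H; rewrite -y0 mul0r add0r => /le_trans; apply.
  apply: (@le_trans _ _ (D * (e / (D + 1)))).
    rewrite ler_wpM2l//; apply: (@le_trans _ _ (((e / (D + 1)) `^ b^-1) `^ b)).
      by apply: powR_mono => //; [exact: ltW|exact: ltW|rewrite ge_min lexx orbT].
    by rewrite -powRrM mulVf ?gt_eqF// powRr1// divr_ge0// ltW.
  by rewrite mulrCA -[leRHS]mulr1 (ler_pM2l e0) ler_pdivrMr//; lra.
pose eps := y `^ (a + b)^-1.
have eps0 : 0 < eps by rewrite powR_gt0.
have Eb : y `^ (b / (a + b)) = eps `^ b by rewrite /eps -powRrM mulrC.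
have [le2|gt2] := leP eps 2^-1.
  have := H eps; rewrite eps0 le2 => /(_ isT).
  have -> : y * eps `^ (- a) = eps `^ b.
    have -> : y = eps `^ (a + b).
      by rewrite /eps -powRrM mulVf ?gt_eqF// powRr1// ltW.
    rewrite -powRD; first by congr (_ `^ _); ring.
    by rewrite (gt_eqF eps0) implybT.
  by rewrite Eb -mulr2n -(mulr_natl (eps `^ b)) mulrA (mulrC D).
apply: (le_trans xD); rewrite Eb -mulrA mulrCA ler_peMr//.
apply: (@le_trans _ _ (2 * (2^-1) `^ b)); last first.
  by rewrite ler_wpM2l//; apply: powR_mono; rewrite ?invr_ge0//; exact: ltW.
apply: (@le_trans _ _ (2 * 2^-1 `^ 1)); first by rewrite powRr1// divff.
by rewrite ler_wpM2l//; apply: powR_anti; lra.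
Qed.

Section norris.
Context {R : realType} {n : nat}.
Variables (X A : R -> 'cV[R]_n) (XX : R -> R -> 'M[R]_n) (A' : R -> 'M[R]_n).
Variables (B IB : R -> R) (g theta K Q z : R).

Local Notation I01 t := (0 <= (t : R) <= 1).
Local Notation sigma := (sewing_const (3 * g)).
Local Notation nu := (n%:R : R).
Local Notation I := (sewn (germ X A XX A')).

Hypothesis g_range : 3^-1 < g <= 2^-1.
Hypothesis theta_gt0 : 0 < theta.
Hypothesis theta_lt : theta < 2 * g.
Hypothesis n_gt0 : (0 < n)%N.
Hypothesis K_ge1 : 1 <= K.
(* All constants below are powers of the single number Q, which dominates the
   dimension, the sewing constant, the norms and the inverse roughness.  A sum of
   at most four terms Q ^+ k is absorbed in Q ^+ k.+1 because 4 <= Q. *)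
Hypothesis Q_ge4 : 4 <= Q.
Hypothesis Q_ge_sigma : sigma <= Q.
Hypothesis Q_ge_nu : nu <= Q.
Hypothesis Q_ge_K : K <= Q.

Hypothesis chen : forall s u t : R,
  s \in `[0, 1] -> u \in `[0, 1] -> t \in `[0, 1] ->
  forall i j, XX s t i j - XX u t i j - XX s u i j
              = (X u - X s) i 0 * (X t - X u) j 0.
Hypothesis X_holder : forall s t i, I01 s -> I01 t ->
  `|(X t - X s) i 0| <= K * `|t - s| `^ g.
Hypothesis XX_holder : forall s t i j, I01 s -> I01 t ->
  `|XX s t i j| <= K * `|t - s| `^ (2 * g).
Hypothesis A0_bounded : forall i, `|A 0 i 0| <= K.
Hypothesis A'_bounded : forall t i j, I01 t -> `|A' t i j| <= K.
Hypothesis A'_holder : forall s t i j, I01 s -> I01 t ->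
  `|A' t i j - A' s i j| <= K * `|t - s| `^ g.
Hypothesis R_holder : forall s t i, I01 s -> I01 t ->
  `|remainder X A A' s t i 0| <= K * `|t - s| `^ (2 * g).
Hypothesis B_bounded : forall t, I01 t -> `|B t| <= K.
Hypothesis IB0 : IB 0 = 0.
Hypothesis IB_expansion : forall u v w : R, 0 <= u -> u <= w -> w <= v -> v <= 1 ->
  `|IB v - IB u - B w * (v - u)| <= K * (v - u) `^ (1 + g).
Hypothesis X_rough : forall (s eps : R) (v : 'I_n -> R) (beta : R), I01 s ->
  0 < eps <= 2^-1 ->
  (forall t, I01 t -> `|t - s| <= eps ->
     `|\sum_j v j * (X t - X s) j 0| <= beta) ->
  forall i, `|v i| <= Q * (beta * eps `^ (- theta)).
Hypothesis z_ge0 : 0 <= z.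
Hypothesis Z_bounded : forall t, I01 t -> `|I t + IB t| <= z.

Let Q0 : 0 <= Q. Proof. by move: Q_ge4; lra. Qed.
Let Q1 : 1 <= Q. Proof. by move: Q_ge4; lra. Qed.
Let Qk k : 0 <= Q ^+ k. Proof. exact: exprn_ge0. Qed.
Let Q4 k : 4 * Q ^+ k <= Q ^+ k.+1.
Proof. by rewrite exprS ler_wpM2r. Qed.
Let Qmono i j : (i <= j)%N -> Q ^+ i <= Q ^+ j.
Proof. exact: ler_weXn2l. Qed.
Let K0 : 0 <= K. Proof. by move: K_ge1; lra. Qed.
Let nu0 : 0 <= nu. Proof. by []. Qed.
Let g0 : 0 < g. Proof. by move: g_range; lra. Qed.
Let g1 : 2 * g <= 1. Proof. by move: g_range; lra. Qed.
Let alpha1 : 1 < 3 * g. Proof. by move: g_range; lra. Qed.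

Let dist01 s t : I01 s -> I01 t -> 0 <= `|t - s| <= 1.
Proof. by move=> s01 t01; rewrite normr_ge0/= ler_norml; lra. Qed.

Let mulQ x y i j k : 0 <= x -> 0 <= y -> x <= Q ^+ i -> y <= Q ^+ j ->
  (i + j <= k)%N -> x * y <= Q ^+ k.
Proof.
move=> x0 y0 xi yj ijk; apply: (@le_trans _ _ (Q ^+ (i + j))); last exact: Qmono.
by rewrite exprD ler_pM.
Qed.

Let KQ : K <= Q ^+ 1. Proof. by []. Qed.
Let nuQ : nu <= Q ^+ 1. Proof. by []. Qed.

Lemma A_holder s t i : I01 s -> I01 t ->
  `|(A t - A s) i 0| <= Q ^+ 4 * `|t - s| `^ g.
Proof.
move=> s01 t01; have d01 := dist01 s01 t01.
have -> : (A t - A s) i 0 = \sum_j A' s i j * (X t - X s) j 0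
    + remainder X A A' s t i 0.
  by rewrite /remainder !mxE; ring.
have H1 : `|\sum_j A' s i j * (X t - X s) j 0| <= nu * (K * (K * `|t - s| `^ g)).
  apply: norm_sum_le => j; rewrite normrM ler_pM//; first exact: A'_bounded.
  exact: X_holder.
have H2 : `|remainder X A A' s t i 0| <= K * `|t - s| `^ g.
  apply: le_trans (R_holder i s01 t01) _; rewrite ler_wpM2l//.
  by apply: powR_anti => //; move: g0; lra.
apply: le_trans (ler_normD _ _) _; apply: le_trans (lerD H1 H2) _.
rewrite !mulrA -mulrDl ler_wpM2r ?powR_ge0//.
have : nu * K * K <= Q ^+ 3.
  apply: (@mulQ _ _ 2 1) => //; first exact: mulr_ge0.
  exact: (@mulQ _ _ 1 1).
have : Q ^+ 1 <= Q ^+ 3 by exact: Qmono.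
have := Q4 3; have := KQ; have := Qk 3; lra.
Qed.

Lemma A_bounded t i : I01 t -> `|A t i 0| <= Q ^+ 5.
Proof.
move=> t01; have O : I01 0 by rewrite lexx ler01.
have := A_holder i O t01; rewrite subr0.
have t1 : `|t| `^ g <= 1.
  by apply: powR_le1; [exact: ltW|exact: normr_ge0|rewrite ger0_norm; lra].
have := Q4 4; have : Q ^+ 1 <= Q ^+ 4 by exact: Qmono.
have := A0_bounded i; have := KQ.
have : Q ^+ 4 * `|t| `^ g <= Q ^+ 4 by rewrite ler_piMr.
rewrite !mxE => H1 H2 H3 H4 H5 H6.
have -> : A t i 0 = (A t i 0 - A 0 i 0) + A 0 i 0 by ring.
apply: le_trans (ler_normD _ _) _; have := Qk 4; lra.
Qed.

Lemma germ_defect_le (a w b : R) : 0 <= a -> a <= w -> w <= b -> b <= 1 ->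
  `|germ X A XX A' a b - germ X A XX A' a w - germ X A XX A' w b|
    <= (2 * nu ^+ 2 * K ^+ 2) * (b - a) `^ (3 * g).
Proof.
move=> a0 aw wb b1.
have a01 : I01 a by lra.
have w01 : I01 w by lra.
have b01 : I01 b by lra.
rewrite germ_defect ?in_itv//= normrN.
apply: le_trans (ler_normD _ _) _.
have P p : 0 <= p -> `|w - a| `^ p <= (b - a) `^ p.
  by move=> p0; apply: powR_mono => //; rewrite ger0_norm; lra.
have P' p : 0 <= p -> `|b - w| `^ p <= (b - a) `^ p.
  by move=> p0; apply: powR_mono => //; rewrite ger0_norm; lra.
have pg : (b - a) `^ (2 * g) * (b - a) `^ g = (b - a) `^ (3 * g).
  rewrite -powRD; first by congr (_ `^ _); ring.
  by apply/implyP => /eqP; move: g0; lra.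
have H1 : `|\sum_j remainder X A A' a w j 0 * (X b - X w) j 0|
    <= nu * (K ^+ 2 * (b - a) `^ (3 * g)).
  apply: norm_sum_le => j; rewrite normrM -pg expr2 mulrACA ler_pM//.
    apply: le_trans (R_holder j a01 w01) _; rewrite ler_wpM2l// P//.
    by rewrite mulr_ge0// ltW.
  by apply: le_trans (X_holder j w01 b01) _; rewrite ler_wpM2l// P'// ltW.
have H2 : `|\sum_j \sum_k (A' w j k - A' a j k) * XX w b k j|
    <= nu * (nu * (K ^+ 2 * (b - a) `^ (3 * g))).
  apply: norm_sum_le => j; apply: norm_sum_le => k.
  rewrite normrM -pg (mulrC (_ `^ (2 * g))) expr2 mulrACA ler_pM//.
    by apply: le_trans (A'_holder j k a01 w01) _; rewrite ler_wpM2l// P// ltW.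
  apply: le_trans (XX_holder k j w01 b01) _; rewrite ler_wpM2l// P'//.
  by rewrite mulr_ge0// ltW.
apply: le_trans (lerD H1 H2) _.
rewrite -[leRHS]mulrA.
have : 0 <= K ^+ 2 * (b - a) `^ (3 * g) by rewrite mulr_ge0 ?exprn_ge0 ?powR_ge0.
have : 1 <= nu by rewrite ler1n.
move: nu (K ^+ 2 * _) => m T m1 T0.
have : m * T <= m * (m * T) by rewrite ler_peMl// mulr_ge0//; lra.
rewrite expr2; lra.
Qed.

Let sewn_Kge0 : 0 <= 2 * nu ^+ 2 * K ^+ 2.
Proof. by rewrite !mulr_ge0 ?exprn_ge0. Qed.

Lemma I_expansion u v : 0 <= u -> u <= v -> v <= 1 ->
  `|I v - I u - germ X A XX A' u v| <= Q ^+ 6 * (v - u) `^ (3 * g).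
Proof.
move=> u0 uv v1.
apply: le_trans (sewn_estimate alpha1 sewn_Kge0 germ_defect_le u0 uv v1) _.
rewrite ler_wpM2r ?powR_ge0//.
apply: (@mulQ _ _ 1 5) => //.
  by have := sewing_const_ge2 alpha1; lra.
apply: (@mulQ _ _ 3 2) => //; rewrite ?mulr_ge0 ?exprn_ge0//.
  apply: (@mulQ _ _ 1 2) => //; rewrite ?mulr_ge0 ?exprn_ge0//.
    by rewrite expr1; move: Q_ge4; lra.
  by rewrite lerXn2r// nnegrE.
by rewrite lerXn2r// nnegrE.
Qed.

Let sumKK (F : 'I_n -> 'I_n -> R) (M : R) : (forall j k, `|F j k| <= M) ->
  `|\sum_j \sum_k F j k| <= nu * (nu * M).
Proof. by move=> H; apply: norm_sum_le => j; apply: norm_sum_le. Qed.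

(** Over [u, v] the increment of the process is A_u (X_v - X_u) up to terms of
    order 2 gamma, and it is at most 2 z. *)
Lemma forward_product u v : 0 <= u -> u <= v -> v <= 1 ->
  `|\sum_j A u j 0 * (X v - X u) j 0|
    <= 2 * z + 3 * Q ^+ 6 * (v - u) `^ (2 * g).
Proof.
move=> u0 uv v1.
have u01 : I01 u by lra.
have v01 : I01 v by lra.
have d01 : 0 <= v - u <= 1 by lra.
set P := (v - u) `^ (2 * g).
have P0 : 0 <= P by exact: powR_ge0.
have le1 : v - u <= P.
  rewrite -[leLHS]powRr1; last by lra.
  by apply: powR_anti => //; move: g0 g1; lra.
have le2 : (v - u) `^ (1 + g) <= P.
  by apply: powR_anti => //; move: g0 g1; lra.
have le3 : (v - u) `^ (3 * g) <= P.
  by apply: powR_anti => //; move: g0 g1; lra.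
have HB : `|IB v - IB u| <= Q ^+ 2 * P.
  have -> : IB v - IB u = (IB v - IB u - B u * (v - u)) + B u * (v - u) by ring.
  apply: le_trans (ler_normD _ _) _.
  have H1 : `|IB v - IB u - B u * (v - u)| <= K * P.
    by apply: le_trans (IB_expansion u0 _ uv v1) _ => //; rewrite ler_wpM2l.
  have H2 : `|B u * (v - u)| <= K * P.
    rewrite normrM ler_pM//; first exact: B_bounded.
    by rewrite ger0_norm//; lra.
  apply: le_trans (lerD H1 H2) _.
  rewrite -mulrDl ler_wpM2r//; have := Q4 1; have := KQ; have := Qk 1; lra.
have HXX : `|\sum_j \sum_k A' u j k * XX u v k j| <= Q ^+ 4 * P.
  apply: le_trans (sumKK (M := K * (K * P)) _) _.
    move=> j k; rewrite normrM ler_pM//; first exact: A'_bounded.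
    by apply: le_trans (XX_holder k j u01 v01) _; rewrite ger0_norm//; lra.
  rewrite !mulrA ler_wpM2r//.
  apply: (@mulQ _ _ 3 1) => //; rewrite ?mulr_ge0//.
  apply: (@mulQ _ _ 2 1) => //; rewrite ?mulr_ge0//.
  exact: (@mulQ _ _ 1 1).
have HI := I_expansion u0 uv v1.
have {}HI : `|I v - I u - germ X A XX A' u v| <= Q ^+ 6 * P.
  by apply: le_trans HI _; rewrite ler_wpM2l.
have Zu := Z_bounded u01; have Zv := Z_bounded v01.
have q2 : Q ^+ 2 * P <= Q ^+ 6 * P by rewrite ler_wpM2r// Qmono.
have q4 : Q ^+ 4 * P <= Q ^+ 6 * P by rewrite ler_wpM2r// Qmono.
have -> : 3 * Q ^+ 6 * P = 3 * (Q ^+ 6 * P) by ring.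
move: HB HXX HI Zu Zv q2 q4; rewrite /germ.
move: (Q ^+ 2 * P) (Q ^+ 4 * P) (Q ^+ 6 * P) => a b c.
move: (\sum_j A u j 0 * _) (\sum_j \sum_k _) (I u) (I v) (IB u) (IB v) => {}x y p q r s.
rewrite !ler_norml; lra.
Qed.

(** Roughness looks at both sides of s.  For t < s the base point is moved from t
    to s, which costs a product of increments of A and X, again of order
    2 gamma. *)
Lemma product_small s t : I01 s -> I01 t ->
  `|\sum_j A s j 0 * (X t - X s) j 0| <= 2 * z + Q ^+ 7 * `|t - s| `^ (2 * g).
Proof.
move=> s01 t01; have [st|ts] := leP s t.
  rewrite [`|t - s|]ger0_norm ?subr_ge0//.
  apply: le_trans (forward_product _ _ _) _; [lra|lra|lra|].
  rewrite lerD2l ler_wpM2r ?powR_ge0//; have := Q4 6; have := Qk 6; lra.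
have -> : \sum_j A s j 0 * (X t - X s) j 0 =
    - (\sum_j A t j 0 * (X s - X t) j 0)
    - (\sum_j (A s - A t) j 0 * (X s - X t) j 0).
  rewrite -!sumrN -big_split; apply: eq_bigr => j _; rewrite /= !mxE; ring.
have H1 : `|\sum_j A t j 0 * (X s - X t) j 0|
    <= 2 * z + 3 * Q ^+ 6 * `|t - s| `^ (2 * g).
  rewrite distrC [`|s - t|]ger0_norm ?subr_ge0 ?(ltW ts)//.
  by apply: forward_product; [lra|exact: ltW|lra].
have H2 : `|\sum_j (A s - A t) j 0 * (X s - X t) j 0|
    <= nu * (Q ^+ 4 * K * `|t - s| `^ (2 * g)).
  apply: norm_sum_le => j; rewrite normrM.
  have -> : 2 * g = g + g by ring.
  rewrite powRD; last by apply/implyP => /eqP; move: g0; lra.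
  rewrite mulrACA ler_pM// (distrC t); first exact: A_holder.
  exact: X_holder.
have H3 : nu * (Q ^+ 4 * K) <= Q ^+ 6.
  apply: (@mulQ _ _ 1 5) => //; rewrite ?mulr_ge0//.
  exact: (@mulQ _ _ 4 1).
apply: le_trans (ler_normD _ _) _; rewrite !normrN.
apply: le_trans (lerD H1 H2) _; rewrite -addrA lerD2l mulrA -mulrDl.
rewrite ler_wpM2r ?powR_ge0//; have := Q4 6; lra.
Qed.

Local Notation r1 := ((2 * g - theta) / (2 * g)).

Let r1_range : 0 < r1 <= 1.
Proof.
have g20 : 0 < 2 * g by move: g0; lra.
rewrite divr_gt0 ?subr_gt0//= ler_pdivrMr// mul1r; move: theta_gt0; lra.
Qed.

Let powQ k r : 0 <= r <= 1 -> (Q ^+ k) `^ r <= Q ^+ k.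
Proof.
case/andP=> r0 r1'; rewrite -[leRHS]powRr1//; apply: ler_powR => //.
exact: exprn_ege1.
Qed.

(** A bound on increments against X at all small scales is a bound on the
    coefficients: this is where roughness and theta < 2 gamma enter. *)
Let rough_interpolation (v : R -> 'I_n -> R) (y : R) (k : nat) (D : R) :
  0 <= y -> D = Q ^+ k.+2 ->
  (forall (t : R) i, I01 t -> `|v t i| <= D) ->
  (forall s t : R, I01 s -> I01 t ->
     `|\sum_j v s j * (X t - X s) j 0|
       <= 2 * y + Q ^+ k * `|t - s| `^ (2 * g)) ->
  forall (t : R) i, I01 t -> `|v t i| <= Q ^+ k.+3 * y `^ r1.
Proof.
move=> y0 -> vD H s i s01.
have -> : r1 = (2 * g - theta) / (theta + (2 * g - theta)) by congr (_ / _); ring.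
apply: (@le_trans _ _ (2 * Q ^+ k.+2 * y `^ ((2 * g - theta) / (theta + (2 * g - theta))))).
  apply: interpolation => //; first exact: ltW.
  - by move: theta_lt theta_gt0 g1; lra.
  - exact: vD.
  move=> eps eps01; have [e0 e2] := andP eps01.
  have pe0 : 0 < eps `^ (- theta) by exact: powR_gt0.
  have := @X_rough s eps (v s) (2 * y + Q ^+ k * eps `^ (2 * g)) s01 eps01.
  move=> /(_ _ i)/le_trans; apply.
    move=> t t01 ts; apply: le_trans (H _ _ s01 t01) _.
    rewrite lerD2l ler_wpM2l//; apply: powR_mono => //; move: g0; lra.
  rewrite mulrDl -mulrA -[X in _ + X]mulrA.
  rewrite -powRD; last by rewrite (gt_eqF e0) implybT.
  have yp : 0 <= y * eps `^ (- theta) by rewrite mulr_ge0// ltW.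
  have pp : 0 <= eps `^ (2 * g - theta) by exact: powR_ge0.
  have QQ : Q * Q ^+ k <= Q ^+ k.+2 by rewrite -exprS Qmono.
  have Q2 : 2 * Q <= Q ^+ k.+2.
    have : Q ^+ 1 <= Q ^+ k.+1 by exact: Qmono.
    by have := Q4 k.+1; have := Q0; rewrite expr1; lra.
  rewrite mulrDr [in leRHS]mulrDr !mulrA lerD//.
    by rewrite (mulrC Q) -mulrA -[leRHS]mulrA ler_wpM2r.
  by rewrite ler_wpM2r.
rewrite ler_wpM2r ?powR_ge0//; have := Q4 k.+2; have := Qk k.+2; lra.
Qed.

Lemma A_small t i : I01 t -> `|A t i 0| <= Q ^+ 10 * z `^ r1.
Proof.
apply: (@rough_interpolation (fun t i => A t i 0) z 7 _ z_ge0 erefl).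
  move=> {}t {}i t01; apply: le_trans (A_bounded i t01) _; exact: Qmono.
move=> s {}t s01 t01; exact: product_small.
Qed.

(** Once A is small, so are its increments, which are A' (X_t - X_s) up to order
    2 gamma: the argument for A is repeated on each row of A', with the bound on A
    in the place of z. *)
Lemma A'_small t i j : I01 t -> `|A' t i j| <= Q ^+ 14 * z `^ (r1 * r1).
Proof.
pose y := Q ^+ 10 * z `^ r1.
have y0 : 0 <= y by rewrite mulr_ge0// powR_ge0.
move=> t01; apply: (@le_trans _ _ (Q ^+ 4 * y `^ r1)).
  apply: (@rough_interpolation (fun t j => A' t i j) y 1 _ y0 erefl) => //.
    move=> {}t {}j {}t01; apply: le_trans (A'_bounded i j t01) _.
    exact: (le_trans KQ (Qmono _)).
  move=> s {}t s01 {}t01.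
  have -> : \sum_j A' s i j * (X t - X s) j 0 =
      A t i 0 - A s i 0 - remainder X A A' s t i 0.
    by rewrite /remainder !mxE; ring.
  have := A_small i s01; have := A_small i t01; have := R_holder i s01 t01.
  have : K * `|t - s| `^ (2 * g) <= Q ^+ 1 * `|t - s| `^ (2 * g).
    by rewrite ler_wpM2r ?powR_ge0.
  rewrite -/y.
  rewrite !ler_norml; lra.
rewrite /y powRM ?powR_ge0// -powRrM mulrA ler_wpM2r ?powR_ge0//.
rewrite (exprD Q 4 10) ler_wpM2l//; apply: powQ; move: r1_range; lra.
Qed.

Hypothesis z_le1 : z <= 1.

Local Notation r2 := ((3 * g - 1) / (3 * g)).
Local Notation r4 := (g / (1 + g)).

Let r2_range : 0 < r2 <= 1.
Proof.
have g30 : 0 < 3 * g by move: g0; lra.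
rewrite divr_gt0 ?subr_gt0//= ler_pdivrMr// mul1r; lra.
Qed.

Let r4_range : 0 < r4 <= 1.
Proof.
have g10 : 0 < 1 + g by move: g0; lra.
by rewrite divr_gt0 ?subr_gt0//= ler_pdivrMr// mul1r; lra.
Qed.

Let y := z `^ (r1 * r1).
Let y_range : 0 <= y <= 1.
Proof.
rewrite powR_ge0 powR_le1// mulr_ge0//; move: r1_range; lra.
Qed.

Lemma sewn_increment_small u v : 0 <= u -> u <= v -> v <= 1 ->
  `|I v - I u| <= Q ^+ 18 * y + Q ^+ 6 * (v - u) `^ (3 * g).
Proof.
move=> u0 uv v1.
have u01 : I01 u by lra.
have v01 : I01 v by lra.
have /andP[y0 y1] := y_range.
have d1 p : 0 <= p -> `|v - u| `^ p <= 1.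
  by move=> p0; apply: powR_le1 => //; rewrite ger0_norm; lra.
have HX j : `|(X v - X u) j 0| <= K.
  apply: le_trans (X_holder j u01 v01) _; rewrite ler_piMr// d1// ltW//.
have HXX j k : `|XX u v j k| <= K.
  apply: le_trans (XX_holder j k u01 v01) _; rewrite ler_piMr// d1//.
  by move: g0; lra.
have zr : z `^ r1 <= y.
  move: z_ge0; rewrite le_eqVlt => /predU1P[<-|z0].
    by rewrite powR0 ?powR_ge0// gt_eqF//; case/andP: r1_range.
  apply: ger_powR; first by rewrite z0 z_le1.
  by case/andP: r1_range => r0 rle1; rewrite ler_piMl// ltW.
have H1 : `|\sum_j A u j 0 * (X v - X u) j 0| <= nu * (Q ^+ 10 * y * K).
  apply: norm_sum_le => j; rewrite normrM ler_pM//.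
  by apply: le_trans (A_small j u01) _; rewrite ler_wpM2l.
have H2 : `|\sum_j \sum_k A' u j k * XX u v k j|
    <= nu * (nu * (Q ^+ 14 * y * K)).
  apply: sumKK => j k; rewrite normrM ler_pM//; exact: A'_small.
have Q12 : nu * (Q ^+ 10 * K) <= Q ^+ 16.
  apply: (@mulQ _ _ 1 11) => //; rewrite ?mulr_ge0//.
  exact: (@mulQ _ _ 10 1).
have Q16 : nu * (nu * (Q ^+ 14 * K)) <= Q ^+ 17.
  apply: (@mulQ _ _ 1 16) => //; rewrite ?mulr_ge0//.
  apply: (@mulQ _ _ 1 15) => //; rewrite ?mulr_ge0//.
  exact: (@mulQ _ _ 14 1).
have {}H1 : `|\sum_j A u j 0 * (X v - X u) j 0| <= Q ^+ 17 * y.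
  apply: (le_trans H1); rewrite (mulrAC _ y) mulrA ler_wpM2r//.
  exact: (le_trans Q12 (Qmono _)).
have {}H2 : `|\sum_j \sum_k A' u j k * XX u v k j| <= Q ^+ 17 * y.
  apply: (le_trans H2).
  have -> : nu * (nu * (Q ^+ 14 * y * K)) = nu * (nu * (Q ^+ 14 * K)) * y by ring.
  by rewrite ler_wpM2r.
have := I_expansion u0 uv v1.
have : 4 * (Q ^+ 17 * y) <= Q ^+ 18 * y by rewrite mulrA ler_wpM2r.
have : 0 <= Q ^+ 17 * y by rewrite mulr_ge0.
move: H1 H2; rewrite /germ !ler_norml.
move: (Q ^+ 18 * y) (Q ^+ 17 * y) (Q ^+ 6 * _) (\sum_j _ * _) (\sum_j \sum_k _).
move=> *; lra.
Qed.

(** With A and A' small, an increment of the rough integral over an interval of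
    length 1/N is at most y + N^(-3 gamma) up to constants.  The N increments add up
    to N y + N^(1 - 3 gamma), and 3 gamma > 1 leaves a decaying term to balance. *)
Lemma sewn_small t : I01 t -> `|I t| <= Q ^+ 21 * y `^ r2.
Proof.
move=> t01; have /andP[y0 y1] := y_range.
have I0 : I 0 = 0 := sewn0 alpha1 sewn_Kge0 germ_defect_le.
have -> : r2 = (3 * g - 1) / (1 + (3 * g - 1)) by congr (_ / _); ring.
apply: (@le_trans _ _ (2 * Q ^+ 20 * y `^ ((3 * g - 1) / (1 + (3 * g - 1))))); last first.
  by rewrite ler_wpM2r ?powR_ge0//; have := Q4 20; have := Qk 20; lra.
apply: interpolation => //.
- by move: g_range; lra.
- have := @sewn_increment_small 0 t (lexx _); rewrite I0 !subr0.
  have H1 : t `^ (3 * g) <= 1 by apply: powR_le1; [move: g0|..]; lra.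
  have H2 : Q ^+ 18 * y <= Q ^+ 18 by rewrite ler_piMr.
  have H3 : Q ^+ 6 * t `^ (3 * g) <= Q ^+ 18.
    by apply: le_trans (Qmono (isT : 6 <= 18)%N); rewrite ler_piMr.
  have : Q ^+ 18 + Q ^+ 18 <= Q ^+ 20.
    by have := Q4 18; have := Q4 19; have := Qk 18; have := Qk 19; lra.
  move=> H4 H; apply: le_trans (H _ _) _; lra.
move=> eps /andP[e0 e2].
pose N := (Num.truncn eps^-1).+1.
have N0 : 0 < N%:R :> R by rewrite ltr0n.
have iN : N%:R^-1 <= eps.
  by rewrite invf_ple ?posrE// ltW// /N; apply: truncnS_gt.
have Ne : N%:R <= 2 * eps^-1.
  have ei : 1 <= eps^-1 by rewrite invf_ge1//; lra.
  have : (Num.truncn eps^-1)%:R <= eps^-1 by rewrite truncn_le// invr_ge0 ltW.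
  by rewrite /N -natr1; lra.
pose s k := t * (k%:R / N%:R).
have sN : s N = t by rewrite /s divff ?mulr1// gt_eqF.
have ds k : s k.+1 - s k = t * N%:R^-1 by rewrite /s -natr1; ring.
have step k : (k < N)%N -> `|I (s k.+1) - I (s k)| <= Q ^+ 18 * y + Q ^+ 6 * eps `^ (3 * g).
  move=> kN.
  have d0 : 0 <= t * N%:R^-1 by rewrite mulr_ge0//; lra.
  have dle : t * N%:R^-1 <= eps.
    apply: le_trans iN; rewrite ler_piMl ?invr_ge0//; lra.
  have s0 : 0 <= s k by rewrite /s mulr_ge0// ?divr_ge0//; lra.
  have s1 : s k.+1 <= 1.
    rewrite /s; apply: (@le_trans _ _ (1 * 1)); last by rewrite mulr1.
    rewrite ler_pM ?divr_ge0//; [lra|lra|].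
    by rewrite ler_pdivrMr// mul1r ler_nat.
  apply: le_trans (sewn_increment_small s0 _ s1) _.
    by rewrite -subr_ge0 ds.
  rewrite lerD2l ler_wpM2l// ds; apply: powR_mono => //.
  by move: g0; lra.
have -> : I t = \sum_(0 <= k < N) (I (s k.+1) - I (s k)).
  rewrite telescope_sumr// sN.
  have -> : s 0%N = 0 by rewrite /s mul0r mulr0.
  by rewrite I0 subr0.
rewrite big_mkord.
have := @norm_sum_le R N (fun k => I (s k.+1) - I (s k))
  (Q ^+ 18 * y + Q ^+ 6 * eps `^ (3 * g)) (fun k => step k (ltn_ord k)).
move/le_trans; apply.
have S0 : 0 <= Q ^+ 18 * y + Q ^+ 6 * eps `^ (3 * g).
  by rewrite addr_ge0// mulr_ge0// powR_ge0.
apply: (@le_trans _ _ (2 * eps^-1 * (Q ^+ 18 * y + Q ^+ 6 * eps `^ (3 * g)))).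
  by rewrite ler_wpM2r.
rewrite powR_inv1; last exact: ltW.
have -> : eps `^ (3 * g) = eps * eps `^ (3 * g - 1).
  by rewrite mulr_powRB1; [|exact: ltW|move: g0; lra].
have -> : 2 * eps^-1 * (Q ^+ 18 * y + Q ^+ 6 * (eps * eps `^ (3 * g - 1))) =
    2 * Q ^+ 18 * (y * eps^-1) + 2 * Q ^+ 6 * eps `^ (3 * g - 1).
  by field; rewrite gt_eqF.
rewrite mulrDr lerD//; rewrite ler_wpM2r ?powR_ge0//.
- by rewrite mulr_ge0 ?invr_ge0// ltW.
- have := Q4 18; have := Q4 19; have := Qk 18; have := Qk 19; lra.
- have : Q ^+ 6 <= Q ^+ 18 by exact: Qmono.
  have := Q4 18; have := Q4 19; have := Qk 18; have := Qk 19; lra.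
Qed.

(** The drift integral is small because the process and the rough integral are;
    dividing its increment over an interval of length eps by eps recovers B up to
    eps^gamma. *)
Lemma B_small t : I01 t -> `|B t| <= Q ^+ 24 * (y `^ r2) `^ r4.
Proof.
move=> t01; have /andP[y0 y1] := y_range.
pose W := Q ^+ 22 * y `^ r2.
have W0 : 0 <= W by rewrite mulr_ge0// powR_ge0.
have zW : z <= y `^ r2.
  have /andP[a0 a1] := r1_range; have /andP[b0 b1] := r2_range.
  rewrite /y -powRrM -[leLHS]powRr1//; apply: powR_anti; first by rewrite z_ge0.
    by apply: mulr_gt0 => //; exact: mulr_gt0.
  move: a0 a1 b0 b1; move: (r1) (r2) => a b a0 a1 b0 b1.
  have aa : a * a <= 1 by apply: mulr_ile1 => //; exact: ltW.
  by apply: mulr_ile1 => //; [rewrite mulr_ge0// ltW|exact: ltW].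
have IBW s : I01 s -> `|IB s| <= W.
  move=> s01; have := sewn_small s01; have := Z_bounded s01.
  have : 1 * y `^ r2 <= Q ^+ 21 * y `^ r2.
    by rewrite ler_wpM2r ?powR_ge0// exprn_ege1.
  have : 4 * (Q ^+ 21 * y `^ r2) <= W by rewrite mulrA ler_wpM2r ?powR_ge0.
  move: zW; rewrite !ler_norml; lra.
apply: (@le_trans _ _ (2 * Q * W `^ r4)).
  apply: interpolation => //.
  - by move: g0 g1; lra.
  - exact: (le_trans (B_bounded t01)).
  move=> eps /andP[e0 e2].
  have main u v : 0 <= u -> u <= t -> t <= v -> v <= 1 -> v - u = eps ->
      `|B t| <= Q * (W * eps `^ (-1) + eps `^ g).
    move=> u0 ut tv v1 uv.
    have v01 : I01 v by lra.
    have u01 : I01 u by lra.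
    have := IB_expansion u0 ut tv v1; rewrite uv.
    have := IBW _ u01; have := IBW _ v01.
    have -> : eps `^ (1 + g) = eps * eps `^ g.
      rewrite powRD; first by rewrite powRr1// ltW.
      by rewrite (gt_eqF e0) implybT.
    move=> H1 H2 H3.
    have {H1 H2}H3 : `|B t| * eps <= 2 * W + K * (eps * eps `^ g).
      rewrite -[X in _ * X](ger0_norm (ltW e0)) -normrM.
      move: H1 H2 H3; rewrite !ler_norml.
      move: (B t * eps) (K * _) => a b; lra.
    rewrite powR_inv1; last exact: ltW.
    rewrite -(ler_pM2r e0); apply: (le_trans H3).
    have -> : Q * (W * eps^-1 + eps `^ g) * eps = Q * W + Q * (eps * eps `^ g).
      by field; rewrite gt_eqF.
    rewrite lerD// ler_wpM2r ?mulr_ge0 ?powR_ge0//; [|exact: ltW].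
    by move: Q_ge4; lra.
  (* the interval is taken on the side of t that stays inside [0, 1] *)
  have [le2|gt2] := leP t 2^-1.
    by apply: (main t (t + eps)); lra.
  by apply: (main (t - eps) t); lra.
have -> : W `^ r4 = (Q ^+ 22) `^ r4 * (y `^ r2) `^ r4.
  by rewrite /W powRM// powR_ge0.
have : 0 <= (y `^ r2) `^ r4 by exact: powR_ge0.
have : (Q ^+ 22) `^ r4 <= Q ^+ 22 by apply: powQ; move: r4_range; lra.
move: ((Q ^+ 22) `^ r4) ((y `^ r2) `^ r4) => a b aQ b0.
rewrite mulrA; apply: ler_wpM2r => //.
apply: (@le_trans _ _ (2 * Q * Q ^+ 22)).
  by apply: ler_wpM2l => //; apply: mulr_ge0.
by rewrite -mulrA -exprS; have := Q4 23; have := Qk 23; lra.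
Qed.

(** The final exponent: A decays with exponent r1, A' with r1 ^ 2, the rough
    integral with r1 ^ 2 * r2 and B with r1 ^ 2 * r2 * r4. *)
Lemma norris_small t i : I01 t ->
  `|A t i 0| <= Q ^+ 24 * z `^ (r1 * r1 * r2 * r4) /\
  `|B t| <= Q ^+ 24 * z `^ (r1 * r1 * r2 * r4).
Proof.
move=> t01; split; last first.
  have -> : z `^ (r1 * r1 * r2 * r4) = (y `^ r2) `^ r4.
    by rewrite /y; move: (r1) (r2) (r4) => a b c; rewrite !powRrM.
  exact: B_small.
apply: le_trans (A_small i t01) _.
apply: ler_pM; rewrite ?powR_ge0//; first exact: Qmono.
move: r1_range r2_range r4_range; move: (r1) (r2) (r4) => a b c.
move=> /andP[a0 a1] /andP[b0 b1] /andP[c0 c1].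
apply: powR_anti; first by rewrite z_ge0.
  by rewrite !mulr_gt0.
rewrite -!mulrA ler_piMr//; first exact: ltW.
rewrite !mulrA.
have ab : a * b <= 1 by apply: mulr_ile1 => //; exact: ltW.
by apply: mulr_ile1 => //; [rewrite mulr_ge0// ltW|exact: ltW].
Qed.

End norris.

(** * From norms to coordinate bounds *)

Lemma mem01 (R : realType) (t : R) : (t \in `[0, 1]) = (0 <= t <= 1).
Proof. by rewrite in_itv. Qed.

Section enorm.
Context {R : realType}.

Lemma enorm_ge0 m n (M : 'M[R]_(m, n)) : 0 <= enorm M.
Proof. exact: sqrtr_ge0. Qed.

Lemma coord_le_enorm m n (M : 'M[R]_(m, n)) i j : `|M i j| <= enorm M.
Proof.
rewrite -sqrtr_sqr; apply: ler_wsqrtr.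
rewrite (bigD1 i)//= (bigD1 j)//= -addrA lerDl addr_ge0//.
  by apply: sumr_ge0 => k _; exact: sqr_ge0.
by apply: sumr_ge0 => k _; apply: sumr_ge0 => l _; exact: sqr_ge0.
Qed.

Lemma enorm_le m n (M : 'M[R]_(m, n)) (c : R) : 0 <= c ->
  (forall i j, `|M i j| <= c) -> enorm M <= (m * n)%:R * c.
Proof.
move=> c0 H.
have C0 : 0 <= (m * n)%:R * c by rewrite mulr_ge0.
rewrite -[leRHS](ger0_norm C0) -sqrtr_sqr; apply: ler_wsqrtr.
have -> : ((m * n)%:R * c) ^+ 2 = \sum_(i < m) \sum_(j < n) ((m * n)%:R * c ^+ 2).
  rewrite !sumr_const !card_ord -mulrnA -mulr_natl mulnC natrM; ring.
apply: ler_sum => i _; apply: ler_sum => j _.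
rewrite -(sqr_norm_real (M i j)).
apply: (@le_trans _ _ (c ^+ 2)); first by rewrite lerXn2r ?nnegrE.
rewrite ler_peMl ?sqr_ge0// ler1n muln_gt0.
by rewrite (leq_ltn_trans _ (ltn_ord i))// (leq_ltn_trans _ (ltn_ord j)).
Qed.

Variables (V : Type) (N : V -> R).
Hypothesis N_ge0 : forall v, 0 <= N v.

Lemma holder2_ge (g : R) F s t : 0 <= s <= 1 -> 0 <= t <= 1 -> s != t ->
  ((N (F s t) / `|t - s| `^ g)%:E <= holder2 N g F)%E.
Proof.
move=> s01 t01 st; apply: ereal_sup_ubound => /=.
by exists (s, t) => //=; split; rewrite ?mem01.
Qed.

Lemma holder2_ge0 (g : R) F : (0 <= holder2 N g F)%E.
Proof.
apply: le_trans (@holder2_ge g F 0 1 _ _ _); rewrite ?lexx ?ler01//.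
  by rewrite lee_fin divr_ge0 ?powR_ge0.
by rewrite eq_sym oner_neq0.
Qed.

Lemma holder2_fineP (g : R) F (c : R) s t : (holder2 N g F <= c%:E)%E ->
  0 <= s <= 1 -> 0 <= t <= 1 -> s != t -> N (F s t) <= c * `|t - s| `^ g.
Proof.
move=> Hc s01 t01 st.
have := le_trans (holder2_ge g F s01 t01 st) Hc.
by rewrite lee_fin ler_pdivrMr// powR_gt0// normr_gt0 subr_eq0 eq_sym.
Qed.

Lemma sup_norm_ge f t : 0 <= t <= 1 -> ((N (f t))%:E <= sup_norm N f)%E.
Proof.
by move=> t01; apply: ereal_sup_ubound => /=; exists t; rewrite //= in_itv.
Qed.

Lemma sup_norm_ge0 f : (0 <= sup_norm N f)%E.
Proof.
apply: le_trans (@sup_norm_ge f 0 _); rewrite ?lexx ?ler01//.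
by rewrite lee_fin.
Qed.

Lemma sup_norm_le f (c : \bar R) :
  (forall t : R, 0 <= t <= 1 -> ((N (f t))%:E <= c)%E) -> (sup_norm N f <= c)%E.
Proof.
move=> H; apply: ge_ereal_sup => _ [t /= t01 <-].
by apply: H; rewrite -mem01.
Qed.

End enorm.

(** * The Lebesgue integral of a Hoelder function *)

Section drift.
Context {R : realType}.
Variables (B : R -> R) (K g : R).
Hypothesis g_gt0 : 0 < g.
Hypothesis K_ge0 : 0 <= K.
Hypothesis B_holder : forall s t : R, 0 <= s <= 1 -> 0 <= t <= 1 ->
  `|B t - B s| <= K * `|t - s| `^ g.

Local Notation mu := (@lebesgue_measure R).

Lemma holder_within_continuous : {within `[0, 1], continuous B}.
Proof.
apply/subspace_continuousP => x; rewrite /= in_itv/= => x01.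
apply/cvgrPdist_lt => e e0; rewrite !near_withinE.
have d0 : 0 < (e / (K + 1)) `^ g^-1 by rewrite powR_gt0// divr_gt0// ltr_wpDl.
near=> t => /=; rewrite in_itv/= => t01.
apply: le_lt_trans (B_holder t01 x01) _.
have tx : `|x - t| <= (e / (K + 1)) `^ g^-1.
  by near: t; exact: cvgr_dist_le.
apply: (@le_lt_trans _ _ (K * (e / (K + 1)))).
  rewrite ler_wpM2l//; apply: le_trans (powR_mono _ _ tx) _ => //; first exact: ltW.
  by rewrite -powRrM mulVf ?gt_eqF// powRr1// divr_ge0 ?addr_ge0// ltW.
rewrite mulrCA -[ltRHS]mulr1 (ltr_pM2l e0) ltr_pdivrMr; move: K_ge0; lra.
Unshelve. all: by end_near. Qed.

Lemma holder_integrable u v : 0 <= u -> v <= 1 ->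
  mu.-integrable `[u, v] (EFin \o B).
Proof.
move=> u0 v1; have : mu.-integrable `[0, 1] (EFin \o B).
  apply: continuous_compact_integrable; first exact: segment_compact.
  exact: holder_within_continuous.
apply: integrableS => // x; rewrite /= !in_itv/= => /andP[ux xv].
by rewrite (le_trans u0 ux) (le_trans xv v1).
Qed.

Lemma drift_expansion (u v w : R) : 0 <= u -> u <= w -> w <= v -> v <= 1 ->
  `|\int[mu]_(s in `[0, v]) B s - \int[mu]_(s in `[0, u]) B s - B w * (v - u)|
   <= K * (v - u) `^ (1 + g).
Proof.
move=> u0 uw wv v1; have uv : u <= v by rewrite (le_trans uw).
rewrite Rintegral_itvB ?bnd_simp//; last exact: holder_integrable.
have iuv : mu.-integrable `]u, v] (EFin \o B).
  apply: (integrableS _ _ _ (holder_integrable u0 v1)) => //.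
  exact: subset_itv_oc_cc.
have mu_uv : fine (mu `]u, v]) = v - u.
  rewrite lebesgue_measure_itv/= lte_fin; case: ltP => //.
  by move=> vu; rewrite (@le_anti _ _ u v) ?subrr// uv vu.
have icst (c : R) : mu.-integrable `]u, v] (EFin \o cst c).
  have : mu.-integrable `[u, v] (EFin \o cst c).
    apply: continuous_compact_integrable; first exact: segment_compact.
    by apply: continuous_subspaceT => x; exact: cvg_cst.
  by apply: integrableS => //; exact: subset_itv_oc_cc.
have <- : \int[mu]_(s in `]u, v]) (cst (B w) s) = B w * (v - u).
  by rewrite Rintegral_cst// mu_uv.
rewrite -(RintegralB _ iuv (icst (B w)))//.
have iB : mu.-integrable `]u, v] (EFin \o (fun s => B s - cst (B w) s)).
  exact: (integrableB _ iuv (icst _)).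
apply: le_trans (le_normr_Rintegral _ iB) _ => //.
apply: (@le_trans _ _ (\int[mu]_(s in `]u, v]) (cst (K * (v - u) `^ g) s))).
  apply: le_Rintegral => //.
    exact: integrable_norm iB.
  move=> s; rewrite /= in_itv/= => /andP[us sv].
  apply: le_trans (B_holder _ _) _; [lra|lra|].
  rewrite ler_wpM2l//; apply: powR_mono => //; first exact: ltW.
  by rewrite ler_norml; lra.
rewrite Rintegral_cst// mu_uv -mulrA.
have -> : (v - u) `^ (1 + g) = (v - u) `^ g * (v - u); last exact: lexx.
rewrite powRD ?powRr1 ?subr_ge0// 1?mulrC//.
by apply/implyP => /eqP; move: g_gt0; lra.
Qed.

End drift.

(** * Roughness as a lower bound on increments *)

Section roughness.
Context {R : realType} {n : nat}.
Implicit Types (X : R -> 'cV[R]_n).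

Lemma enormZ (a : R) (v : 'cV[R]_n) : 0 <= a -> enorm (a *: v) = a * enorm v.
Proof.
move=> a0; rewrite /enorm -[X in X * _](ger0_norm a0) -sqrtr_sqr -sqrtrM ?sqr_ge0//.
congr Num.sqrt; rewrite mulr_sumr; apply: eq_bigr => i _.
by rewrite mulr_sumr; apply: eq_bigr => j _; rewrite mxE exprMn.
Qed.

Lemma dotvZ (a : R) (u v : 'cV[R]_n) : dotv (a *: u) v = a * dotv u v.
Proof.
by rewrite /dotv mulr_sumr; apply: eq_bigr => i _; rewrite mxE mulrA.
Qed.

Lemma dotvB (u v w : 'cV[R]_n) : dotv u (v - w) = dotv u v - dotv u w.
Proof. by rewrite /dotv -sumrB; apply: eq_bigr => i _; rewrite !mxE mulrBr. Qed.

Lemma rough_with_le theta L X s eps (v : 'cV[R]_n) beta :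
  holder_rough_with theta L X -> 0 <= s <= 1 -> 0 < eps <= 2^-1 ->
  (forall t : R, 0 <= t <= 1 -> `|t - s| <= eps ->
     `|dotv v (X t - X s)| <= beta) ->
  L * eps `^ theta * enorm v <= beta.
Proof.
move=> HL s01 eps01 H.
have beta0 : 0 <= beta.
  have := H s s01; rewrite subrr normr0 => /(_ _)/(le_trans _); apply => //.
  by case/andP: eps01 => /ltW.
have [v0|v0] := eqVneq (enorm v) 0; first by rewrite v0 mulr0.
have vgt0 : 0 < enorm v by rewrite lt_def v0 enorm_ge0.
have nv : enorm ((enorm v)^-1 *: v) = 1.
  by rewrite enormZ ?invr_ge0 ?enorm_ge0// mulVf.
have s01' : s \in `[0, 1] by rewrite in_itv.
have [t [t01 ts Ht]] := HL s eps _ s01' eps01 nv.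
rewrite in_itv /= in t01.
move: Ht; rewrite dotvZ normrM ger0_norm ?invr_ge0 ?enorm_ge0// => /ltW.
by rewrite [leRHS]mulrC ler_pdivlMr// => /le_trans; apply; exact: H.
Qed.

Lemma roughness_ge0 theta X : (0 <= roughness theta X)%E.
Proof. by apply: ereal_sup_ubound; left. Qed.

Lemma roughness_le theta X s eps (v : 'cV[R]_n) (beta : R) :
  0 <= s <= 1 -> 0 < eps <= 2^-1 -> 0 < enorm v -> 
  (forall t : R, 0 <= t <= 1 -> `|t - s| <= eps ->
     `|dotv v (X t - X s)| <= beta) ->
  (roughness theta X <= (beta / (eps `^ theta * enorm v))%:E)%E.
Proof.
move=> s01 eps01 v0 H.
have p0 : 0 < eps `^ theta * enorm v.
  by rewrite mulr_gt0// powR_gt0//; case/andP: eps01.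
apply: ge_ereal_sup => _ [->|[L [L0 HL] <-]]; rewrite lee_fin; last first.
  by rewrite ler_pdivlMr// mulrA; exact: (rough_with_le HL s01 eps01 H).
rewrite divr_ge0 ?(ltW p0)//; apply: le_trans (H s s01 _) => //.
by rewrite subrr normr0; case/andP: eps01 => /ltW.
Qed.

Lemma roughness_gt0 theta X : holder_rough theta X -> (0 < roughness theta X)%E.
Proof.
case=> L L0 HL; apply: (@lt_le_trans _ _ L%:E); first by rewrite lte_fin.
by apply: ereal_sup_ubound; right; exists L.
Qed.

(** The supremum defining the modulus may fail to be attained, but the non
    strict lower bound on the increments passes to it. *)
Lemma roughness_lower_bound theta X s eps (v : 'cV[R]_n) (beta L : R) :
  roughness theta X = L%:E -> 0 <= s <= 1 -> 0 < eps <= 2^-1 ->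
  (forall t : R, 0 <= t <= 1 -> `|t - s| <= eps ->
     `|dotv v (X t - X s)| <= beta) ->
  L * (eps `^ theta * enorm v) <= beta.
Proof.
move=> LE s01 eps01 H.
have [v0|v0] := eqVneq (enorm v) 0.
  rewrite v0 !mulr0; apply: le_trans (H s s01 _) => //.
  by rewrite subrr normr0; case/andP: eps01 => /ltW.
have vgt0 : 0 < enorm v by rewrite lt_def v0 enorm_ge0.
have := roughness_le theta s01 eps01 vgt0 H; rewrite LE lee_fin ler_pdivlMr//.
by rewrite mulr_gt0// powR_gt0//; case/andP: eps01.
Qed.

End roughness.

(** * The Norris lemma *)

Lemma adde_le_fine (R : realType) (a b : \bar R) :
  (0 <= a)%E -> (0 <= b)%E -> (a + b < +oo)%E ->
  (a <= (fine (a + b))%:E)%E /\ (b <= (fine (a + b))%:E)%E.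
Proof.
move=> a0 b0 aboo; have ab0 : (0 <= a + b)%E by exact: adde_ge0.
by rewrite fineK ?ge0_fin_numE// leeDl// leeDr.
Qed.

Lemma holder2_coord (R : realType) (m n : nat) (g K : R)
    (F : R -> R -> 'M[R]_(m, n)) :
  0 <= K -> (holder2 (@enorm R m n) g F <= K%:E)%E ->
  (forall s : R, 0 <= s <= 1 -> F s s = 0) ->
  forall (s t : R) i j, 0 <= s <= 1 -> 0 <= t <= 1 ->
    `|F s t i j| <= K * `|t - s| `^ g.
Proof.
move=> K0 HK F0 s t i j s01 t01; have [->|st] := eqVneq s t.
  by rewrite F0// mxE normr0 mulr_ge0// powR_ge0.
apply: le_trans (coord_le_enorm _ _ _) _.
exact: (@holder2_fineP _ _ _ g F K s t HK).
Qed.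

Lemma holder_coord (R : realType) (m n : nat) (g K : R) (f : R -> 'M[R]_(m, n)) :
  0 <= K -> (holder (@enorm R m n) g f <= K%:E)%E ->
  forall (s t : R) i j, 0 <= s <= 1 -> 0 <= t <= 1 ->
    `|(f t - f s) i j| <= K * `|t - s| `^ g.
Proof.
by move=> K0 HK; apply: (holder2_coord K0 HK) => s _; rewrite subrr.
Qed.

Lemma holder_bounded (R : realType) (m n : nat) (g : R) (f : R -> 'M[R]_(m, n)) :
  0 < g -> (holder (@enorm R m n) g f < +oo)%E ->
  (sup_norm (@enorm R m n) f < +oo)%E.
Proof.
move=> g0 foo; set h := holder _ _ _ in foo.
have h0 : (0 <= h)%E by apply: holder2_ge0 => M; exact: enorm_ge0.
have hfin : (h <= (fine h)%:E)%E by rewrite fineK// ge0_fin_numE.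
have c0 : 0 <= fine h by exact: fine_ge0.
have H := holder_coord c0 hfin.
apply: (@le_lt_trans _ _ ((m * n)%:R * (fine h + enorm (f 0)))%:E); last exact: ltry.
apply: sup_norm_le => t t01; rewrite lee_fin; apply: enorm_le => [|i j].
  by rewrite addr_ge0// enorm_ge0.
have -> : f t i j = (f t - f 0) i j + f 0 i j by rewrite !mxE subrK.
apply: le_trans (ler_normD _ _) _; apply: lerD; last exact: coord_le_enorm.
apply: le_trans (H 0 t i j _ t01) _; first by rewrite lexx ler01.
rewrite ler_piMr//; apply: powR_le1; rewrite ?normr_ge0 ?(ltW g0)//.
by rewrite subr0 ger0_norm; case/andP: t01.
Qed.

Lemma half_powR (R : realType) (p : R) : 0 < p < 1 ->
  2^-1 <= (2^-1 : R) `^ p.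
Proof.
by case/andP=> p0 p1; rewrite -[leLHS]powRr1//; apply: powR_anti; lra.
Qed.

(** The lower bound on iL, an inverse roughness, turns 1 + iL into a multiple of
    iL, so that the final estimate contains the pure power of the roughness. *)
Lemma norris_constant_bounds (R : realType) (sig nu K iL : R) :
  2 <= sig -> 1 <= nu -> 1 <= K -> 0 < iL -> 1 <= 2 * K * iL ->
  let Q := 4 * sig * nu * K * (1 + iL) in
  [/\ 4 <= Q, sig <= Q, nu <= Q, K <= Q & iL <= Q] /\
  Q <= 12 * sig * nu * K ^+ 2 * iL.
Proof.
move=> sig2 nu1 K1 iL0 KL Q.
have [a1 d1] : 1 <= sig /\ 1 <= 1 + iL by split; lra.
have P (a b : R) : 1 <= a -> 1 <= b -> [/\ 1 <= a * b, a <= a * b & b <= a * b].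
  by move=> *; split; nra.
have [e1 e2 e3] := P _ _ a1 nu1; have [f1 f2 f3] := P _ _ e1 K1.
have [h1 h2 h3] := P _ _ f1 d1.
have EQ : Q = 4 * (sig * nu * K * (1 + iL)) by rewrite /Q !mulrA.
split.
  rewrite EQ; move: (sig * nu * K) (sig * nu) (_ * _) e1 e2 e3 f1 f2 f3 h1 h2 h3.
  by move=> *; split; lra.
have -> : 12 * sig * nu * K ^+ 2 * iL =
  (4 * sig * nu * K) * (3 * K * iL) by ring.
have ? : iL <= K * iL by rewrite ler_peMl// ltW.
rewrite /Q; apply: ler_wpM2l; last by lra.
by rewrite mulr_ge0//; lra.
Qed.

(** For a process bounded by 1 this is norris_small; otherwise the a priori bounds
    on A and B suffice, as a positive power of the norm of the process is at least 1.
    The modulus of roughness is at most 2 K, by the Hoelder bound on X at scale 1/2,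
    which allows the constant to be written with the power -26 of the modulus. *)
Lemma rough_norris (R : realType) (n : nat) (gamma theta : R) (hn : (0 < n)%N) :
  3^-1 < gamma <= 2^-1 -> 0 < theta < 1 -> theta < 2 * gamma ->
  exists2 r : R, 0 < r &
  exists2 C : R, 0 <= C &
  forall (X : R -> 'cV[R]_n) (XX : R -> R -> 'M[R]_n)
         (A : R -> 'cV[R]_n) (A' : R -> 'M[R]_n) (B : R -> R) (K : R),
    is_rough_path gamma X XX ->
    is_controlled gamma X A A' ->
    (holder (@Num.norm R R) gamma B < +oo)%E ->
    holder_rough theta X ->
    K = 1 + fine (rough_path_norm gamma X XX) +
      fine (controlled_norm gamma X A A') +
      fine (holder_norm (@Num.norm R R) gamma B) ->
    (sup_norm (@enorm R n 1) A + sup_norm (@Num.norm R R) B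
     <= (C * K ^+ 52)%:E * poweR (inve (roughness theta X)) 26
        * poweR (sup_norm (@Num.norm R R) (rough_process X XX A A' B)) r)%E.
Proof.
move=> g_range th01 thg; have /andP[th0 th1] := th01.
have g0 : 0 < gamma by move: g_range; lra.
have alpha1 : 1 < 3 * gamma by move: g_range; lra.
pose r1 := (2 * gamma - theta) / (2 * gamma).
pose r2 := (3 * gamma - 1) / (3 * gamma).
pose r4 := gamma / (1 + gamma).
pose sig := sewing_const (3 * gamma).
have sig2 : 2 <= sig by exact: sewing_const_ge2.
have nu1 : 1 <= n%:R :> R by rewrite ler1n.
have r_pos : 0 < r1 * r1 * r2 * r4.
  have a0 : 0 < r1 by rewrite /r1 divr_gt0 ?subr_gt0// mulr_gt0.
  have b0 : 0 < r2 by rewrite /r2 divr_gt0 ?subr_gt0// mulr_gt0.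
  have c0 : 0 < r4 by rewrite /r4 divr_gt0// addr_gt0.
  by apply: mulr_gt0 => //; apply: mulr_gt0 => //; exact: mulr_gt0.
exists (r1 * r1 * r2 * r4) => //.
exists ((12 * sig * n%:R) ^+ 26).
  by rewrite exprn_ge0// mulr_ge0//; lra.
move=> X XX A A' B K [_ _ _ chen Xfin] [Afin A'fin Rfin] Bfin rough EK.

have K1_add (a b c : R) : 0 <= a -> 0 <= b -> 0 <= c ->
    [/\ a <= 1 + a + b + c, b <= 1 + a + b + c, c <= 1 + a + b + c
       & 1 <= 1 + a + b + c] by move=> *; split; lra.
have X0 : (0 <= holder (@enorm R n 1) gamma X)%E.
  by apply: holder2_ge0 => M; exact: enorm_ge0.
have XX0 : (0 <= holder2 (@enorm R n n) (2 * gamma) XX)%E.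
  by apply: holder2_ge0 => M; exact: enorm_ge0.
have A'0 : (0 <= holder (@enorm R n n) gamma A')%E.
  by apply: holder2_ge0 => M; exact: enorm_ge0.
have A's0 : (0 <= sup_norm (@enorm R n n) A')%E.
  by apply: sup_norm_ge0 => M; exact: enorm_ge0.
have R0 : (0 <= holder2 (@enorm R n 1) (2 * gamma) (remainder X A A'))%E.
  by apply: holder2_ge0 => M; exact: enorm_ge0.
have B0 : (0 <= holder (@Num.norm R R) gamma B)%E.
  by apply: holder2_ge0 => M; exact: normr_ge0.
have Bs0 : (0 <= sup_norm (@Num.norm R R) B)%E.
  by apply: sup_norm_ge0 => M; exact: normr_ge0.
have A'sfin := holder_bounded g0 A'fin.
have Bsfin : (sup_norm (@Num.norm R R) B < +oo)%E.
  set h := holder _ _ _ in Bfin B0.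
  have hfin : (h <= (fine h)%:E)%E by rewrite fineK// ge0_fin_numE.
  have c0 : 0 <= fine h by exact: fine_ge0.
  apply: (@le_lt_trans _ _ (fine h + `|B 0|)%:E); last exact: ltry.
  apply: sup_norm_le => t t01; rewrite lee_fin.
  have -> : B t = (B t - B 0) + B 0 by rewrite subrK.
  apply: le_trans (ler_normD _ _) _; rewrite lerD2r.
  have [->|t0] := eqVneq t 0; first by rewrite subrr normr0.
  have O : 0 <= (0 : R) <= 1 by rewrite lexx ler01.
  apply: le_trans (holder2_fineP hfin O t01 _) _; first by rewrite eq_sym.
  rewrite ler_piMr//; apply: powR_le1; rewrite ?normr_ge0 ?(ltW g0)//.
  by rewrite subr0 ger0_norm; case/andP: t01.
have A'Nfin : (holder_norm (@enorm R n n) gamma A' < +oo)%E by exact: lte_add_pinfty.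
have A'N0 : (0 <= holder_norm (@enorm R n n) gamma A')%E by exact: adde_ge0.
have e0 : (0 <= (enorm (A 0))%:E)%E by rewrite lee_fin enorm_ge0.
have eA'fin : ((enorm (A 0))%:E + holder_norm (@enorm R n n) gamma A' < +oo)%E.
  by apply: lte_add_pinfty => //; exact: ltry.
have eA'0 : (0 <= (enorm (A 0))%:E + holder_norm (@enorm R n n) gamma A')%E.
  exact: adde_ge0.
have Cfin : (controlled_norm gamma X A A' < +oo)%E by exact: lte_add_pinfty.
have BNfin : (holder_norm (@Num.norm R R) gamma B < +oo)%E by exact: lte_add_pinfty.
have [x1 x2] := adde_le_fine X0 XX0 Xfin.
have [c1 c2] := adde_le_fine eA'0 R0 Cfin.
have [b1 b2] := adde_le_fine Bs0 B0 BNfin.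
have [K1 K2 K3 K4] := K1_add _ _ _
  (fine_ge0 (adde_ge0 X0 XX0)) (fine_ge0 (adde_ge0 eA'0 R0))
  (fine_ge0 (adde_ge0 Bs0 B0)).
rewrite -EK in K1 K2 K3 K4.
have toK a b : (a <= b%:E)%E -> b <= K -> (a <= K%:E)%E.
  by move=> ab bK; apply: le_trans ab _; rewrite lee_fin.
have {x1}hX := toK _ _ x1 K1; have {x2}hXX := toK _ _ x2 K1.
have {c1}hA := toK _ _ c1 K2; have {c2}hR := toK _ _ c2 K2.
have {b1}hBs := toK _ _ b1 K3; have {b2}hB := toK _ _ b2 K3.
have hA0 : ((enorm (A 0))%:E <= K%:E)%E.
  by apply: le_trans hA; rewrite leeDl.
have hA'N : (holder_norm (@enorm R n n) gamma A' <= K%:E)%E.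
  by apply: le_trans hA; rewrite leeDr.
have hA's : (sup_norm (@enorm R n n) A' <= K%:E)%E.
  by apply: le_trans hA'N; rewrite leeDl.
have hA' : (holder (@enorm R n n) gamma A' <= K%:E)%E.
  by apply: le_trans hA'N; rewrite leeDr.
have K0 : 0 <= K by lra.
have X_h := holder_coord K0 hX; have A'_h := holder_coord K0 hA'.
have XX_h : forall (s t : R) i j, 0 <= s <= 1 -> 0 <= t <= 1 ->
    `|XX s t i j| <= K * `|t - s| `^ (2 * gamma).
  apply: (holder2_coord K0 hXX) => s s01; apply/matrixP => i j.
  have ss : s \in `[0, 1] by rewrite mem01.
  have E : (X s - X s) i 0 = 0 by rewrite subrr mxE.
  by have := chen s s s ss ss ss i j; rewrite E mul0r mxE; lra.
have R_h : forall (s t : R) i j, 0 <= s <= 1 -> 0 <= t <= 1 ->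
    `|remainder X A A' s t i j| <= K * `|t - s| `^ (2 * gamma).
  by apply: (holder2_coord K0 hR) => s s01; rewrite /remainder !subrr mulmx0 subrr.
have B_h : forall s t : R, 0 <= s <= 1 -> 0 <= t <= 1 ->
    `|B t - B s| <= K * `|t - s| `^ gamma.
  move=> s t s01 t01; have [->|st] := eqVneq s t.
    by rewrite !subrr normr0 mulr_ge0// powR_ge0.
  exact: (@holder2_fineP _ _ _ gamma _ K s t hB).
have A'_b : forall (t : R) i j, 0 <= t <= 1 -> `|A' t i j| <= K.
  move=> t i j t01; apply: le_trans (coord_le_enorm _ _ _) _.
  by rewrite -lee_fin; apply: le_trans (sup_norm_ge _ _ t01) _.
have B_b : forall t : R, 0 <= t <= 1 -> `|B t| <= K.
  move=> t t01; rewrite -lee_fin.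
  exact: (le_trans (sup_norm_ge (@Num.norm R R) B t01) hBs).
have A0_b : forall i, `|A 0 i 0| <= K.
  by move=> i; apply: le_trans (coord_le_enorm _ _ _) _; rewrite -lee_fin.
pose IB t := \int[lebesgue_measure]_(s in `[0, t]) B s.
have IB_e := drift_expansion g0 K0 B_h.
have IB0 : IB 0 = 0 by rewrite /IB set_itv1 Rintegral_set1.
pose i0 := Ordinal hn.
pose v0 : 'cV[R]_n := delta_mx i0 0.
have v0_ge1 : 1 <= enorm v0.
  by have := coord_le_enorm v0 i0 0; rewrite mxE !eqxx normr1.
have L_le : (roughness theta X <= (2 * K)%:E)%E.
  have O : 0 <= (0 : R) <= 1 by rewrite lexx ler01.
  have h2 : 0 < (2^-1 : R) <= 2^-1 by rewrite invr_gt0 ltr0n lexx.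
  have v0_gt0 : 0 < enorm v0 by exact: lt_le_trans v0_ge1.
  apply: le_trans (roughness_le (beta := K) theta O h2 v0_gt0 _) _.
    move=> t t01 _; rewrite /dotv (bigD1 i0)//= big1 ?addr0; last first.
      by move=> i ii0; rewrite mxE (negbTE ii0) mul0r.
    rewrite mxE !eqxx mul1r; apply: le_trans (X_h _ _ _ _ O t01) _.
    rewrite ler_piMr//; apply: powR_le1; rewrite ?normr_ge0 ?(ltW g0)//.
    by rewrite subr0 ger0_norm; case/andP: t01.
  have p2 : 2^-1 <= (2^-1 : R) `^ theta by exact: half_powR.
  rewrite lee_fin ler_pdivrMr; last by rewrite mulr_gt0// powR_gt0// invr_gt0.
  have : 2^-1 * 1 <= 2^-1 `^ theta * enorm v0 by apply: ler_pM.
  rewrite mulr1 => H; apply: (@le_trans _ _ (2 * K * 2^-1)).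
    by rewrite mulrAC divff ?mul1r.
  by apply: ler_wpM2l => //; rewrite mulr_ge0.
have := roughness_gt0 rough.
case LE : (roughness theta X) L_le => [L| |]; rewrite ?lee_fin ?lte_fin//.
move=> L2K L0.
have iL0 : 0 < L^-1 by rewrite invr_gt0.
have KL : 1 <= 2 * K * L^-1 by rewrite ler_pdivlMr// mul1r.
pose Q := 4 * sig * n%:R * K * (1 + L^-1).
have [[Q4 Qsig QN QK QL] Q12] := norris_constant_bounds sig2 nu1 K4 iL0 KL.
rewrite -/Q in Q4 Qsig QN QK QL Q12.
have Q0 : 0 <= Q by exact: le_trans Q4.
have rough_v : forall (s eps : R) (v : 'I_n -> R) (beta : R), 0 <= s <= 1 ->
  0 < eps <= 2^-1 ->
  (forall t : R, 0 <= t <= 1 -> `|t - s| <= eps ->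
     `|\sum_j v j * (X t - X s) j 0| <= beta) ->
  forall i, `|v i| <= Q * (beta * eps `^ (- theta)).
  move=> s eps v beta s01 eps01 H i.
  have pe : 0 < eps `^ theta by rewrite powR_gt0//; case/andP: eps01.
  have Hd : forall t : R, 0 <= t <= 1 -> `|t - s| <= eps ->
      `|dotv (\col_j v j) (X t - X s)| <= beta.
    move=> t t01 ts; rewrite /dotv; under eq_bigr do rewrite mxE.
    exact: H.
  have := roughness_lower_bound LE s01 eps01 Hd.
  have cv : `|v i| <= enorm (\col_j v j).
    by have := coord_le_enorm (\col_j v j) i 0; rewrite mxE.
  rewrite mulrC -ler_pdivlMr// mulrC -ler_pdivlMr// => /(le_trans cv)/le_trans; apply.
  have b0 : 0 <= beta.
    apply: le_trans (H s s01 _) => //.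
    by rewrite subrr normr0; case/andP: eps01 => /ltW.
  rewrite powRN -mulrA mulrCA; apply: ler_wpM2r => //.
  by rewrite divr_ge0// ltW.
pose Z := rough_process X XX A A' B.
have A'_h2 : forall (s t : R) i j, 0 <= s <= 1 -> 0 <= t <= 1 ->
    `|A' t i j - A' s i j| <= K * `|t - s| `^ gamma.
  by move=> s t i j s01 t01; have := A'_h s t i j s01 t01; rewrite !mxE.
have X_h0 s t i := X_h s t i 0; have R_h0 s t i := R_h s t i 0.
have Ab : forall (t : R) i, 0 <= t <= 1 -> `|A t i 0| <= Q ^+ 5.
  by apply: (A_bounded (X := X) (A' := A') (g := gamma) (K := K)).
have small z : 0 <= z -> z <= 1 -> (forall t : R, 0 <= t <= 1 -> `|Z t| <= z) ->
    forall (t : R) i, 0 <= t <= 1 ->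
    `|A t i 0| <= Q ^+ 24 * z `^ (r1 * r1 * r2 * r4) /\
    `|B t| <= Q ^+ 24 * z `^ (r1 * r1 * r2 * r4).
  move=> z0 z1 HZ.
  by apply: (norris_small (X := X) (XX := XX) (A' := A') (IB := IB) (K := K)).
set r := r1 * r1 * r2 * r4.
have r_gt0 : 0 < r by exact: r_pos.
set zE := sup_norm _ (rough_process _ _ _ _ _).
have zE0 : (0 <= zE)%E by apply: sup_norm_ge0 => x; exact: normr_ge0.
have HZ (t : R) : 0 <= t <= 1 -> (`|Z t|%:E <= zE)%E.
  exact: (sup_norm_ge (@Num.norm R R)).
have C_gt0 : 0 < (12 * sig * n%:R) ^+ 26 * K ^+ 52.
  have sig0 : 0 < sig by exact: lt_le_trans sig2.
  have nu0 : 0 < n%:R :> R by rewrite ltr0n.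
  apply: mulr_gt0; apply: exprn_gt0; last exact: lt_le_trans K4.
  by apply: mulr_gt0 => //; exact: mulr_gt0.
have -> : (L%:E^-1)%E = (L^-1)%:E by rewrite inver gt_eqF.
rewrite poweR_EFin powR_mulrn ?(ltW iL0)//.
have coef_gt0 : 0 < (12 * sig * n%:R) ^+ 26 * K ^+ 52 * L^-1 ^+ 26.
  by apply: mulr_gt0 => //; exact: exprn_gt0.
rewrite -EFinM.
case Ez : zE zE0 HZ => [z| |] //; last first.
  move=> _ _; rewrite poweRyr ?gt_eqF// gt0_muley ?lte_fin//; exact: leey.
rewrite lee_fin => z0 HZ.
rewrite poweR_EFin -EFinM.
have zr0 : 0 <= z `^ r by exact: powR_ge0.
have Q1 : 1 <= Q by apply: le_trans Q4; rewrite ler1n.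
have Qp k : 0 <= Q ^+ k by exact: exprn_ge0.
have bounds (t : R) : 0 <= t <= 1 ->
    enorm (A t) <= Q ^+ 25 * z `^ r /\ `|B t| <= Q ^+ 25 * z `^ r.
  move=> t01; have [z1|z1] := leP z 1.
    have {}small := small z z0 z1 (fun t t01 => HZ t t01) t _ t01.
    have Qz : 0 <= Q ^+ 24 * z `^ r by rewrite mulr_ge0.
    split; last first.
      apply: le_trans (small i0).2 _; apply: ler_wpM2r => //.
      by apply: ler_weXn2l.
    apply: le_trans (enorm_le Qz _) _.
      by move=> i j; rewrite ord1; exact: (small i).1.
    by rewrite muln1 mulrA; apply: ler_wpM2r => //; rewrite (exprS Q 24); apply: ler_wpM2r.
  have zr1 : 1 <= z `^ r.
    by have := powR_mono (ltW r_gt0) ler01 (ltW z1); rewrite powR1.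
  have Q25 x : x <= Q ^+ 25 -> x <= Q ^+ 25 * z `^ r.
    by move=> /le_trans; apply; rewrite ler_peMr.
  split; apply: Q25.
    apply: le_trans (enorm_le (Qp 5) _) _; first by move=> i j; rewrite ord1; exact: Ab.
    rewrite muln1; apply: (@le_trans _ _ (Q ^+ 6)); last exact: ler_weXn2l.
    by rewrite (exprS Q 5); apply: ler_wpM2r.
  apply: le_trans (B_b _ t01) _; apply: (le_trans QK).
  by rewrite -[leLHS]expr1; exact: ler_weXn2l.
have sA : (sup_norm (@enorm R n 1) A <= (Q ^+ 25 * z `^ r)%:E)%E.
  by apply: sup_norm_le => t t01; rewrite lee_fin; exact: (bounds t t01).1.
have sB : (sup_norm (@Num.norm R R) B <= (Q ^+ 25 * z `^ r)%:E)%E.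
  by apply: sup_norm_le => t t01; rewrite lee_fin; exact: (bounds t t01).2.
apply: le_trans (leeD sA sB) _.
rewrite -EFinD lee_fin -mulrDl; apply: ler_wpM2r => //.
apply: (@le_trans _ _ (Q ^+ 26)).
  rewrite (exprS Q 25); have := ler_wpM2r (Qp 25) Q4.
  move: (Q ^+ 25) (Qp 25%N) => a; clear; lra.
have -> : (12 * sig * n%:R) ^+ 26 * K ^+ 52 * L^-1 ^+ 26 =
    (12 * sig * n%:R * K ^+ 2 * L^-1) ^+ 26 by rewrite (exprM K 2 26) -!exprMn.
by apply: lerXn2r => //; rewrite nnegrE//; exact: le_trans Q12.
Qed.

(** * Gaussian integrals on the line *)

Section gaussian_integrals.
Context {R : realType}.
Local Notation mu := (@lebesgue_measure R).
Variable s : R.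
Hypothesis s_neq0 : s != 0.
Local Notation w := (normal_pdf 0 s).

Let s2_gt0 : 0 < s ^+ 2. Proof. by rewrite exprn_even_gt0. Qed.

Lemma pdf_centeredE x : w x = normal_peak s * expR (- (x ^+ 2 / (2 * s ^+ 2))).
Proof.
rewrite normal_pdfE// /normal_fun subr0; congr (_ * expR _).
by rewrite -mulr_natl mulNr.
Qed.

Lemma pdf_is_derive (x : R) : is_derive x 1 w (- (x / s ^+ 2) * w x).
Proof.
have -> : w = (fun x => normal_peak s * expR (- (x ^+ 2 / (2 * s ^+ 2)))).
  by apply/funext => y; exact: pdf_centeredE.
have H : is_derive x 1 (fun y : R => - (y ^+ 2 / (2 * s ^+ 2))) (- (x / s ^+ 2)).
  apply: is_derive_eq.
  by rewrite /GRing.scale/= !mulr1 mulr0 add0r; field.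
apply: is_derive_eq; rewrite /GRing.scale/=; ring.
Qed.

Lemma sqr_pdf_le (x : R) : x ^+ 2 * w x <= 2 * s ^+ 2 * normal_peak s.
Proof.
have p0 := normal_peak_ge0 s.
rewrite pdf_centeredE mulrCA [leRHS]mulrC ler_wpM2l//.
have := expR_ge1Dx (x ^+ 2 / (2 * s ^+ 2)).
rewrite expRN ler_pdivrMr ?expR_gt0//.
set e := expR _ => H.
have -> : x ^+ 2 = 2 * s ^+ 2 * (x ^+ 2 / (2 * s ^+ 2)).
  by field.
by apply: ler_wpM2l; [rewrite mulr_ge0// ltW|lra].
Qed.

Lemma cvg_id_pdf : (n%:R * w n%:R) @[n --> \oo] --> (0 : R).
Proof.
have C0 : 0 <= 4 * s ^+ 2 * normal_peak s.
  by apply: mulr_ge0; [rewrite mulr_ge0// ltW|exact: normal_peak_ge0].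
apply: (@squeeze_cvgr _ _ _ _ (cst 0)
  (fun n => 4 * s ^+ 2 * normal_peak s * harmonic n)).
- apply: nearW => n; rewrite mulr_ge0 ?normal_pdf_ge0//=.
  rewrite /harmonic/= ler_pdivlMr//.
  have := sqr_pdf_le n%:R; have := normal_pdf_ge0 0 s (n%:R : R).
  have n0 : 0 <= n%:R :> R by [].
  have nn : n%:R <= n%:R ^+ 2 :> R.
    by rewrite -natrX ler_nat; case: (n) => // k; rewrite expnS expn1 leq_pmulr.
  rewrite -natr1; move: (w _) (normal_peak s) nn => a b; nra.
- exact: cvg_cst.
- rewrite -[X in _ --> X](mulr0 (4 * s ^+ 2 * normal_peak s)).
  by apply: cvgM; [exact: cvg_cst|exact: cvg_harmonic].
Qed.

Lemma pdf_even (x : R) : w (- x) = w x.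
Proof. by rewrite !pdf_centeredE sqrrN. Qed.

(** The fundamental theorem of calculus on [-n, n], with F vanishing at infinity. *)
Lemma integral_derivative_eq0 (F h : R -> R) :
  (forall x : R, is_derive x 1 F (h x)) -> continuous h ->
  mu.-integrable setT (EFin \o h) ->
  (forall x : R, 1 <= `|x| -> `|F x| <= `|x| * w x) ->
  \int[mu]_x h x = 0.
Proof.
move=> Fh ch ih FW.
pose D (n : nat) : set R := [set` `[- n%:R, n%:R]%R].
pose f_ n : R -> \bar R := EFin \o (h \_ (D n)).
have mh : measurable_fun setT h by exact: measurable_realfun.continuous_measurable_fun.
have cv : (\int[mu]_x f_ n x)%E @[n --> \oo] --> (\int[mu]_x (h x)%:E)%E.
  apply: (@dominated_cvg _ _ _ mu setT measurableT f_ (EFin \o h)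
    (fun x => `|h x|%:E)) => //.
  - move=> n; have mDn : measurable (D n) by exact: measurable_itv.
    apply/measurable_EFinP; apply: (measurable_restrictT h mDn).1.
    exact: measurable_funTS.
  - move=> x _; apply: cvg_near_cst; near=> n.
    rewrite /f_/= patchE mem_set//= /D /= in_itv/= -ler_norml.
    by near: n; exact: nbhs_infty_ger.
  - exact: (integrable_norm ih).
  - by move=> n x _; rewrite /f_/= patchE lee_fin; case: ifPn => //= _; rewrite normr0.
have E : \forall n \near \oo, (\int[mu]_x f_ n x)%E = (F n%:R - F (- n%:R))%:E.
  near=> n.
  have n0 : (0 < n)%N by near: n; exact: nbhs_infty_gt.
  rewrite /f_ -restrict_EFin -integral_mkcond (@continuous_FTC2 _ h F)//.
  - by rewrite -subr_gt0 opprK addr_gt0 ?ltr0n.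
  - exact: continuous_subspaceT.
  - split.
    + by move=> x _; have [] := Fh x.
    + apply: cvg_at_right_filter; apply: differentiable_continuous.
      by apply/derivable1_diffP; have [] := Fh (- n%:R).
    + apply: cvg_at_left_filter; apply: differentiable_continuous.
      by apply/derivable1_diffP; have [] := Fh n%:R.
  - by move=> x _; rewrite derive1E; have [_ ->] := Fh x.
have cv2 : (F n%:R - F (- n%:R)) @[n --> \oo] --> (0 : R).
  apply: norm_cvg0; apply: (@squeeze_cvgr _ _ _ _ (cst 0)
    (fun n => 2 * (n%:R * w n%:R))).
  - near=> n; rewrite normr_ge0/=.
    have n0 : (0 < n)%N by near: n; exact: nbhs_infty_gt.
    have n1 : 1 <= `|n%:R : R| by rewrite ger0_norm// ler1n.
    have := FW _ n1; have := FW (- n%:R).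
    rewrite normrN pdf_even ger0_norm// => /(_ _) H1 H2.
    apply: le_trans (ler_normB _ _) _; rewrite mulr_natl mulr2n lerD//.
    by apply: H1; rewrite ler1n.
  - exact: cvg_cst.
  - rewrite -[X in _ --> X](mulr0 2).
    by apply: cvgM; [exact: cvg_cst|exact: cvg_id_pdf].
rewrite /Rintegral.
suff -> : (\int[mu]_x (h x)%:E = 0%:E)%E by [].
have cv3 : (F n%:R - F (- n%:R))%:E @[n --> \oo] --> 0%:E.
  by apply: cvg_EFin; [exact: nearW|exact: cv2].
have cv4 : (\int[mu]_x f_ n x)%E @[n --> \oo] --> 0%:E.
  apply: cvg_trans cv3; apply: near_eq_cvg.
  by apply: filterS E => n ->.
exact: (cvg_unique _ cv cv4).
Unshelve. all: by end_near. Qed.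

Local Notation s' := (Num.sqrt 2 * s).

Let s'_neq0 : s' != 0.
Proof. by rewrite mulf_neq0// gt_eqF// sqrtr_gt0. Qed.

Let s'2 : s' ^+ 2 = 2 * s ^+ 2.
Proof. by rewrite exprMn sqr_sqrtr. Qed.

(** A factor exp(x^2 / (4 s^2)) only widens the Gaussian density.  It dominates
    polynomial factors, and it is the exponential weight of the tail bound. *)
Lemma exp_quarter_pdf (x : R) : expR (x ^+ 2 / (4 * s ^+ 2)) * w x =
  Num.sqrt 2 * normal_pdf 0 s' x.
Proof.
rewrite pdf_centeredE normal_pdfE// /normal_fun subr0 s'2.
have -> : normal_peak s = Num.sqrt 2 * normal_peak s'.
  rewrite /normal_peak s'2.
  have -> : (2 * s ^+ 2 * pi *+ 2) = 2 * (s ^+ 2 * pi *+ 2).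
    by rewrite -mulrA -mulrnAr.
  by rewrite sqrtrM// invfM mulrA divff ?mul1r.
rewrite mulrCA -mulrA; congr (_ * (_ * _)).
rewrite -expRD; congr expR.
have -> : 2 * s ^+ 2 *+ 2 = 4 * s ^+ 2 by rewrite -mulrnAl -mulrnA.
by field.
Qed.

Lemma sqr_le_exp_quarter (x : R) :
  1 + x ^+ 2 <= (1 + 4 * s ^+ 2) * expR (x ^+ 2 / (4 * s ^+ 2)).
Proof.
have := expR_ge1Dx (x ^+ 2 / (4 * s ^+ 2)); set e := expR _ => H.
have E : x ^+ 2 = 4 * s ^+ 2 * (x ^+ 2 / (4 * s ^+ 2)) by field.
have e1 : 1 <= e.
  by apply: le_trans H; rewrite lerDl divr_ge0 ?sqr_ge0// mulr_ge0// ltW.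
rewrite [leRHS]mulrDl mul1r; apply: lerD => //; rewrite [leLHS]E.
by apply: ler_wpM2l; [rewrite mulr_ge0// ltW|lra].
Qed.

Lemma pdf_dominated_integrable (f : R -> R) (c : R) : measurable_fun setT f ->
  (forall x, `|f x| <= c * ((1 + x ^+ 2) * w x)) -> 
  mu.-integrable setT (EFin \o f).
Proof.
move=> mf H.
have c0 : 0 <= c.
  have := H 0; rewrite expr0n/= addr0 mul1r.
  move=> /(le_trans (normr_ge0 _)); rewrite pmulr_lge0//.
  by rewrite normal_pdfE// mulr_gt0 ?normal_peak_gt0// expR_gt0.
pose K := c * ((1 + 4 * s ^+ 2) * Num.sqrt 2).
have K0 : 0 <= K.
  rewrite /K mulr_ge0// mulr_ge0 ?sqrtr_ge0// addr_ge0// mulr_ge0// ltW//.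
have iK : mu.-integrable setT (fun x => K%:E * (normal_pdf 0 s' x)%:E)%E.
  by apply: integrableZl => //; exact: integrable_normal_pdf.
apply: le_integrable iK => //; first exact/measurable_EFinP.
move=> x _ /=; rewrite lee_fin.
apply: le_trans (H x) _.
rewrite ger0_norm; last by rewrite mulr_ge0// normal_pdf_ge0.
rewrite /K -mulrA; apply: ler_wpM2l => //.
rewrite -mulrA -exp_quarter_pdf mulrA; apply: ler_wpM2r; first exact: normal_pdf_ge0.
exact: sqr_le_exp_quarter.
Qed.

(** The function w - (x^2 / s^2) w is the derivative of x w. *)
Lemma second_moment_pdf : \int[mu]_x (x ^+ 2 * w x) = s ^+ 2.
Proof.
have p0 x : 0 <= w x by exact: normal_pdf_ge0.
pose h x := w x - (x ^+ 2 / s ^+ 2) * w x.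
have ch : continuous h.
  move=> x; apply: cvgB; first exact: continuous_normal_pdf.
  apply: cvgM; last exact: continuous_normal_pdf.
  by apply: cvgM; [exact: exprn_continuous|exact: cvg_cst].
have iw : mu.-integrable setT (EFin \o w) by exact: integrable_normal_pdf.
have i2 : mu.-integrable setT (EFin \o (fun x => x ^+ 2 * w x)).
  apply: (@pdf_dominated_integrable _ 1).
    apply: continuous_measurable_fun => x; apply: cvgM; last exact: continuous_normal_pdf.
    exact: exprn_continuous.
  move=> x; rewrite mul1r normrM (ger0_norm (p0 _)) ger0_norm ?sqr_ge0//.
  by apply: ler_wpM2r => //; rewrite lerDr.
have ih : mu.-integrable setT (EFin \o h).
  apply: (@pdf_dominated_integrable _ (1 + (s ^+ 2)^-1)).
    exact: continuous_measurable_fun.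
  move=> x; rewrite /h -[X in X - _]mul1r -mulrBl normrM (ger0_norm (p0 _)) mulrA.
  apply: ler_wpM2r => //; apply: le_trans (ler_normB _ _) _.
  rewrite normr1 ger0_norm ?divr_ge0 ?sqr_ge0//.
  have : 0 <= (s ^+ 2)^-1 by rewrite invr_ge0 ltW.
  by have := sqr_ge0 x; nra.
have Fh (x : R) : is_derive x 1 (fun y => y * w y) (h x).
  have := pdf_is_derive x => H.
  apply: is_derive_eq; rewrite /GRing.scale/= /h; ring.
have := integral_derivative_eq0 Fh ch ih _.
have FW (x : R) : 1 <= `|x| -> `|x * w x| <= `|x| * w x.
  by move=> _; rewrite normrM (ger0_norm (p0 _)).
move=> /(_ FW); rewrite /h RintegralB//; last first.
  have := i2; have -> : (fun x => x ^+ 2 / s ^+ 2 * w x) = (fun x => (s ^+ 2)^-1 * (x ^+ 2 * w x)).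
    by apply/funext => x; ring.
  move=> /(integrableZl measurableT (s ^+ 2)^-1).
  by under eq_fun do rewrite -EFinM.
have -> : \int[mu]_x (x ^+ 2 / s ^+ 2 * w x) = (s ^+ 2)^-1 * \int[mu]_x (x ^+ 2 * w x).
  by rewrite -RintegralZl//; apply: eq_Rintegral => x _; ring.
have -> : \int[mu]_x w x = 1 by rewrite /Rintegral integral_normal_pdf.
move=> /eqP; rewrite subr_eq0 => /eqP H.
by rewrite -[RHS]mulr1 H mulrA divff ?mul1r// gt_eqF.
Qed.

Lemma is_derive_sinM (t x : R) : is_derive x 1 (fun y => sin (t * y)) (t * cos (t * x)).
Proof. by apply: is_derive_eq; rewrite /GRing.scale/= ?mulr1 ?mulr0 ?addr0; ring. Qed.

Let cosM_continuous (t : R) : continuous (fun x => cos (t * x)).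
Proof.
move=> x; apply: (cvg_comp (fun x => t * x) cos); last exact: continuous_cos.
by apply: cvgM; [exact: cvg_cst|exact: cvg_id].
Qed.

Let sinM_continuous (t : R) : continuous (fun x => sin (t * x)).
Proof.
move=> x; apply: (cvg_comp (fun x => t * x) sin); last exact: continuous_sin.
by apply: cvgM; [exact: cvg_cst|exact: cvg_id].
Qed.

Let abs_le (x : R) : `|x| <= 1 + x ^+ 2.
Proof.
rewrite -(sqr_norm_real x).
by have := normr_ge0 x; nra.
Qed.

Definition pdf_fourier (t : R) : R := \int[mu]_x (cos (t * x) * w x).

Let cos_le1 (y : R) : `|cos y| <= 1.
Proof. by rewrite ler_norml cos_geN1 cos_le1. Qed.

Let sin_le1 (y : R) : `|sin y| <= 1.
Proof. by rewrite ler_norml sin_geN1 sin_le1. Qed.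

Let p0 x : 0 <= w x. Proof. exact: normal_pdf_ge0. Qed.

Lemma integrable_cos_pdf t : mu.-integrable setT (EFin \o (fun x => cos (t * x) * w x)).
Proof.
apply: (@pdf_dominated_integrable _ 1).
  apply: continuous_measurable_fun => x.
  by apply: cvgM; [exact: cosM_continuous|exact: continuous_normal_pdf].
move=> x; rewrite mul1r normrM (ger0_norm (p0 _)); apply: ler_wpM2r => //.
by apply: le_trans (cos_le1 _) _; rewrite lerDl sqr_ge0.
Qed.

Lemma integrable_xsin_pdf t :
  mu.-integrable setT (EFin \o (fun x => x * sin (t * x) * w x)).
Proof.
apply: (@pdf_dominated_integrable _ 1).
  apply: continuous_measurable_fun => x.
  apply: cvgM; last exact: continuous_normal_pdf.
  by apply: cvgM; [exact: cvg_id|exact: sinM_continuous].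
move=> x; rewrite mul1r normrM (ger0_norm (p0 _)); apply: ler_wpM2r => //.
by rewrite normrM; apply: le_trans (abs_le x); rewrite ler_piMr.
Qed.

(** Integration by parts, as x w is - s^2 times the derivative of w. *)
Lemma integral_xsin_pdf t :
  \int[mu]_x (x * sin (t * x) * w x) = s ^+ 2 * t * pdf_fourier t.
Proof.
pose h x := t * (cos (t * x) * w x) - (s ^+ 2)^-1 * (x * sin (t * x) * w x).
have ic := integrable_cos_pdf t; have ixs := integrable_xsin_pdf t.
have itc : mu.-integrable setT (EFin \o (fun x => t * (cos (t * x) * w x))).
  have := integrableZl measurableT t ic.
  by under [X in _ -> mu.-integrable _ X]eq_fun do rewrite /= EFinM.
have iss : mu.-integrable setT
    (EFin \o (fun x => (s ^+ 2)^-1 * (x * sin (t * x) * w x))).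
  have := integrableZl measurableT (s ^+ 2)^-1 ixs.
  by under [X in _ -> mu.-integrable _ X]eq_fun do rewrite /= EFinM.
have ih : mu.-integrable setT (EFin \o h).
  have := integrableB measurableT itc iss.
  by under [X in _ -> mu.-integrable _ X]eq_fun do rewrite /= EFinB.
have ch : continuous h.
  move=> x; apply: cvgB; (apply: cvgM; first exact: cvg_cst);
    (apply: cvgM; last exact: continuous_normal_pdf).
    exact: cosM_continuous.
  by apply: cvgM; [exact: cvg_id|exact: sinM_continuous].
have Fh (x : R) : is_derive x 1 (fun y => sin (t * y) * w y) (h x).
  have := pdf_is_derive x => H1; have := is_derive_sinM t x => H2.
  apply: is_derive_eq; rewrite /GRing.scale/= /h; ring.
have FW (x : R) : 1 <= `|x| -> `|sin (t * x) * w x| <= `|x| * w x.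
  move=> x1; rewrite normrM (ger0_norm (p0 _)); apply: ler_wpM2r => //.
  exact: le_trans (sin_le1 _) x1.
have := integral_derivative_eq0 Fh ch ih FW.
rewrite /h RintegralB// !RintegralZl// => /eqP; rewrite subr_eq0 => /eqP H.
rewrite -mulrA /pdf_fourier H mulrA divff ?mul1r// gt_eqF//.
Qed.

Lemma pdf_fourier_is_derive (t : R) :
  is_derive t 1 pdf_fourier (- (s ^+ 2 * t * pdf_fourier t)).
Proof.
pose f t x := cos (t * x) * w x.
have Ia : `]t - 1, t + 1[%classic t by rewrite /= in_itv/=; apply/andP; split; lra.
have df (u x : R) : is_derive u 1 (f ^~ x) (- (x * sin (u * x) * w x)).
  apply: is_derive_eq; rewrite /GRing.scale/= ?mulr0 ?mulr1 ?addr0 ?add0r; ring.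
have intf : forall u, `]t - 1, t + 1[%classic u -> mu.-integrable setT (EFin \o f u).
  by move=> u _; exact: integrable_cos_pdf.
have der : forall u x, `]t - 1, t + 1[%classic u -> [set: R] x -> derivable (f ^~ x) u 1.
  by move=> u x _ _; have [] := df u x.
pose G x := `|x| * w x.
have G0 x : 0 <= G x by rewrite mulr_ge0.
have iG : mu.-integrable setT (EFin \o G).
  apply: (@pdf_dominated_integrable _ 1).
    apply: continuous_measurable_fun => x; apply: cvgM; last exact: continuous_normal_pdf.
    by apply: cvg_norm; exact: cvg_id.
  by move=> x; rewrite mul1r ger0_norm//; apply: ler_wpM2r.
have Gub : forall u x, `]t - 1, t + 1[%classic u -> [set: R] x ->
    `|partial1of2 f u x| <= G x.
  move=> u x _ _; rewrite partial1of2E; have [_ ->] := df u x.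
  rewrite normrN !normrM (ger0_norm (p0 _)); apply: ler_wpM2r => //.
  by rewrite ler_piMr.
have D := @derivable_under_integral R _ _ mu f setT measurableT t _ _ Ia intf der G G0 iG Gub.
have V := @differentiation_under_integral R _ _ mu f setT measurableT t _ _ Ia intf der G G0 iG Gub.
split; first exact: D.
rewrite -derive1E V -integral_xsin_pdf.
rewrite -mulN1r -RintegralZl//; last exact: integrable_xsin_pdf.
apply: eq_Rintegral => x _; rewrite partial1of2E; have [_ ->] := df t x.
by rewrite mulN1r.
Qed.

(** The transform f satisfies f' = - s^2 t f and f(0) = 1. *)
Lemma pdf_fourierE (t : R) : pdf_fourier t = expR (- (s ^+ 2 * t ^+ 2 / 2)).
Proof.
pose G t := pdf_fourier t * expR (s ^+ 2 * t ^+ 2 / 2).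
have dG (u : R) : is_derive u 1 G 0.
  have H1 := pdf_fourier_is_derive u.
  have H2 : is_derive u 1 (fun t : R => s ^+ 2 * t ^+ 2 / 2) (s ^+ 2 * u).
    by apply: is_derive_eq; rewrite /GRing.scale/= ?mulr0 ?mulr1 ?addr0 ?add0r; field.
  by apply: is_derive_eq; rewrite /GRing.scale/=; ring.
have := is_derive_0_is_cst t 0 dG.
rewrite /G expr0n/= mulr0 mul0r expR0 mulr1.
have -> : pdf_fourier 0 = 1.
  rewrite /pdf_fourier; under eq_Rintegral do rewrite mul0r cos0 mul1r.
  by rewrite /Rintegral integral_normal_pdf.
move=> H; have e0 : expR (s ^+ 2 * t ^+ 2 / 2) != 0 by rewrite gt_eqF// expR_gt0.
by apply: (mulIf e0); rewrite H expRN mulVf.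
Qed.

End gaussian_integrals.

Lemma integral_normal_prob (R : realType) (s : R) (f : R -> \bar R) :
  (normal_prob 0 s).-integrable setT f ->
  (\int[normal_prob 0 s]_x f x =
   \int[lebesgue_measure]_x (f x * (normal_pdf 0 s x)%:E))%E.
Proof.
move=> fi; have mf := measurable_int _ fi.
rewrite -(Radon_Nikodym_change_of_variables (normal_prob_dominates 0 s))//=.
apply: ae_eq_integral => //.
- apply: emeasurable_funM => //; apply: (measurable_int lebesgue_measure).
  by apply: Radon_Nikodym_integrable; exact: normal_prob_dominates.
- apply: emeasurable_funM => //=; apply/measurableT_comp => //=.
  exact: measurable_normal_pdf.
- apply: ae_eqe_mul2l => /=.
  rewrite Radon_NikodymE//=; first exact: normal_prob_dominates.
  move=> dom; case: cid => /= h [h1 h2 h3].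
  apply: integral_ae_eq => //=.
  + by apply/measurable_EFinP; exact: measurable_normal_pdf.
  + by move=> E _ mE; rewrite -h3.
Qed.

Section gaussian_variable.
Context {R : realType} {d : measure_display} {T : measurableType d}.
Variable P : probability T R.
Variable Y : T -> R.
Hypothesis mY : measurable_fun setT Y.
Let mY_mixin := @isMeasurableFun.Build _ _ T (measurableTypeR R) Y mY.
Let mY_pack : {mfun T >-> measurableTypeR R} := HB.pack Y mY_mixin.

Lemma integral_gaussian_law (s : R) (f : R -> R) :
  (forall B : set R, measurable B -> P (Y @^-1` B) = normal_prob 0 s B) ->
  measurable_fun setT f -> P.-integrable setT (EFin \o (f \o Y)) ->
  (\int[P]_w (f (Y w))%:E =
   \int[lebesgue_measure]_x (f x * normal_pdf 0 s x)%:E)%E.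
Proof.
move=> H mf fi.
pose m1 : {measure set (measurableTypeR R) -> \bar R} := distribution P mY_pack.
pose m2 : {measure set (measurableTypeR R) -> \bar R} := normal_prob 0 s.
have m21 : forall A : set (measurableTypeR R), measurable A -> A `<=` setT ->
    m2 A = m1 A by move=> A mA _; exact/esym/H.
have mfE : measurable_fun [set: measurableTypeR R] (EFin \o f).
  exact/measurable_EFinP.
have fn : (normal_prob 0 s).-integrable setT (EFin \o f).
  apply/integrableP; split => //.
  have -> : (\int[normal_prob 0 s]_x `|(EFin \o f) x| =
      \int[m1]_x `|(EFin \o f) x|)%E.
    exact: (@eq_measure_integral _ _ _ setT m1 m2).
  rewrite ge0_integral_distribution//; last exact: measurableT_comp.
  by have /integrableP[] := fi.
under [RHS]eq_integral do rewrite EFinM.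
rewrite -(integral_normal_prob fn).
rewrite -[LHS](integral_distribution (X := mY_pack) mfE fi).
by apply/esym; exact: (@eq_measure_integral _ _ _ setT m1 m2).
Qed.

Lemma integrable_bounded (f : T -> R) (c : R) : measurable_fun setT f ->
  (forall w, `|f w| <= c) -> P.-integrable setT (EFin \o f).
Proof.
move=> mf fc; apply: (@le_integrable _ _ _ P setT measurableT _ (EFin \o cst c)).
- exact/measurable_EFinP.
- by move=> w _; rewrite /= lee_fin (le_trans (fc w))// ler_norm.
- exact: finite_measure_integrable_cst.
Qed.

Hypothesis gY : centered_gaussian P Y.
Variable v : R.
Hypothesis Yv : (\int[P]_w ((Y w) ^+ 2)%:E)%E = v%:E.

Lemma dirac_law_ae : (forall B : set R, measurable B -> P (Y @^-1` B) = \d_(0 : R) B) ->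
  {ae P, forall w, Y w = 0}.
Proof.
move=> H; exists (Y @^-1` [set~ 0]); split.
- by rewrite -[X in measurable X]setTI; apply: mY => //; exact: measurableC.
- by rewrite H//; [rewrite diracE memNset//=; case|exact: measurableC].
- by move=> w /= Yw0 Y0; apply: Yw0.
Qed.

Let square_integrable : P.-integrable setT (EFin \o (fun w => Y w ^+ 2)).
Proof.
apply/integrableP; split.
  by apply/measurable_EFinP; exact: measurable_funX.
under eq_integral do rewrite /= ger0_norm ?sqr_ge0//.
by rewrite Yv ltry.
Qed.

(** The parameter of the law is recovered from the second moment, the degenerate
    law being the case v = 0. *)
Lemma gaussian_variance : exists2 s : R, s ^+ 2 = v &
  forall B : set R, measurable B ->
    P (Y @^-1` B) = if s == 0 then \d_(0 : R) B else normal_prob 0 s B.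
Proof.
have [s Hs] := gY; exists s => //; have [s0|s0] := eqVneq s 0.
  have H (B : set R) (mB : measurable B) := Hs B mB; rewrite s0 eqxx in H.
  suff : (\int[P]_w ((Y w) ^+ 2)%:E = 0)%E.
    by rewrite Yv s0 expr0n/= => -[->].
  rewrite (ae_eq_integral (cst 0%E)) ?integral0//.
    by apply/measurable_EFinP; exact: measurable_funX.
  by apply: filterS (dirac_law_ae H) => w Yw _; rewrite Yw expr0n.
have H (B : set R) (mB : measurable B) := Hs B mB; rewrite (negbTE s0) in H.
have mf : measurable_fun setT (fun x : R => x ^+ 2) by exact: measurable_funX.
have := integral_gaussian_law H mf square_integrable; rewrite Yv => E.
by rewrite -second_moment_pdf// /Rintegral -E.
Qed.

Lemma gaussian_characteristic : (\int[P]_w (cos (Y w))%:E)%E = (expR (- (v / 2)))%:E.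
Proof.
have [s sv Hs] := gaussian_variance; have [s0|s0] := eqVneq s 0.
  have H (B : set R) (mB : measurable B) := Hs B mB; rewrite s0 eqxx in H.
  rewrite (ae_eq_integral (cst 1%E)) ?integral_cst//.
  - by rewrite -sv s0 expr0n/= mul0r oppr0 expR0 mul1e probability_setT.
  - apply/measurable_EFinP; apply: measurableT_comp mY.
    by apply: continuous_measurable_fun; exact: continuous_cos.
  - by apply: filterS (dirac_law_ae H) => w Yw _; rewrite Yw cos0.
have H (B : set R) (mB : measurable B) := Hs B mB; rewrite (negbTE s0) in H.
have mcos : measurable_fun setT (@cos R).
  by apply: continuous_measurable_fun; exact: continuous_cos.
rewrite (integral_gaussian_law H)//; last first.
  apply: (@integrable_bounded _ 1); first exact: measurableT_comp.
  by move=> w; rewrite ler_norml cos_geN1 cos_le1.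
have := pdf_fourierE s0 1; rewrite expr1n mulr1 sv => <-.
rewrite /pdf_fourier -[LHS]fineK.
  by congr (fine _)%:E; apply: eq_integral => x _; rewrite mul1r.
have := integrable_cos_pdf s0 1 => /(integrable_fin_num measurableT).
by under eq_integral do rewrite /= mul1r.
Qed.

(** Markov's inequality for exp(Y^2 / (4 v)), whose mean is sqrt 2. *)
Lemma gaussian_tail (z : R) : 0 < v -> 0 <= z ->
  (P [set w | (z <= `|Y w|)%R] <= (Num.sqrt 2 * expR (- (z ^+ 2 / (4 * v))))%:E)%E.
Proof.
move=> v0 z0; have [s sv Hs] := gaussian_variance.
have s0 : s != 0 by apply/eqP => s0; move: v0; rewrite -sv s0 expr0n ltxx.
have H (B : set R) (mB : measurable B) := Hs B mB; rewrite (negbTE s0) in H.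
pose D : set R := [set x | z <= `|x|].
have mD : measurable D.
  rewrite -[D]setTI.
  have -> : setT `&` D = setT `&` (fun x : R => `|x|) @^-1` `[z, +oo[%classic.
    by apply/seteqP; split => x /=; rewrite /D /= in_itv/= andbT.
  have mn : measurable_fun setT (fun x : R => `|x|).
    by apply: continuous_measurable_fun => x; exact: norm_continuous.
  by apply: mn.
have -> : [set w | z <= `|Y w|] = Y @^-1` D by [].
rewrite H// /normal_prob.
pose c := expR (- (z ^+ 2 / (4 * v))) * Num.sqrt 2.
have c0 : 0 <= c by rewrite mulr_ge0 ?expR_ge0 ?sqrtr_ge0.
have ic : lebesgue_measure.-integrable setT
    (fun x => c%:E * (normal_pdf 0 (Num.sqrt 2 * s) x)%:E)%E.
  by apply: integrableZl => //; exact: integrable_normal_pdf.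
apply: (@le_trans _ _ (\int[lebesgue_measure]_(x in D)
    (c%:E * (normal_pdf 0 (Num.sqrt 2 * s) x)%:E))%E).
  apply: ge0_le_integral => //.
  - by move=> x _; rewrite lee_fin normal_pdf_ge0.
  - by apply/measurable_EFinP/measurable_funTS; exact: measurable_normal_pdf.
  - exact: measurable_funTS (measurable_int _ ic).
  - move=> x Dx; rewrite -EFinM lee_fin /c -mulrA -exp_quarter_pdf// mulrA -expRD.
    rewrite ler_peMl ?normal_pdf_ge0//.
    rewrite -[leLHS]expR0 ler_expR sv addrC subr_ge0 ler_pM2r; last first.
      by rewrite invr_gt0 mulr_gt0.
    rewrite -(sqr_norm_real x).
    by rewrite lerXn2r ?nnegrE.
apply: (@le_trans _ _ (\int[lebesgue_measure]_x
    (c%:E * (normal_pdf 0 (Num.sqrt 2 * s) x)%:E))%E).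
  apply: ge0_subset_integral => //; first exact: measurable_int ic.
  by move=> x _; rewrite -EFinM lee_fin mulr_ge0// normal_pdf_ge0.
rewrite integralZl//; last exact: integrable_normal_pdf.
by rewrite integral_normal_pdf mule1 /c mulrC.
Qed.

End gaussian_variable.

(** * Small-ball estimates for Gaussian vectors *)

(** The function exp(- y^2 / 2) as an average of cosines: the Gaussian is its own
    Fourier transform. *)
Lemma gauss_weight_integral (R : realType) (y : R) :
  (\int[normal_prob 0 (1 : R)]_x (cos (x * y))%:E = (expR (- (y ^+ 2 / 2)))%:E)%E.
Proof.
have mc : measurable_fun setT (fun x : R => cos (x * y)).
  apply: continuous_measurable_fun => x.
  apply: (cvg_comp (fun x => x * y) cos); last exact: continuous_cos.
  by apply: cvgM; [exact: cvg_id|exact: cvg_cst].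
have ic : (normal_prob 0 (1 : R)).-integrable setT (EFin \o (fun x => cos (x * y))).
  apply: (@integrable_bounded _ _ _ (normal_prob 0 (1 : R)) _ 1 mc).
  by move=> x; exact: cos_max.
rewrite (integral_normal_prob ic).
have := pdf_fourierE (oner_neq0 R) y; rewrite expr1n mul1r => <-.
rewrite /pdf_fourier -[LHS]fineK.
  by congr (fine _)%:E; apply: eq_integral => x _; rewrite /= (mulrC x y).
have := integrable_cos_pdf (oner_neq0 R) y => /(integrable_fin_num measurableT).
by congr (_ \is a fin_num); apply: eq_integral => x _; rewrite /= (mulrC y).
Qed.

Lemma measurable_gauss_weight (R : realType) (lam : R) :
  measurable_fun setT (fun x : R => expR (- (lam * x ^+ 2 / 2))).
Proof.
apply: measurableT_comp => //; apply: measurableT_comp => //.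
by apply: measurable_funM => //; apply: measurable_funM => //; exact: measurable_funX.
Qed.

Lemma gauss_weight_decay_integrable (R : realType) (lam : R) : 0 < lam ->
  (normal_prob 0 (1 : R)).-integrable setT
    (EFin \o (fun x => expR (- (lam * x ^+ 2 / 2)))).
Proof.
move=> l0; apply: (@integrable_bounded _ _ _ (normal_prob 0 (1 : R)) _ 1
  (measurable_gauss_weight lam)) => x.
rewrite ger0_norm ?expR_ge0// -[leRHS]expR0 ler_expR oppr_le0.
by rewrite divr_ge0// mulr_ge0 ?sqr_ge0// ltW.
Qed.

Lemma gauss_weight_decay (R : realType) (lam : R) : 0 < lam ->
  (\int[normal_prob 0 (1 : R)]_x (expR (- (lam * x ^+ 2 / 2)))%:E
    <= ((Num.sqrt lam)^-1)%:E)%E.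
Proof.
move=> l0; have sl0 : 0 < Num.sqrt lam by rewrite sqrtr_gt0.
pose s := (Num.sqrt lam)^-1.
have s0 : 0 < s by rewrite invr_gt0.
have s2 : s ^+ 2 = lam^-1 by rewrite exprVn sqr_sqrtr// ltW.
have E x : expR (- (lam * x ^+ 2 / 2)) * normal_pdf 0 1 x <= s * normal_pdf 0 s x.
  rewrite !pdf_centeredE ?gt_eqF// s2 expr1n.
  have -> : normal_peak 1 = s * normal_peak s.
    rewrite /normal_peak expr1n mul1r -mulrnAr sqrtrM ?sqr_ge0// sqrtr_sqr.
    by rewrite gtr0_norm// invfM mulrA divff ?mul1r// gt_eqF.
  have -> : x ^+ 2 / (2 * lam^-1) = lam * x ^+ 2 / 2.
    by field; rewrite gt_eqF.
  rewrite [leRHS]mulrA [leRHS]mulrC; apply: ler_wpM2l; first exact: expR_ge0.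
  rewrite ler_piMr ?mulr_ge0 ?normal_peak_ge0 ?(ltW s0)//.
  by rewrite -[leRHS]expR0 ler_expR oppr_le0 divr_ge0 ?sqr_ge0// mulr1.
have ie := gauss_weight_decay_integrable l0.
have me := measurable_gauss_weight lam.
rewrite (integral_normal_prob ie).
have isd : lebesgue_measure.-integrable setT (fun x => s%:E * (normal_pdf 0 s x)%:E)%E.
  by apply: integrableZl => //; exact: integrable_normal_pdf.
apply: (@le_trans _ _ (\int[lebesgue_measure]_x (s%:E * (normal_pdf 0 s x)%:E))%E).
  apply: ge0_le_integral => //.
  - by move=> x _; rewrite -EFinM lee_fin mulr_ge0 ?expR_ge0 ?normal_pdf_ge0.
  - apply/measurable_EFinP/measurable_funM => //; exact: measurable_normal_pdf.
  - exact: measurable_int isd.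
  - by move=> x _; rewrite -!EFinM lee_fin.
rewrite integralZl//; last exact: integrable_normal_pdf.
by rewrite integral_normal_pdf mule1.
Qed.

Section small_ball.
Context {R : realType} {d : measure_display} {T : measurableType d}.
Variable P : probability T R.
Variables (k : nat) (eta : nat -> T -> R) (lam : R).
Hypothesis m_eta : forall l, measurable_fun setT (eta l).
Hypothesis lam_gt0 : 0 < lam.

Local Notation weight j w := (\prod_(l < j) expR (- (eta l w ^+ 2 / 2))).
Local Notation comb a j w := (\sum_(j <= l < k) a l * eta l w).
Local Notation sq a j := (\sum_(j <= l < k) a l ^+ 2).

Hypothesis char_le : forall a : nat -> R,
  (\int[P]_w (cos (comb a 0 w))%:E <= (expR (- (lam * sq a 0 / 2)))%:E)%E.

Let m_weight j : measurable_fun setT (fun w => weight j w).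
Proof.
apply: measurable_prod => l _; apply: measurableT_comp => //.
apply: measurableT_comp => //; apply: measurable_funM => //.
exact: measurable_funX.
Qed.

Let weight_ge0 j w : 0 <= weight j w.
Proof. by apply: prodr_ge0 => l _; exact: expR_ge0. Qed.

Let weight_le1 j w : weight j w <= 1.
Proof.
apply: prodr_ile1 => l _; rewrite expR_ge0/= -[leRHS]expR0 ler_expR oppr_le0.
by rewrite divr_ge0 ?sqr_ge0.
Qed.

Let m_comb a j : measurable_fun setT (fun w => comb a j w).
Proof. by apply: measurable_sum => l; exact: measurable_funM. Qed.

Let mcos : measurable_fun setT (@cos R).
Proof. by apply: continuous_measurable_fun; exact: continuous_cos. Qed.

Let weight_cos_integrable j (Y : T -> R) : measurable_fun setT Y ->
  P.-integrable setT (EFin \o (fun w => weight j w * cos (Y w))).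
Proof.
move=> mY; apply: (@integrable_bounded _ _ _ P _ 1).
  by apply: measurable_funM => //; exact: measurableT_comp.
move=> w; rewrite normrM ger0_norm//; apply: mulr_ile1 => //; exact: cos_max.
Qed.

(** Each weight exp(-eta_j^2/2) is an average of cos(x eta_j) over a standard
    normal x; averaging the characteristic function over x gains a factor
    lam^(-1/2) per coordinate. *)
Lemma weighted_char_le j (a : nat -> R) : (j <= k)%N ->
  (\int[P]_w (weight j w * cos (comb a j w))%:E
    <= ((Num.sqrt lam)^-1 ^+ j * expR (- (lam * sq a j / 2)))%:E)%E.
Proof.
elim: j a => [|j IH] a jk.
  under eq_integral do rewrite big_ord0 mul1r.
  by rewrite expr0 mul1r; exact: char_le.
pose N : probability _ R := normal_prob 0 (1 : R).
pose F (z : T * measurableTypeR R) : R :=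
  weight j z.1 * cos (comb a j.+1 z.1) * cos (z.2 * eta j z.1).
have mF : measurable_fun setT F.
  apply: measurable_funM.
    apply: measurable_funM.
      exact: (measurableT_comp (m_weight j) measurable_fst).
    apply: measurableT_comp => //.
    exact: (measurableT_comp (m_comb a j.+1) measurable_fst).
  apply: measurableT_comp => //; apply: measurable_funM => //.
  exact: (measurableT_comp (m_eta j) measurable_fst).
have F1 z : `|F z| <= 1.
  rewrite !normrM; apply: mulr_ile1 => //; last exact: cos_max.
  by apply: mulr_ile1 => //; [rewrite ger0_norm|exact: cos_max].
have iF : (P \x N)%E.-integrable setT (EFin \o F).
  by apply: (@integrable_bounded _ _ _ (P \x N)%E F 1).
have E1 w : (weight j.+1 w * cos (comb a j.+1 w))%:E =
    (\int[N]_x (EFin \o F) (w, x))%E.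
  rewrite big_ord_recr /= mulrAC EFinM -gauss_weight_integral /F /=.
  rewrite -integralZl//; last first.
    apply: (@integrable_bounded _ _ _ N _ 1); last by move=> x; exact: cos_max.
    by apply: measurableT_comp => //; exact: measurable_funM.
under eq_integral do rewrite E1.
rewrite (Fubini iF).
pose c := (Num.sqrt lam)^-1 ^+ j * expR (- (lam * sq a j.+1 / 2)).
have c0 : 0 <= c by rewrite mulr_ge0 ?expR_ge0// exprn_ge0// invr_ge0 sqrtr_ge0.
have E2 x : (\int[P]_w (EFin \o F) (w, x) <= (c * expR (- (lam * x ^+ 2 / 2)))%:E)%E.
  pose b (e : R) l := if l == j then e else a l.
  have Eb e w : comb (b e) j w = e * eta j w + comb a j.+1 w.
    rewrite big_ltn// /b eqxx; congr (_ + _).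
    by apply: eq_big_nat => l /andP[jl _]; rewrite gt_eqF.
  have Esq e : sq (b e) j = e ^+ 2 + sq a j.+1.
    rewrite big_ltn// /b eqxx; congr (_ + _).
    by apply: eq_big_nat => l /andP[jl _]; rewrite gt_eqF.
  have EF w : F (w, x) = 2^-1 * (weight j w * cos (comb (b x) j w))
      + 2^-1 * (weight j w * cos (comb (b (- x)) j w)).
    by rewrite /F /= !Eb mulNr addrC (addrC (- _)) cosB cosD; field.
  pose U e w := weight j w * cos (comb (b e) j w).
  have -> : (\int[P]_w (EFin \o F) (w, x) =
      \int[P]_w (2^-1%:E * (U x w)%:E + 2^-1%:E * (U (- x)%R w)%:E))%E.
    by apply: eq_integral => w _; rewrite /= EF EFinD !EFinM.
  have iw e : P.-integrable setT
      (fun w => (U e w)%:E).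
    by apply: weight_cos_integrable.
  have iw2 e : P.-integrable setT (fun w => (2^-1)%:E * (U e w)%:E)%E.
    exact: integrableZl.
  rewrite integralD//.
  rewrite !integralZl//.
  have jk' : (j <= k)%N by exact: ltnW.
  have H e : e ^+ 2 = x ^+ 2 -> (2^-1%:E *
      \int[P]_w (U e w)%:E
      <= (2^-1 * (c * expR (- (lam * x ^+ 2 / 2))))%:E)%E.
    move=> ex; rewrite EFinM; apply: lee_wpmul2l; first by rewrite lee_fin invr_ge0.
    apply: le_trans (IH (b e) jk') _; rewrite lee_fin Esq ex /c.
    rewrite -[leRHS]mulrA -expRD.
    have -> // : - (lam * (x ^+ 2 + sq a j.+1) / 2) =
      - (lam * sq a j.+1 / 2) + - (lam * x ^+ 2 / 2) by field.
  apply: le_trans (leeD (H x erefl) (H (- x) (sqrrN x))) _.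
  by rewrite -EFinD lee_fin; move: (c * _) => y; lra.
apply: (@le_trans _ _ (\int[N]_x (c%:E * (expR (- (lam * x ^+ 2 / 2)))%:E))%E).
  apply: le_integral => //.
  - apply: (@le_integrable _ _ _ N setT measurableT _ (EFin \o cst 1)) => //.
    + exact: (measurable_fubini_G iF).
    + move=> x _; have mFx' : measurable_fun setT (fun w => F (w, x)).
        exact: (measurableT_comp mF (pair2_measurable x)).
      have mFx : measurable_fun setT (fun w => (F (w, x))%:E) by exact/measurable_EFinP.
      apply: le_trans (le_abse_integral P measurableT mFx) _.
      rewrite /= normr1 -[leRHS](probability_setT P) -[leRHS]mul1e -integral_cst//.
      apply: ge0_le_integral => //.
        by apply/measurable_EFinP; exact: measurableT_comp.
      by move=> w _; rewrite /= lee_fin.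
    + exact: finite_measure_integrable_cst.
  - by apply: integrableZl => //; exact: gauss_weight_decay_integrable.
rewrite integralZl//; last exact: gauss_weight_decay_integrable.
apply: le_trans (lee_wpmul2l _ (gauss_weight_decay lam_gt0)) _.
  by rewrite lee_fin.
by rewrite -EFinM lee_fin /c exprSr mulrAC.
Qed.

(** On the cube each Gaussian weight is at least e^(-1/2), so the probability is at
    most e^(k/2) times the expectation of the product of all weights. *)
Lemma small_ball_le : (P [set w | forall l, (l < k)%N -> (`|eta l w| <= 1)%R]
  <= (expR (2^-1) ^+ k * (Num.sqrt lam)^-1 ^+ k)%:E)%E.
Proof.
set D := [set w | _].
have mD : measurable D.
  have -> : D = \bigcap_(l < k) [set w | (`|eta l w| <= 1)%R].
    by apply/seteqP; split => w /=.
  apply: bigcap_measurableType => l _.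
  have -> : [set w | (`|eta l w| <= 1)%R] = setT `&` eta l @^-1` `[-1, 1]%classic.
    by apply/seteqP; split => w /=; rewrite in_itv/= ler_norml// => -[].
  exact: m_eta.
have iw : P.-integrable setT (EFin \o (fun w => weight k w * cos 0)).
  by apply: weight_cos_integrable; exact: measurable_cst.
have := weighted_char_le (fun=> 0) (leqnn k).
rewrite big_geq// mulr0 mul0r oppr0 expR0 mulr1.
have -> : (\int[P]_w (weight k w * cos (comb (fun=> 0%R) k w))%:E =
    \int[P]_w (weight k w)%:E)%E.
  by apply: eq_integral => w _; rewrite big_geq// cos0 mulr1.
move=> H; rewrite EFinM; apply: le_trans (lee_wpmul2l _ H); last first.
  by rewrite lee_fin exprn_ge0// expR_ge0.
have iw1 : P.-integrable setT (EFin \o (fun w => weight k w)).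
  by move: iw; rewrite cos0; under eq_fun do rewrite mulr1.
rewrite -integralZl//.
have -> : P D = (\int[P]_w (\1_D w)%:E)%E by rewrite integral_indic// setIT.
apply: ge0_le_integral => //.
- by apply/measurable_EFinP; exact: measurable_indic.
- by apply: (measurable_int P); apply: integrableZl.
move=> w _; rewrite -EFinM lee_fin indicE.
have [|_] := boolP (w \in D); last by rewrite mulr_ge0// exprn_ge0// expR_ge0.
rewrite inE => Dw /=.
have -> : expR 2^-1 ^+ k = \prod_(l < k) expR (2^-1 : R).
  by rewrite prodr_const card_ord.
rewrite -big_split/=; apply: (big_ind (fun x : R => 1 <= x)) => // [x y x1 y1|l _].
  by rewrite -[leLHS]mulr1 ler_pM.
rewrite -expRD -[leLHS]expR0 ler_expR subr_ge0 ler_pdivrMr// mulVf//.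
rewrite -(sqr_norm_real (eta l w)).
by rewrite exprn_ile1//; exact: Dw.
Qed.

End small_ball.

(** * Means and independence *)

(** The function x w is - s^2 times the derivative of w. *)
Lemma first_moment_pdf (R : realType) (s : R) : s != 0 ->
  (\int[lebesgue_measure]_x (x * normal_pdf 0 s x)%:E = 0)%E.
Proof.
move=> s0; have s20 : s ^+ 2 != 0 by rewrite expf_neq0.
pose h (x : R) := - (x / s ^+ 2) * normal_pdf 0 s x.
have p0 x : 0 <= normal_pdf 0 s x by exact: normal_pdf_ge0.
have ch : continuous h.
  move=> x; apply: cvgM; last exact: continuous_normal_pdf.
  by apply: cvgN; apply: cvgM; [exact: cvg_id|exact: cvg_cst].
have ih : lebesgue_measure.-integrable setT (EFin \o h).
  apply: (pdf_dominated_integrable s0 (c := (s ^+ 2)^-1)).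
    exact: continuous_measurable_fun.
  move=> x; rewrite /h normrM normrN normrM (ger0_norm (p0 x)) [`|_^-1|]ger0_norm.
    rewrite mulrAC [leRHS]mulrC; apply: ler_wpM2r; first by rewrite invr_ge0 sqr_ge0.
    apply: ler_wpM2r => //; rewrite -(sqr_norm_real x).
    by have := normr_ge0 x; nra.
  by rewrite invr_ge0 sqr_ge0.
have H := integral_derivative_eq0 s0 (pdf_is_derive s0) ch ih.
have {H} : \int[lebesgue_measure]_x h x = 0.
  by apply: H => x x1; rewrite (ger0_norm (p0 x)) ler_peMl.
rewrite /Rintegral => H.
have H0 : (\int[lebesgue_measure]_x (h x)%:E = 0)%E.
  rewrite -[LHS]fineK ?H//.
  exact: (integrable_fin_num measurableT ih).
have -> : (\int[lebesgue_measure]_x (x * normal_pdf 0 s x)%:E =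
   \int[lebesgue_measure]_x ((- s ^+ 2)%:E * (h x)%:E))%E.
  apply: eq_integral => x _; rewrite -EFinM /h; congr EFin.
  by field.
by rewrite integralZl// H0 mule0.
Qed.

Section mean_value.
Context {R : realType} {d : measure_display} {T : measurableType d}.
Variable P : probability T R.

Definition has_mean (f : T -> R) (c : R) : Prop :=
  P.-integrable setT (EFin \o f) /\ (\int[P]_w (f w)%:E = c%:E)%E.

Lemma has_meanD f g a b : has_mean f a -> has_mean g b ->
  has_mean (fun w => f w + g w) (a + b).
Proof.
move=> [if_ ef] [ig eg]; split; first exact: (integrableD measurableT if_ ig).
under eq_integral do rewrite EFinD.
by rewrite integralD// ef eg EFinD.
Qed.

Lemma has_meanZ c f a : has_mean f a -> has_mean (fun w => c * f w) (c * a).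
Proof.
move=> [if_ ef]; split; first exact: (integrableZl measurableT c if_).
under eq_integral do rewrite EFinM.
by rewrite integralZl// ef EFinM.
Qed.

Lemma has_mean0 : has_mean (fun=> 0) 0.
Proof.
split; last by rewrite integral0.
exact: finite_measure_integrable_cst.
Qed.

Lemma has_mean_sum (I : Type) (r : seq I) (f : I -> T -> R) (c : I -> R) :
  (forall i, has_mean (f i) (c i)) ->
  has_mean (fun w => \sum_(i <- r) f i w) (\sum_(i <- r) c i).
Proof.
move=> H; elim: r => [|i r IH].
  rewrite big_nil; under eq_fun do rewrite big_nil.
  exact: has_mean0.
by rewrite big_cons; under eq_fun do rewrite big_cons; exact: has_meanD.
Qed.

Lemma has_mean_ext f g a : has_mean f a -> f =1 g -> has_mean g a.
Proof. by move=> H /funext <-. Qed.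

Lemma integrable_of_square (f : T -> R) (v : R) : measurable_fun setT f ->
  has_mean (fun w => f w ^+ 2) v -> P.-integrable setT (EFin \o f).
Proof.
move=> mf [if2 _].
have i1 : P.-integrable setT (EFin \o (fun w => 1 + f w ^+ 2)).
  have ic := finite_measure_integrable_cst P (1 : R) measurableT.
  exact: (integrableD measurableT ic if2).
apply: (le_integrable measurableT _ _ i1); first exact/measurable_EFinP.
move=> w _; rewrite /= lee_fin [leRHS]ger0_norm ?addr_ge0 ?sqr_ge0//.
rewrite -(sqr_norm_real (f w)).
by have := normr_ge0 (f w); nra.
Qed.

Lemma has_meanM_integrable (f g : T -> R) (a b : R) :
  measurable_fun setT f -> measurable_fun setT g ->
  has_mean (fun w => f w ^+ 2) a -> has_mean (fun w => g w ^+ 2) b ->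
  P.-integrable setT (EFin \o (fun w => f w * g w)).
Proof.
move=> mf mg [if2 _] [ig2 _].
apply: (le_integrable measurableT _ _ (integrableD measurableT if2 ig2)).
  by apply/measurable_EFinP; exact: measurable_funM.
move=> w _; rewrite /= lee_fin [leRHS]ger0_norm ?addr_ge0 ?sqr_ge0//.
rewrite normrM.
rewrite -(sqr_norm_real (f w)).
rewrite -(sqr_norm_real (g w)).
move: `|f w| `|g w| (normr_ge0 (f w)) (normr_ge0 (g w)) => x y x0 y0.
by have := sqr_ge0 (x - y); nra.
Qed.

Lemma gaussian_mean (Y : T -> R) (v : R) : measurable_fun setT Y ->
  centered_gaussian P Y -> has_mean (fun w => Y w ^+ 2) v -> has_mean Y 0.
Proof.
move=> mY gY Y2; have iY := integrable_of_square mY Y2; split => //.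
have [s sv Hs] := gaussian_variance mY gY Y2.2; have [s0|s0] := eqVneq s 0.
  have H (B : set R) (mB : measurable B) := Hs B mB; rewrite s0 eqxx in H.
  rewrite (ae_eq_integral (cst 0%E)) ?integral0//.
    exact/measurable_EFinP.
  by apply: filterS (dirac_law_ae mY H) => w Yw _; rewrite Yw.
have H (B : set R) (mB : measurable B) := Hs B mB; rewrite (negbTE s0) in H.
rewrite (@integral_gaussian_law _ _ _ P Y mY s id)//.
exact: first_moment_pdf.
Qed.

(** By independence the joint law is the product law, under which the
    expectation of the product is computed one variable at a time. *)
Lemma independent_uncorrelated (U V : T -> R) (a b : R) :
  measurable_fun setT U -> measurable_fun setT V ->
  (forall A B : set R, measurable A -> measurable B ->
    P (U @^-1` A `&` V @^-1` B) = (P (U @^-1` A) * P (V @^-1` B))%E) ->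
  has_mean (fun w => U w ^+ 2) a -> has_mean (fun w => V w ^+ 2) b ->
  has_mean V 0 -> has_mean (fun w => U w * V w) 0.
Proof.
move=> mU mV ind U2 V2 V0.
have iUV := has_meanM_integrable mU mV U2 V2; split => //.
have mUV : measurable_fun setT (fun w => (U w, V w)).
  exact: measurable_fun_pair.
pose mixU := @isMeasurableFun.Build _ _ T (measurableTypeR R) U mU.
pose pU : {mfun T >-> measurableTypeR R} := HB.pack U mixU.
pose mixV := @isMeasurableFun.Build _ _ T (measurableTypeR R) V mV.
pose pV : {mfun T >-> measurableTypeR R} := HB.pack V mixV.
pose TT := (measurableTypeR R * measurableTypeR R)%type.
pose mixW := @isMeasurableFun.Build _ _ T TT (fun w => (U w, V w)) mUV.
pose pW : {mfun T >-> TT} := HB.pack (fun w => (U w, V w) : TT) mixW.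
pose LU := distribution P pU.
pose LV := distribution P pV.
pose LW := distribution P pW.
pose m1 : {measure set TT -> \bar R} := (LU \x LV)%E.
pose m2 : {measure set TT -> \bar R} := LW.
have E : forall X : set TT, measurable X -> X `<=` setT -> m1 X = m2 X.
  move=> X mX _; move: X mX.
  apply: product_measure_unique => A B mA mB.
  by rewrite /LU /LV /LW /distribution/= /pushforward/= -ind.
pose f (z : TT) : \bar R := (z.1 * z.2)%:E.
have mf : measurable_fun setT f.
  by apply/measurable_EFinP; apply: measurable_funM.
have E1 : (\int[P]_w (U w * V w)%:E = \int[LW]_z f z)%E.
  by rewrite (integral_distribution (X := pW) mf).
have E2 : (\int[LW]_z f z = \int[LU \x LV]_z f z)%E.
  by apply/esym; exact: (@eq_measure_integral _ _ _ setT m2 m1).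
have iF : (LU \x LV)%E.-integrable setT f.
  apply/integrableP; split => //.
  have -> : (\int[LU \x LV]_z `|f z| = \int[LW]_z `|f z|)%E.
    exact: (@eq_measure_integral _ _ _ setT m2 m1).
  rewrite (ge0_integral_distribution pW)//; last exact: measurableT_comp.
  by have /integrableP[] := iUV.
rewrite E1 E2 -integral12_prod_meas1//.
have mid : measurable_fun [set: measurableTypeR R] (EFin : measurableTypeR R -> \bar R).
  by apply/measurable_EFinP; exact: measurable_id.
have iV : LV.-integrable setT (EFin : measurableTypeR R -> \bar R).
  apply/integrableP; split => //.
  rewrite (ge0_integral_distribution pV)//; last exact: measurableT_comp.
  by have /integrableP[] := V0.1.
under eq_integral => x _.
  rewrite /fubini_F /f/=.
  under eq_integral do rewrite EFinM.
  rewrite integralZl// (integral_distribution (X := pV) mid V0.1)/= V0.2 mule0.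
  over.
by rewrite integral0.
Qed.

End mean_value.

(** * The covariance of equally spaced increments *)

Section increment_covariance.
Context {R : realType}.
Variable a : R.
Hypothesis a01 : 0 < a <= 1.
Let a0 : 0 < a. Proof. by have /andP[] := a01. Qed.

Local Notation f x := (`|x| `^ a).

(** The covariance of the increments over [l, l+1] and [m, m+1] of a centered
    process with variogram |t - s|^a. *)
Definition incr_cov (l m : R) : R :=
  (f (l + 1 - m) + f (l - (m + 1)) - f (l + 1 - (m + 1)) - f (l - m)) / 2.

(** Concavity of x^a, read off from the convexity of x^(1/a). *)
Lemma powR_midpoint (x : R) : 1 <= x -> f (x + 1) + f (x - 1) <= 2 * f x.
Proof.
move=> x1; rewrite !ger0_norm; [|lra|lra|lra].
set u := _ `^ a; set v := (x - 1) `^ a.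
have u0 : 0 <= u by exact: powR_ge0.
have v0 : 0 <= v by exact: powR_ge0.
have ai : 1 <= a^-1 by rewrite invf_ge1//; have /andP[] := a01.
have K (y : R) : 0 <= y -> (y `^ a) `^ a^-1 = y.
  by move=> y0; rewrite -powRrM mulfV ?gt_eqF// powRr1.
have H : (2^-1 * u + (1 - 2^-1) * v) `^ a^-1 <= 2^-1 * u `^ a^-1 + (1 - 2^-1) * v `^ a^-1.
  by apply: (convex_powR ai (Itv01 _ _)) => //=;
    rewrite ?inE/= ?in_itv/= ?andbT// ?invr_ge0// invf_le1 ?ler1n.
rewrite !K in H; [|lra|lra].
have {}H : ((u + v) / 2) `^ a^-1 <= x.
  by rewrite [X in X `^ _](_ : _ = 2^-1 * u + (1 - 2^-1) * v); [move: H; lra|field].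
have : (((u + v) / 2) `^ a^-1) `^ a <= x `^ a.
  by apply: ge0_ler_powR; rewrite ?nnegrE ?powR_ge0 ?(ltW a0)//; lra.
rewrite -powRrM mulVf ?gt_eqF// powRr1; lra.
Qed.

Let D (l : nat) : R := f (l.+1%:R : R) - f (l%:R : R).

Let D_decr l m : (l <= m)%N -> D m <= D l.
Proof.
elim: m => [|m IH]; first by rewrite leqn0 => /eqP ->.
rewrite leq_eqVlt => /predU1P[->//|/IH]; apply: le_trans.
have := @powR_midpoint m.+1%:R; rewrite ler1n => /(_ isT).
rewrite /D -!natr1 addrK; lra.
Qed.

Let D_gt0 l : 0 < D l.
Proof.
rewrite subr_gt0 !ger0_norm//; apply: gt0_ltr_powR => //; rewrite ?nnegrE//.
by rewrite ltr_nat.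
Qed.

Lemma incr_cov_sym l m : incr_cov l m = incr_cov m l.
Proof.
rewrite /incr_cov (distrC m l) (distrC (m + 1) l) (distrC (m + 1) (l + 1)) (distrC m).
by congr (_ / 2); ring.
Qed.

Lemma incr_cov_le0 (l m : nat) : l != m -> incr_cov l%:R m%:R <= 0.
Proof.
wlog : l m / (m < l)%N => [H|ml _].
  move=> lm; case: (ltngtP l m) (lm) => // l_m _; last by apply: H.
  by rewrite incr_cov_sym; apply: H => //; rewrite eq_sym.
have := @powR_midpoint (l%:R - m%:R); rewrite -natrB ?(ltnW ml)// ler1n subn_gt0.
move=> /(_ ml); rewrite natrB ?(ltnW ml)// /incr_cov.
have -> : l%:R + 1 - m%:R = l%:R - m%:R + 1 :> R by ring.
have -> : l%:R - (m%:R + 1) = l%:R - m%:R - 1 :> R by ring.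
have -> : l%:R + 1 - (m%:R + 1) = l%:R - m%:R :> R by ring.
lra.
Qed.

(** The row sums telescope; the two surviving differences of x^a are positive, and
    the one at l is at least the one at k by concavity. *)
Lemma incr_cov_row (k l : nat) : (l < k)%N ->
  D k / 2 <= \sum_(m < k) incr_cov l%:R m%:R.
Proof.
move=> lk.
pose g (m : nat) : R := f (l%:R + 1 - m%:R) - f (l%:R - m%:R).
have E (m : nat) : incr_cov l%:R m%:R = (- g m.+1 - - g m) / 2.
  rewrite /incr_cov /g (_ : m.+1%:R = m%:R + 1); last by rewrite natr1.
  by congr (_ / 2); ring.
rewrite -(big_mkord xpredT (fun m => incr_cov l%:R m%:R)).
under eq_bigr do rewrite E.
rewrite -mulr_suml telescope_sumr// ler_pM2r//.
have -> : - g k - - g 0%N = D l + D (k - l).-1.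
  rewrite /g /D prednK ?subn_gt0// subr0 natr1 subr0.
  by rewrite -!(distrC k%:R) -!natrB ?(ltnW lk)// subnS; ring.
have := D_decr (ltnW lk); have := D_gt0 (k - l).-1; lra.
Qed.

(** The covariance matrix has nonpositive entries off the diagonal and positive
    row sums, so it dominates its row sums as a quadratic form. *)
Lemma incr_cov_coercive (k : nat) : exists2 lam : R, 0 < lam &
  forall b : nat -> R,
    lam * \sum_(l < k) b l ^+ 2 <=
    \sum_(l < k) \sum_(m < k) b l * b m * incr_cov l%:R m%:R.
Proof.
exists (D k / 2) => [|b]; first by have := D_gt0 k; lra.
have sym : \sum_(l < k) \sum_(m < k) b m ^+ 2 * incr_cov l%:R m%:R =
    \sum_(l < k) \sum_(m < k) b l ^+ 2 * incr_cov l%:R m%:R.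
  rewrite exchange_big/=; apply: eq_bigr => l _; apply: eq_bigr => m _.
  by rewrite incr_cov_sym.
apply: (@le_trans _ _ (\sum_(l < k) \sum_(m < k) b l ^+ 2 * incr_cov l%:R m%:R)).
  rewrite mulr_sumr; apply: ler_sum => l _.
  by rewrite -mulr_sumr mulrC ler_wpM2l ?sqr_ge0// incr_cov_row.
rewrite -(ler_pM2l (ltr0n R 2)) mulr_natl mulr2n -[X in X + _]sym -big_split/=.
rewrite mulr_sumr; apply: ler_sum => l _.
rewrite mulr_sumr -big_split/=; apply: ler_sum => m _.
have [->|lm] := eqVneq l m; first by rewrite le_eqVlt; apply/orP; left; apply/eqP; ring.
have := incr_cov_le0 lm; have := sqr_ge0 (b l - b m).
by move: (incr_cov _ _) (b l) (b m) => c x y; nra.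
Qed.

End increment_covariance.

(** * Increments of fractional Brownian motion *)

Section fbm_increments.
Context {R : realType} {n : nat} {d : measure_display} {T : measurableType d}.
Variable P : probability T R.
Variables (H : R) (X : T -> R -> 'cV[R]_n).
Hypothesis fbm : is_fbm P H X.
Hypothesis H01 : 0 < H <= 2^-1.
Variables (t0 h : R) (k : nat).
Hypothesis t0_ge0 : 0 <= t0.
Hypothesis h_gt0 : 0 < h.
Hypothesis t0k_le1 : t0 + k%:R * h <= 1.

Local Notation tm l := (t0 + l%:R * h).

Definition increment (w : T) (l : nat) : 'cV[R]_n := X w (tm l.+1) - X w (tm l).

Let tm01 l : (l <= k)%N -> tm l \in `[0, 1].
Proof.
move=> lk; rewrite in_itv/=; apply/andP; split.
  by rewrite addr_ge0// mulr_ge0// ltW.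
by apply: le_trans t0k_le1; rewrite lerD2l ler_pM2r// ler_nat.
Qed.

Lemma measurable_increment l i : (l < k)%N ->
  measurable_fun setT (fun w => increment w l i 0).
Proof.
move=> lk.
rewrite [X in measurable_fun _ X](_ : _ =
    (fun w => X w (tm l.+1) i 0 - X w (tm l) i 0)); last first.
  by apply/funext => w; rewrite !mxE.
by apply: measurable_funB; apply: fbm_measurable fbm _ _ _; apply: tm01 => //; exact: ltnW.
Qed.

Lemma square_increment_mean (s t : R) i : s \in `[0, 1] -> t \in `[0, 1] ->
  has_mean P (fun w => (X w t i 0 - X w s i 0) ^+ 2) (`|t - s| `^ (2 * H)).
Proof.
move=> s01 t01.
have E : (\int[P]_w ((X w t i 0 - X w s i 0) ^+ 2)%:E = (`|t - s| `^ (2 * H))%:E)%E.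
  rewrite -(fbm_variance fbm i s01 t01) unlock; apply: eq_integral => w _ /=.
  by rewrite real_normK// num_real.
split => //; apply/integrableP; split.
  apply/measurable_EFinP; apply: measurable_funX; apply: measurable_funB.
    exact: fbm_measurable fbm _ _ t01.
  exact: fbm_measurable fbm _ _ s01.
under eq_integral do rewrite /= ger0_norm ?sqr_ge0//.
by rewrite E ltry.
Qed.

Let distE (l m : nat) :
  `|tm l - tm m| `^ (2 * H) = h `^ (2 * H) * `|l%:R - m%:R| `^ (2 * H).
Proof.
have -> : tm l - tm m = h * (l%:R - m%:R) by ring.
by rewrite normrM powRM// gtr0_norm.
Qed.

(** A product of two increments is a combination of four squared increments. *)
Lemma increment_product_mean l m i : (l < k)%N -> (m < k)%N ->
  has_mean P (fun w => increment w l i 0 * increment w m i 0)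
    (h `^ (2 * H) * incr_cov (2 * H) l%:R m%:R).
Proof.
move=> lk mk.
have l1 := tm01 lk; have l0 := tm01 (ltnW lk).
have m1 := tm01 mk; have m0 := tm01 (ltnW mk).
have := has_meanZ 2^-1 (has_meanD
  (has_meanD (square_increment_mean i m0 l1) (square_increment_mean i m1 l0))
  (has_meanZ (-1) (has_meanD (square_increment_mean i m1 l1)
                             (square_increment_mean i m0 l0)))).
rewrite !distE => M.
have -> : h `^ (2 * H) * incr_cov (2 * H) l%:R m%:R =
    2^-1 * (h `^ (2 * H) * `|l.+1%:R - m%:R| `^ (2 * H) +
         h `^ (2 * H) * `|l%:R - m.+1%:R| `^ (2 * H) +
         -1 * (h `^ (2 * H) * `|l.+1%:R - m.+1%:R| `^ (2 * H) +
               h `^ (2 * H) * `|l%:R - m%:R| `^ (2 * H))).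
  by rewrite /incr_cov !natr1; field.
by apply: has_mean_ext M _ => w; rewrite !mxE; field.
Qed.

Lemma increment_square_mean l i : (l < k)%N ->
  has_mean P (fun w => increment w l i 0 ^+ 2) ((h `^ H) ^+ 2).
Proof.
move=> lk; have := square_increment_mean i (tm01 (ltnW lk)) (tm01 lk).
rewrite distE -natr1 addrAC subrr add0r normr1 powR1 mulr1.
rewrite (mulrC 2) powRrM powR_mulrn ?powR_ge0// => M.
by apply: has_mean_ext M _ => w; rewrite natr1 !mxE.
Qed.

Variable a : nat -> R.

Let U i w : R := \sum_(l < k) a l * increment w l i 0.

Let W (phi : 'cV[R]_n) w : R := \sum_(l < k) a l * dotv phi (increment w l).

Let Q : R := \sum_(l < k) \sum_(m < k) a l * a m * incr_cov (2 * H) l%:R m%:R.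

Let U_square i : has_mean P (fun w => U i w ^+ 2) (h `^ (2 * H) * Q).
Proof.
have M := has_mean_sum (index_enum 'I_k) (fun l =>
  has_mean_sum (index_enum 'I_k) (fun m =>
    has_meanZ (a l * a m) (increment_product_mean i (ltn_ord l) (ltn_ord m)))).
rewrite /Q mulr_sumr; under eq_bigr do rewrite mulr_sumr.
under eq_bigr do under eq_bigr do rewrite mulrCA.
apply: has_mean_ext M _ => w; rewrite /U expr2 big_distrlr/=.
by apply: eq_bigr => l _; apply: eq_bigr => m _; ring.
Qed.

Let mU i : measurable_fun setT (U i).
Proof.
apply: (@measurable_sum _ _ _ _ _ (index_enum 'I_k)) => l.
by apply: measurable_funM => //; exact: measurable_increment.
Qed.

Lemma increment_comb_gaussian phi : centered_gaussian P (W phi).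
Proof.
pose t (q : 'I_(k + k)) : R := match fintype.split q with
  | inl l => tm l.+1 | inr l => tm l end.
pose b (q : 'I_(k + k)) : 'cV[R]_n := match fintype.split q with
  | inl l => a l *: phi | inr l => - a l *: phi end.
have -> : W phi = (fun w => \sum_q dotv (b q) (X w (t q))).
  apply/funext => w; rewrite big_split_ord/= -big_split/=; apply: eq_bigr => l _.
  rewrite /t /b !(unsplitK (inl _)) !(unsplitK (inr _)) /increment.
  rewrite dotvB mulrBr /dotv !mulr_sumr -sumrN -!big_split/=.
  by apply: eq_bigr => i _; rewrite !mxE; ring.
apply: (fbm_gaussian fbm) => q; rewrite /t; case: fintype.split => l.
  exact: tm01.
by apply: tm01; exact: ltnW.
Qed.

Let U_W i : U i = W (delta_mx i 0).
Proof.
apply/funext => w; apply: eq_bigr => l _; congr (_ * _).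
rewrite /dotv (bigD1 i)//= big1 ?addr0; last first.
  by move=> j ji; rewrite !mxE (negbTE ji) mul0r.
by rewrite !mxE !eqxx mul1r.
Qed.

Let U_mean i : has_mean P (U i) 0.
Proof.
apply: gaussian_mean (mU i) _ (U_square i).
by rewrite U_W; exact: increment_comb_gaussian.
Qed.

(* The sum is measurable for the sigma-algebra generated by its component, where
   independence is assumed. *)
Let U_component i (A : set R) : measurable A -> component_sigma X i (U i @^-1` A).
Proof.
move=> mA; rewrite /component_sigma; set G := [set E | _].
have mX t : t \in `[0, 1] ->
    measurable_fun [set: g_sigma_algebraType G] (fun w : g_sigma_algebraType G => X w t i 0).
  move=> t01 _ B mB; rewrite setTI; apply: sub_sigma_algebra.
  by exists t, B.
have mUG : measurable_fun [set: g_sigma_algebraType G] (U i : g_sigma_algebraType G -> R).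
  apply: (@measurable_sum _ (g_sigma_algebraType G) _ _ _ (index_enum 'I_k)) => l.
  apply: measurable_funM => //.
  rewrite [X in measurable_fun _ X](_ : _ =
    (fun w => X w (tm l.+1) i 0 - X w (tm l) i 0)); last first.
    by apply/funext => w; rewrite !mxE.
  by apply: measurable_funB; apply: mX; apply: tm01 => //; exact: ltnW.
by have := mUG measurableT A mA; rewrite setTI.
Qed.

Let U_independent i j (A B : set R) : i != j -> measurable A -> measurable B ->
  P (U i @^-1` A `&` U j @^-1` B) = (P (U i @^-1` A) * P (U j @^-1` B))%E.
Proof.
move=> ij mA mB.
pose E l := if l == i then U i @^-1` A else if l == j then U j @^-1` B else setT.
have -> : U i @^-1` A `&` U j @^-1` B = \bigcap_l E l.
  apply/seteqP; split => [w [wA wB] l _|w H'].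
    by rewrite /E; case: eqP => [_|_]//; case: eqP.
  split; first by have := H' i Logic.I; rewrite /E eqxx.
  by have := H' j Logic.I; rewrite /E eq_sym (negbTE ij) eqxx.
rewrite (fbm_independent fbm); last first.
  move=> l; rewrite /E; case: eqP => [->|_]; first exact: U_component.
  case: eqP => [->|_]; first exact: U_component.
  rewrite -(preimage_setT (U l)); exact: U_component.
rewrite (bigD1 i)//= (bigD1 j)//= 1?eq_sym// big1 ?mule1.
  by rewrite /E eqxx eq_sym (negbTE ij) eqxx.
move=> l /andP[li lj]; rewrite /E (negbTE li) (negbTE lj); exact: probability_setT.
Qed.

Let WE phi w : W phi w = \sum_i phi i 0 * U i w.
Proof.
rewrite /W /U /dotv; under eq_bigr do rewrite mulr_sumr.
rewrite exchange_big/=; apply: eq_bigr => i _; rewrite mulr_sumr.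
by apply: eq_bigr => l _; ring.
Qed.

(** The components are independent and centered, so their cross terms vanish. *)
Lemma increment_comb_variance phi :
  has_mean P (fun w => W phi w ^+ 2) (dotv phi phi * (h `^ (2 * H) * Q)).
Proof.
have UU i j : has_mean P (fun w => U i w * U j w)
    (if i == j then h `^ (2 * H) * Q else 0).
  have [<-|ij] := eqVneq i j; first exact: U_square.
  apply: (independent_uncorrelated (mU i) (mU j) _ (U_square i) (U_square j)) => //.
  by move=> A B mA mB; exact: U_independent.
have M := has_mean_sum (index_enum 'I_n) (fun i =>
  has_mean_sum (index_enum 'I_n) (fun j =>
    has_meanZ (phi i 0 * phi j 0) (UU i j))).
have -> : dotv phi phi * (h `^ (2 * H) * Q) = \sum_i \sum_j
    phi i 0 * phi j 0 * (if i == j then h `^ (2 * H) * Q else 0).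
  rewrite /dotv mulr_suml; apply: eq_bigr => i _; rewrite (bigD1 i)//= eqxx big1 ?addr0//.
  by move=> j ji; rewrite eq_sym (negbTE ji) mulr0.
apply: has_mean_ext M _ => w; rewrite WE expr2 big_distrlr/=.
by apply: eq_bigr => i _; apply: eq_bigr => j _; ring.
Qed.

End fbm_increments.

Lemma increment_gaussian (R : realType) (n : nat) (d : measure_display)
    (T : measurableType d) (P : probability T R) (H : R) (X : T -> R -> 'cV[R]_n) :
  is_fbm P H X ->
  forall (t0 h : R) (k : nat), 0 <= t0 -> 0 < h -> t0 + k%:R * h <= 1 ->
  forall l i, (l < k)%N -> centered_gaussian P (fun w => increment X t0 h w l i 0).
Proof.
move=> fbm t0 h k t00 h0 th1 l i lk.
have := increment_comb_gaussian fbm t00 h0 th1 (fun m => (m == l)%:R) (delta_mx i 0).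
congr centered_gaussian; apply/funext => w.
rewrite (bigD1 (Ordinal lk))//= eqxx mul1r big1 ?addr0; last first.
  by move=> m ml; rewrite (_ : _ == l = false) ?mul0r//; apply/negbTE.
rewrite /dotv (bigD1 i)//= big1 ?addr0; last first.
  by move=> j ji; rewrite !mxE (negbTE ji) mul0r.
by rewrite !mxE !eqxx mul1r.
Qed.

(** For a fixed direction phi the increments tested against phi are jointly Gaussian
    with a covariance matrix that is at least lam h^(2 H) |phi|^2, so
    small_ball_le gives one factor e / h^H for each of the k increments. *)
Lemma fbm_small_ball (R : realType) (n : nat) (H : R) (k : nat) : 0 < H <= 2^-1 ->
  exists2 C : R, 0 < C &
  forall (d : measure_display) (T : measurableType d) (P : probability T R)
    (X : T -> R -> 'cV[R]_n), is_fbm P H X ->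
  forall (t0 h : R), 0 <= t0 -> 0 < h -> t0 + k%:R * h <= 1 ->
  forall (phi : 'cV[R]_n) (e : R), 1 <= dotv phi phi -> 0 < e ->
  (P [set w | forall l, (l < k)%N -> (`|dotv phi (increment X t0 h w l)| <= e)%R]
   <= ((C * (e / h `^ H)) ^+ k)%:E)%E.
Proof.
move=> H01; have H2 : 0 < 2 * H <= 1 by lra.
have [lam lam0 Hlam] := incr_cov_coercive H2 k.
have sl0 : 0 < Num.sqrt lam by rewrite sqrtr_gt0.
exists (expR 2^-1 / Num.sqrt lam) => [|d T P X fbm t0 h t00 h0 th1 phi e phi1 e0].
  by rewrite divr_gt0// expR_gt0.
pose xi l w := dotv phi (increment X t0 h w l).
pose eta l w := if (l < k)%N then e^-1 * xi l w else 0.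
have mxi l : (l < k)%N -> measurable_fun setT (xi l).
  move=> lk; apply: measurable_sum => i; apply: measurable_funM => //.
  exact: (measurable_increment fbm t00 h0 th1).
have meta l : measurable_fun setT (eta l).
  rewrite /eta; case: ltnP => lk; last exact: measurable_cst.
  by apply: measurable_funM => //; exact: mxi.
have hH0 : 0 < h `^ H by exact: powR_gt0.
pose L := lam * (h `^ H / e) ^+ 2.
have L0 : 0 < L by rewrite mulr_gt0// exprn_gt0// divr_gt0.
have char (a : nat -> R) : (\int[P]_w (cos (\sum_(0 <= l < k) a l * eta l w))%:E <=
    (expR (- (L * (\sum_(0 <= l < k) a l ^+ 2) / 2)))%:E)%E.
  pose b l := a l / e.
  have gW := increment_comb_gaussian fbm t00 h0 th1 b phi.
  have [_ vW] := increment_comb_variance fbm t00 h0 th1 b phi.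
  have mW : measurable_fun setT (fun w => \sum_(l < k) b l * dotv phi (increment X t0 h w l)).
    apply: (@measurable_sum _ _ _ _ _ (index_enum 'I_k)) => l.
    by apply: measurable_funM => //; exact: mxi.
  have := gaussian_characteristic mW gW vW => E.
  have -> : (\int[P]_w (cos (\sum_(0 <= l < k) a l * eta l w))%:E =
      \int[P]_w (cos (\sum_(l < k) b l * dotv phi (increment X t0 h w l)))%:E)%E.
    apply: eq_integral => w _; congr (cos _)%:E; rewrite big_mkord.
    by apply: eq_bigr => l _; rewrite /eta ltn_ord mulrA.
  rewrite E lee_fin ler_expR lerN2 ler_pM2r// big_mkord.
  have := Hlam b; set Q := \sum_(l < k) \sum_(m < k) _ => HQ.
  have bE : \sum_(l < k) b l ^+ 2 = (\sum_(l < k) a l ^+ 2) / e ^+ 2.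
    by rewrite mulr_suml; apply: eq_bigr => l _; rewrite /b expr_div_n.
  have h2 : h `^ (2 * H) = (h `^ H) ^+ 2.
    by rewrite mulrC powRrM powR_mulrn// powR_ge0.
  have Q0 : 0 <= h `^ (2 * H) * Q.
    rewrite mulr_ge0 ?powR_ge0//; apply: le_trans HQ.
    by rewrite mulr_ge0 ?(ltW lam0)// sumr_ge0// => l _; exact: sqr_ge0.
  apply: (@le_trans _ _ (h `^ (2 * H) * Q)); last by rewrite ler_peMl.
  rewrite h2 /L expr_div_n.
  have -> : lam * ((h `^ H) ^+ 2 / e ^+ 2) * (\sum_(l < k) a l ^+ 2) =
    (h `^ H) ^+ 2 * (lam * \sum_(l < k) b l ^+ 2).
    by rewrite bE; ring.
  by apply: ler_wpM2l; [exact: sqr_ge0|].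
have := small_ball_le meta L0 char; rewrite -exprMn.
have -> : expR 2^-1 * (Num.sqrt L)^-1 = expR 2^-1 / Num.sqrt lam * (e / h `^ H).
  rewrite /L sqrtrM ?ltW// sqrtr_sqr ger0_norm ?divr_ge0 ?ltW//.
  by field; rewrite !gt_eqF.
apply: le_trans; rewrite le_eqVlt; apply/orP; left; apply/eqP; congr (P _).
apply/seteqP; split => w /= Hw l lk.
  by rewrite /eta lk normrM gtr0_norm ?invr_gt0// mulrC ler_pdivrMr// mul1r; exact: Hw.
have := Hw l lk; rewrite /eta lk normrM gtr0_norm ?invr_gt0// mulrC ler_pdivrMr// mul1r.
exact.
Qed.

(** * A uniform bound over all directions *)

Lemma union_bound (R : realType) (d : measure_display) (T : measurableType d)
    (P : probability T R) (I : Type) (s : seq I) (Q : pred I) (F : I -> set T) (c : R) :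
  0 <= c -> (forall i, Q i -> measurable (F i) /\ (P (F i) <= c%:E)%E) ->
  measurable (\big[setU/set0]_(i <- s | Q i) F i) /\
  (P (\big[setU/set0]_(i <- s | Q i) F i) <= ((size s)%:R * c)%:E)%E.
Proof.
move=> c0 H; elim: s => [|i s [mI PI]].
  by rewrite big_nil measure0 mul0r.
rewrite big_cons /= -nat1r mulrDl mul1r EFinD; case: ifP => [/H[mi Pi]|_]; split => //.
- exact: measurableU.
- by apply: le_trans (measureU2 P mi mI) _; exact: leeD.
- by apply: le_trans PI _; rewrite leeDr// lee_fin.
Qed.

Lemma size_index_enum (I : finType) : size (index_enum I) = #|I|.
Proof. by rewrite -sum1_card -sum1_size. Qed.

Lemma expR_ge_pow (R : realType) (m : nat) (u : R) : 0 <= u ->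
  u ^+ m <= m%:R ^+ m * expR u.
Proof.
case: m => [|m] u0; first by rewrite !expr0 mul1r -[leLHS]expR0 ler_expR.
have -> : expR u = expR (u / m.+1%:R) ^+ m.+1.
  by rewrite -expRM_natl mulrC divfK.
rewrite -exprMn lerXn2r ?nnegrE ?mulr_ge0 ?expR_ge0// mulrC -ler_pdivrMr//.
by apply: le_trans (expR_ge1Dx _); rewrite lerDr.
Qed.

(** Rounding away from zero keeps the approximating direction at least as long
    as the original one. *)
Lemma round_away (R : realType) (N : nat) (x : R) : (0 < N)%N -> `|x| <= 1 ->
  exists z : 'I_(N + N).+1,
    let g := (z%:R - N%:R) / N%:R : R in x ^+ 2 <= g ^+ 2 /\ `|g - x| <= N%:R^-1.
Proof.
move=> N0 x1; have N0' : 0 < N%:R :> R by rewrite ltr0n.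
have [m mN /andP[m1 m2]] : exists2 m, (m <= N)%N & `|x| <= m%:R / N%:R <= `|x| + N%:R^-1.
  have t0 : 0 <= `|x| * N%:R by rewrite mulr_ge0.
  have /andP[t1 t2] := truncn_itv t0.
  exists (minn (Num.truncn (`|x| * N%:R)).+1 N); first exact: geq_minr.
  rewrite ler_pdivlMr// ler_pdivrMr// mulrDl mulVf ?gt_eqF//.
  case: (leqP (Num.truncn (`|x| * N%:R)).+1 N) => [_|].
    by rewrite (ltW t2)/= -natr1 lerD2r.
  rewrite ltnS => Nt; rewrite ler_piMl ?ler0n//=.
  have : N%:R <= (Num.truncn (`|x| * N%:R))%:R :> R by rewrite ler_nat.
  by lra.
have mR : m%:R / N%:R >= 0 :> R by rewrite divr_ge0.
case: (leP 0 x) => x0.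
  have zN : (N + m < (N + N).+1)%N by rewrite ltnS leq_add2l.
  exists (Ordinal zN) => /=; rewrite natrD addrAC subrr add0r.
  rewrite ger0_norm// in m1 m2; split.
    by rewrite lerXn2r ?nnegrE.
  by rewrite ger0_norm ?subr_ge0//; lra.
have zN : (N - m < (N + N).+1)%N by rewrite ltnS (leq_trans (leq_subr _ _))// leq_addr.
exists (Ordinal zN) => /=; rewrite natrB// addrAC subrr add0r mulNr sqrrN.
rewrite ltr0_norm// in m1 m2; split.
  by rewrite -(sqrrN x) lerXn2r ?nnegrE// oppr_ge0 ltW.
by rewrite ler0_norm; lra.
Qed.

Lemma dotv_rounding (R : realType) (n N : nat) (g phi xi : 'cV[R]_n) (b : R) :
  (forall i, `|g i 0 - phi i 0| <= N%:R^-1) -> (forall i, `|xi i 0| <= b) ->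
  `|dotv g xi| <= `|dotv phi xi| + n%:R * (b / N%:R).
Proof.
move=> Hg Hxi.
have -> : dotv g xi = dotv phi xi + \sum_i (g i 0 - phi i 0) * xi i 0.
  by rewrite /dotv -big_split/=; apply: eq_bigr => i _; ring.
apply: le_trans (ler_normD _ _) _; rewrite lerD2l.
apply: le_trans (ler_norm_sum _ _ _) _.
rewrite -[X in X%:R * _]card_ord -sum1_card natr_sum mulr_suml.
apply: ler_sum => i _; rewrite mul1r normrM mulrC; exact: ler_pM.
Qed.

(** A direction is replaced by a grid point within 1/N in each coordinate, which
    changes the tested increments by at most n y h^H unless some increment exceeds
    N y h^H.  With N close to y^(-2) the grid has about y^(- 2 n) points, each of
    probability of order y^k with k > p + 2 n, and the exceptional event has probability of
    order exp(- 1 / (4 y^2)). *)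
Lemma fbm_inf_small_ball (R : realType) (n : nat) (H : R) (p : nat) :
  0 < H <= 2^-1 ->
  exists k : nat, (0 < k)%N /\ exists2 C : R, 0 < C &
  forall (d : measure_display) (T : measurableType d) (P : probability T R)
    (X : T -> R -> 'cV[R]_n), is_fbm P H X ->
  forall (t0 h : R), 0 <= t0 -> 0 < h -> t0 + k%:R * h <= 1 ->
  forall y : R, 0 < y <= 1 -> exists B : set T,
  [/\ measurable B,
    forall w (phi : 'cV[R]_n), enorm phi = 1 ->
      (forall l, (l < k)%N -> `|dotv phi (increment X t0 h w l)| <= y * h `^ H) -> B w
  & (P B <= (C * y ^+ p)%:E)%E].
Proof.
move=> H01; pose k := (p + n.*2).+1; exists k; split => //.
have [C0 C00 HC] := fbm_small_ball n k H01.
pose CA := (5 ^+ n * (C0 * (1 + n%:R)) ^+ k) : R.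
pose CB := ((n * k)%:R * (Num.sqrt 2 * (4 * p%:R) ^+ p)) : R.
have CA0 : 0 < CA by rewrite mulr_gt0 ?exprn_gt0// mulr_gt0// ltr_pwDl.
have CB0 : 0 <= CB by rewrite mulr_ge0// mulr_ge0 ?sqrtr_ge0// exprn_ge0// mulr_ge0.
exists (CA + CB); first by rewrite ltr_wpDr.
move=> d T P X fbm t0 h t00 h0 th1 y /andP[y0 y1].
have hH0 : 0 < h `^ H by exact: powR_gt0.
(* N y >= 1 / y makes the Gaussian tail negligible, at a polynomial cost in the
   size of the grid *)
pose N := (Num.truncn (y ^- 2)).+1.
have yi0 : 0 <= y ^- 2 by rewrite invr_ge0 sqr_ge0.
have yi1 : 1 <= y ^- 2 by rewrite invf_ge1 ?exprn_gt0// expr_le1// ltW.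
have [N1 N2] : N%:R <= 2 * y ^- 2 /\ y ^- 2 <= N%:R :> R.
  have /andP[t1 t2] := truncn_itv yi0; rewrite /N; split; last exact: ltW.
  by rewrite -natr1; lra.
have N0 : 0 < N%:R :> R by rewrite ltr0n.
pose g (z : {ffun 'I_n -> 'I_(N + N).+1}) : 'cV[R]_n :=
  \col_i (((z i)%:R - N%:R) / N%:R).
pose xi w l := increment X t0 h w l.
pose A z := [set w | forall l, (l < k)%N ->
  `|dotv (g z) (xi w l)| <= (1 + n%:R) * y * h `^ H].
pose D (q : 'I_n * 'I_k) := [set w | N%:R * y * h `^ H <= `|xi w q.2 q.1 0|].
have mxi l i : (l < k)%N -> measurable_fun setT (fun w => xi w l i 0).
  exact: (measurable_increment fbm t00 h0 th1).
have mA z : measurable (A z).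
  have -> : A z = \bigcap_(l < k)
      [set w | `|dotv (g z) (xi w l)| <= (1 + n%:R) * y * h `^ H].
    by apply/seteqP; split.
  apply: bigcap_measurableType => l /= lk.
  have mdot : measurable_fun setT (fun w => dotv (g z) (xi w l)).
    by apply: measurable_sum => i; apply: measurable_funM => //; exact: mxi.
  set c := _ * h `^ H.
  have -> : [set w | `|dotv (g z) (xi w l)| <= c] = setT `&`
      (fun w => dotv (g z) (xi w l)) @^-1` `[- c, c]%classic.
    by apply/seteqP; split => w /=; rewrite in_itv/= ler_norml// => -[].
  exact: mdot.
have mD q : measurable (D q).
  have mn : measurable_fun setT (fun w => `|xi w q.2 q.1 0|).
    by apply: measurableT_comp => //; exact: mxi.
  have -> : D q = setT `&` (fun w => `|xi w q.2 q.1 0|) @^-1` `[N%:R * y * h `^ H, +oo[%classic.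
    by apply/seteqP; split => w /=; rewrite /D/= in_itv/= andbT// => -[].
  exact: mn.
pose cA := (C0 * (1 + n%:R) * y) ^+ k.
pose cB := Num.sqrt 2 * (4 * p%:R) ^+ p * y ^+ p.
have cA0 : 0 <= cA by rewrite exprn_ge0// mulr_ge0 ?(ltW y0)// mulr_ge0 ?(ltW C00)// addr_ge0.
have cB0 : 0 <= cB.
  by rewrite !mulr_ge0 ?sqrtr_ge0 ?exprn_ge0 ?(ltW y0)// mulr_ge0.
have PA z : 1 <= dotv (g z) (g z) -> (P (A z) <= cA%:E)%E.
  move=> z1; have e0 : 0 < (1 + n%:R) * y * h `^ H by rewrite !mulr_gt0// ltr_pwDl.
  have := HC d T P X fbm t0 h t00 h0 th1 (g z) _ z1 e0.
  by rewrite mulfK ?gt_eqF// mulrA.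
have PD q : (P (D q) <= cB%:E)%E.
  have [_ vD] := increment_square_mean fbm t00 h0 th1 q.1 (ltn_ord q.2).
  have gD := increment_gaussian fbm t00 h0 th1 q.1 (ltn_ord q.2).
  have z0 : 0 <= N%:R * y * h `^ H by rewrite !mulr_ge0// ltW.
  have v0 : 0 < (h `^ H) ^+ 2 by rewrite exprn_gt0.
  have := gaussian_tail (mxi q.2 q.1 (ltn_ord q.2)) gD vD v0 z0.
  move/le_trans; apply; rewrite lee_fin /cB -[leRHS]mulrA ler_wpM2l ?sqrtr_ge0//.
  have yy : y ^- 2 / 4 <= (N%:R * y * h `^ H) ^+ 2 / (4 * (h `^ H) ^+ 2).
    rewrite [leRHS](_ : _ = (N%:R * y) ^+ 2 / 4); last by field; rewrite gt_eqF.
    rewrite ler_pM2r// -exprVn lerXn2r ?nnegrE ?invr_ge0 ?mulr_ge0 ?(ltW y0)//.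
    apply: (@le_trans _ _ (y ^- 2 * y)); last by rewrite ler_pM2r.
    by rewrite expr2 invfM -mulrA mulVf ?mulr1 ?gt_eqF.
  apply: (@le_trans _ _ (expR (- (y ^- 2 / 4)))); first by rewrite ler_expR lerN2.
  have u0 : 0 <= y ^- 2 / 4 by rewrite divr_ge0.
  have := expR_ge_pow p u0.
  rewrite expRN => Hp; rewrite -[leLHS]mul1r ler_pdivrMr ?expR_gt0//.
  have yp : 0 <= (4 * y) ^+ p * y ^+ p.
    by rewrite mulr_ge0 ?exprn_ge0 ?mulr_ge0 ?(ltW y0).
  have := ler_wpM2l yp Hp; rewrite -!exprMn.
  have -> : 4 * y * y * (y ^- 2 / 4) = 1 by field; rewrite gt_eqF.
  rewrite expr1n => /le_trans; apply.
  rewrite mulrA -!exprMn ler_wpM2r ?expR_ge0//.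
  rewrite lerXn2r ?nnegrE ?mulr_ge0 ?(ltW y0)//.
  have : y * y <= y by rewrite ler_piMl ?(ltW y0).
  have p0 : 0 <= p%:R :> R by []. 
  move: p0; move: (p%:R) => pp p0 yy1; nra.
have [mAU PAU] := @union_bound _ _ _ P _ (index_enum _) (fun z => 1 <= dotv (g z) (g z)) A cA cA0
  (fun z z1 => conj (mA z) (PA z z1)).
have [mDU PDU] := @union_bound _ _ _ P _ (index_enum _) xpredT D cB cB0
  (fun q _ => conj (mD q) (PD q)).
set AU := \big[_/_]_(_ <- _ | _) _ in mAU PAU.
set DU := \big[_/_]_(_ <- _ | _) _ in mDU PDU.
exists (AU `|` DU); split; first exact: measurableU.
- move=> w phi phi1 Hphi.
  have [[q Dq]|noD] := pselect (exists q, D q w).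
    by right; rewrite /DU (bigD1 q)//=; left.
  left.
  have phi_le1 i : `|phi i 0| <= 1 by rewrite -phi1; exact: coord_le_enorm.
  have [z Hz] := choice (fun i => @round_away R N (phi i 0) isT (phi_le1 i)).
  have gz i : g [ffun i => z i] i 0 = ((z i)%:R - N%:R) / N%:R by rewrite mxE ffunE.
  have z1 : 1 <= dotv (g [ffun i => z i]) (g [ffun i => z i]).
    have <- : dotv phi phi = 1.
      have := phi1; rewrite /enorm => E.
      have : Num.sqrt (\sum_i \sum_j phi i j ^+ 2) ^+ 2 = 1 by rewrite E expr1n.
      rewrite sqr_sqrtr; last by rewrite !sumr_ge0// => i _; rewrite sumr_ge0// => j _; exact: sqr_ge0.
      by move=> <-; apply: eq_bigr => i _; rewrite big_ord1 expr2.
    by apply: ler_sum => i _; rewrite gz -!expr2; have [] := Hz i.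
  rewrite /AU (bigD1 [ffun i => z i])//=; left => l lk.
  have xb i : `|xi w l i 0| <= N%:R * y * h `^ H.
    rewrite leNgt; apply/negP => Hlt; apply: noD.
    by exists (i, Ordinal lk); exact: ltW.
  have gphi i : `|g [ffun i => z i] i 0 - phi i 0| <= N%:R^-1.
    by rewrite gz; have [] := Hz i.
  apply: le_trans (dotv_rounding gphi xb) _.
  have -> : N%:R * y * h `^ H / N%:R = y * h `^ H by field; rewrite gt_eqF.
  by rewrite -mulrA mulrDl mul1r lerD2r; exact: Hphi.
- apply: le_trans (measureU2 P mAU mDU) _; apply: le_trans (leeD PAU PDU) _.
  rewrite -EFinD lee_fin mulrDl.
  have -> : size (index_enum ('I_n * 'I_k)%type) = (n * k)%N.
    by rewrite size_index_enum card_prod !card_ord.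
  have -> : size (index_enum {ffun 'I_n -> 'I_(N + N).+1}) = ((N + N).+1 ^ n)%N.
    by rewrite size_index_enum card_ffun !card_ord.
  have -> : (n * k)%:R * cB = CB * y ^+ p by rewrite /cB /CB; ring.
  rewrite lerD2r natrX.
  have N5 : (N + N).+1%:R <= 5 * y ^- 2 :> R.
    by rewrite -natr1 natrD; lra.
  apply: (@le_trans _ _ ((5 * y ^- 2) ^+ n * cA)).
    by rewrite ler_wpM2r// lerXn2r ?nnegrE ?mulr_ge0.
  rewrite /cA /CA exprMn [X in _ * X <= _]exprMn -!mulrA ler_wpM2l ?exprn_ge0//.
  rewrite mulrCA ler_wpM2l ?exprn_ge0 ?mulr_ge0 ?addr_ge0 ?(ltW C00)//.
  have -> : (y ^- 2) ^+ n * y ^+ k = y ^+ p * y.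
    have yn0 : y ^+ n != 0 by rewrite expf_neq0// gt_eqF.
    have -> : y ^+ k = y * (y ^+ p * (y ^+ n * y ^+ n)).
      by rewrite /k exprS exprD -addnn exprD.
    have -> : (y ^- 2) ^+ n = (y ^+ n * y ^+ n)^-1.
      by rewrite -exprMn -expr2 exprVn.
    by field; rewrite yn0.
  by rewrite ler_piMr// exprn_ge0// ltW.
Qed.

(** * Tail of the modulus of roughness *)

Lemma dyadic_below (R : realType) (e : R) : 0 < e <= 2^-1 ->
  exists M : nat, let b := (2^-1 : R) ^+ M.+1 in b <= e < 2 * b.
Proof.
move=> /andP[e0 e2]; apply: contrapT => Hn.
have H M : e < 2^-1 ^+ M.+1.
  elim: M => [|M IH].
    have [//|He] := ltP e (2^-1 ^+ 1); exfalso; apply: Hn; exists 0%N => /=.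
    by rewrite He/= expr1; move: e2; lra.
  have [//|He] := ltP e (2^-1 ^+ M.+2); exfalso; apply: Hn; exists M.+1 => /=.
  by rewrite He/= exprS mulrA mulfV// mul1r.
have cv : (2^-1 : R) ^+ M @[M --> \oo] --> (0 : R).
  by apply: cvg_expr; rewrite ger0_norm// invf_lt1// ltr1n.
have : (0 : R) < e by [].
have /cvgrPdist_lt /(_ e e0)[N _ HN] := cv.
have := HN N.+1 (leqnSn N); rewrite sub0r normrN ger0_norm ?exprn_ge0//.
by move=> /(lt_trans (H N)); rewrite ltxx.
Qed.

Lemma dyadic_interval (R : realType) (M : nat) (s : R) : 0 <= s <= 1 ->
  let b := (2^-1 : R) ^+ M in
  exists2 j : nat, (j < 2 ^ M)%N & j%:R * b <= s <= j.+1%:R * b.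
Proof.
move=> /andP[s0 s1] b.
have b2 : b * (2 ^ M)%:R = 1 by rewrite natrX /b exprVn mulVf// expf_neq0.
have b0 : 0 < b by rewrite exprn_gt0.
have sb : s * (2 ^ M)%:R * b = s by rewrite -mulrA (mulrC _ b) b2 mulr1.
have t0 : 0 <= s * (2 ^ M)%:R by rewrite mulr_ge0.
have /andP[t1 t2] := truncn_itv t0.
have [tM|tM] := ltnP (Num.truncn (s * (2 ^ M)%:R)) (2 ^ M).
  exists (Num.truncn (s * (2 ^ M)%:R)) => //.
  rewrite -(ler_pM2r b0) sb in t1; rewrite t1/=.
  by rewrite -(ltr_pM2r b0) sb in t2; exact: ltW.
exists (2 ^ M).-1; first by rewrite prednK// expn_gt0.
rewrite prednK ?expn_gt0// (mulrC (2 ^ M)%:R) b2 s1 andbT.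
rewrite -(ler_pM2r b0) sb in t1; apply: le_trans t1.
by rewrite ler_pM2r// ler_nat (leq_trans (leq_pred _)).
Qed.

(** If every dyadic interval contains, for every direction, an increment that is
    not too small, the path is rough: an interval of radius e around s contains
    a dyadic interval around s of comparable length. *)
Lemma rough_of_increments (R : realType) (n : nat) (theta x : R) (k : nat)
    (X : R -> 'cV[R]_n) :
  0 < theta < 1 -> 0 < x -> (0 < k)%N ->
  (forall (M j : nat) (phi : 'cV[R]_n), (j < 2 ^ M.+1)%N -> enorm phi = 1 ->
    let b := (2^-1 : R) ^+ M.+1 in
    exists2 l, (l < k)%N &
      4 * x * b `^ theta < `|dotv phi (X (j%:R * b + l.+1%:R * (b / k%:R))
                            - X (j%:R * b + l%:R * (b / k%:R)))|) ->
  holder_rough_with theta x X.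
Proof.
move=> /andP[th0 th1] x0 k0 Hinc s e phi s01 e01 phi1.
have [M /andP[be eb]] := dyadic_below e01; set b := _ ^+ M.+1 in be eb.
rewrite in_itv/= in s01.
have [j jM /andP[js sj]] := dyadic_interval M.+1 s01.
have [l lk Hl] := Hinc M j phi jM phi1; rewrite -/b in Hl js sj.
have b0 : 0 < b by rewrite exprn_gt0.
have kR : 0 < k%:R :> R by rewrite ltr0n.
have j1 : j.+1%:R * b <= 1.
  have bE : (2 ^ M.+1)%:R * b = 1.
    by rewrite natrX /b exprVn mulfV// expf_neq0.
  by rewrite -[leRHS]bE ler_pM2r// ler_nat.
have tl m : (m <= k)%N -> j%:R * b <= j%:R * b + m%:R * (b / k%:R) <= j.+1%:R * b.
  move=> mk; rewrite lerDl mulr_ge0 ?divr_ge0 ?(ltW b0)//= -natr1 mulrDl lerD2l mul1r.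
  rewrite mulrCA ler_piMr ?(ltW b0)// ler_pdivrMr// mul1r ler_nat//.
have jb0 : 0 <= j%:R * b by rewrite mulr_ge0// ltW.
have jS : j.+1%:R * b = j%:R * b + b by rewrite -natr1 mulrDl mul1r.
set t1 := _ + l.+1%:R * _ in Hl; set t2 := _ + l%:R * _ in Hl.
have /andP[t1a t1b] : j%:R * b <= t1 <= j.+1%:R * b by exact: tl.
have /andP[t2a t2b] : j%:R * b <= t2 <= j.+1%:R * b by apply: tl; exact: ltnW.
have ok t : j%:R * b <= t -> t <= j.+1%:R * b -> t \in `[0, 1] /\ `|t - s| <= e.
  move=> ta tb; rewrite in_itv/=; split; first by apply/andP; split; lra.
  by rewrite ler_norml; apply/andP; split; lra.
have ee : e `^ theta <= 2 * b `^ theta.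
  apply: (@le_trans _ _ ((2 * b) `^ theta)).
    by apply: powR_mono; [exact: ltW|case/andP: e01 => /ltW|exact: ltW].
  rewrite powRM ?(ltW b0)// ler_wpM2r ?powR_ge0//.
  rewrite -[leRHS]powRr1//; apply: ler_powR; first by rewrite ler1n.
  exact: ltW.
have x2 : x * e `^ theta <= 2 * x * b `^ theta.
  by rewrite (mulrC 2) -mulrA ler_wpM2l// ltW.
have tri : `|dotv phi (X t1 - X t2)| <=
    `|dotv phi (X t1 - X s)| + `|dotv phi (X t2 - X s)|.
  have -> : dotv phi (X t1 - X t2) = dotv phi (X t1 - X s) - dotv phi (X t2 - X s).
    by rewrite !dotvB; ring.
  exact: ler_normB.
have [c1|c1] := ltP (x * e `^ theta) `|dotv phi (X t1 - X s)|.
  by have [? ?] := ok _ t1a t1b; exists t1.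
have [? ?] := ok _ t2a t2b; exists t2; split => //.
have xb : 0 <= x * b `^ theta by rewrite mulr_ge0 ?powR_ge0 ?ltW.
move: Hl tri c1 x2; rewrite -!mulrA; move: (x * _) (x * _) => A B; lra.
Qed.

(** If the modulus is below x, then rough_of_increments fails at some dyadic interval
    of length b = 2^(- M - 1): some direction has all its k increments below
    y h^H with y of order x b^(theta - H).  At level M there are 1/b intervals, each
    of probability of order y^q, and (theta - H) q >= 2 makes the sum over all
    levels converge. *)
Lemma fbm_roughness_tail (R : realType) (n : nat) (H theta : R) (p : nat) :
  0 < H <= 2^-1 -> H < theta < 1 ->
  exists2 C : R, 0 < C &
  forall (d : measure_display) (T : measurableType d) (P : probability T R)
    (X : T -> R -> 'cV[R]_n), is_fbm P H X ->
  forall x : R, 0 < x -> exists B : set T,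
  [/\ measurable B,
    forall w, (roughness theta (X w) < x%:E)%E -> B w
  & (P B <= (C * x ^+ p)%:E)%E].
Proof.
move=> H01 /andP[Hth th1]; have /andP[H0 H12] := H01.
have dth : 0 < theta - H by rewrite subr_gt0.
have th0 : 0 < theta by exact: lt_trans Hth.
pose q := maxn p (Num.truncn (2 / (theta - H))).+1.
have q2 : 2 <= (theta - H) * q%:R.
  have /andP[_ t2] := truncn_itv (divr_ge0 (ler0n R 2) (ltW dth)).
  rewrite mulrC -ler_pdivrMr//; apply: le_trans (ltW t2) _.
  by rewrite ler_nat leq_maxr.
have [k [k0 [C C0 HC]]] := fbm_inf_small_ball n q H01.
have kR : 0 < k%:R :> R by rewrite ltr0n.
(* below x0 the thresholds y of all levels are at most 1; above x0 the bound is
   trivial *)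
pose x0 := (4 * k%:R)^-1 : R.
have x00 : 0 < x0 by rewrite invr_gt0 mulr_gt0.
exists (C * (4 * k%:R) ^+ q + x0 ^- p) => [|d T P X fbm x xgt0].
  by rewrite addr_gt0 ?mulr_gt0 ?exprn_gt0 ?mulr_gt0 ?invr_gt0 ?exprn_gt0.
have [xx0|xx0] := ltP x0 x.
  exists setT; split => //; rewrite probability_setT lee_fin mulrDl.
  apply: (@le_trans _ _ (x0 ^- p * x ^+ p)).
    rewrite mulrC ler_pdivlMr ?exprn_gt0// mul1r.
    by rewrite lerXn2r ?nnegrE ?(ltW x00) ?(ltW xgt0)// ltW.
  by rewrite lerDr !mulr_ge0 ?exprn_ge0 ?mulr_ge0 ?(ltW C0) ?(ltW xgt0).
have x1 : x <= 1.
  by apply: le_trans xx0 _; rewrite invf_le1 ?mulr_gt0// -natrM ler1n muln_gt0.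
pose b M := (2^-1 : R) ^+ M.+1.
have b0 M : 0 < b M by rewrite exprn_gt0.
have b1 M : b M <= 1 by rewrite exprn_ile1// invf_le1// ler1n.
pose u := (k%:R^-1 : R) `^ H.
have u0 : 0 < u by apply: powR_gt0; rewrite invr_gt0.
have uk : u^-1 <= k%:R.
  rewrite invf_ple ?posrE//.
  rewrite -[leLHS]powRr1 ?invr_ge0//; apply: powR_anti => //.
    by rewrite invr_ge0 ler0n/= invf_le1// ler1n.
  by apply: le_trans H12 _; rewrite invf_le1 ?ler1n.
(* chosen such that y M * h ^ H is the increment 4 x b^theta that
   rough_of_increments asks for, with h = b / k *)
pose y M := 4 * x * (b M) `^ (theta - H) / u.
have y0 M : 0 < y M by rewrite divr_gt0// !mulr_gt0// powR_gt0.
have yb M : y M <= 4 * k%:R * x * (b M) `^ (theta - H).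
  rewrite /y mulrC [leRHS](_ : _ = k%:R * (4 * x * b M `^ (theta - H))); last by ring.
  by rewrite ler_wpM2r// !mulr_ge0 ?powR_ge0// ltW.
have y1 M : y M <= 1.
  apply: le_trans (yb M) _; apply: mulr_ile1.
  - by rewrite !mulr_ge0// ltW.
  - exact: powR_ge0.
  - by rewrite mulrC -ler_pdivlMr ?mulr_gt0// mul1r.
  - by apply: powR_le1; rewrite ?b1 ?(ltW (b0 _)) ?(ltW dth).
have yh M : y M * (b M / k%:R) `^ H = 4 * x * b M `^ theta.
  rewrite powRM ?invr_ge0 ?(ltW (b0 _))// -/u /y.
  have -> : b M `^ theta = b M `^ (theta - H) * b M `^ H.
    by rewrite -powRD ?subrK// (gt_eqF (b0 _)) implybT.
  by field; rewrite gt_eqF.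
have yq M : y M ^+ q <= (4 * k%:R) ^+ q * x ^+ p * b M ^+ 2.
  apply: (@le_trans _ _ ((4 * k%:R * x * (b M) `^ (theta - H)) ^+ q)).
    by rewrite lerXn2r ?nnegrE ?(ltW (y0 M))// !mulr_ge0 ?powR_ge0// ltW.
  rewrite !exprMn -!mulrA; do 2! (apply: ler_wpM2l; first by rewrite ?exprn_ge0).
  apply: ler_pM.
  - by rewrite exprn_ge0// ltW.
  - by rewrite exprn_ge0// powR_ge0.
  - by apply: ler_wiXn2l => //; [exact: ltW|exact: leq_maxl].
  - rewrite -(powR_mulrn q (powR_ge0 _ _)) -powRrM -(powR_mulrn 2 (ltW (b0 M))).
    by apply: powR_anti => //; rewrite b1 ltW.
have bE M : (2 ^ M.+1)%:R * b M = 1.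
  by rewrite natrX /b exprVn mulfV// expf_neq0.
have tj M j : (j < 2 ^ M.+1)%N -> 0 <= j%:R * b M /\ j%:R * b M + k%:R * (b M / k%:R) <= 1.
  move=> jM; split; first by rewrite mulr_ge0// ltW.
  rewrite mulrCA mulfV ?gt_eqF// mulr1 -[X in _ + X]mul1r -mulrDl natr1.
  by rewrite -[leRHS](bE M) ler_pM2r// ler_nat.
have y01 M : 0 < y M <= 1 by rewrite y0 y1.
have h0 M : 0 < b M / k%:R by rewrite divr_gt0.
have EB M (j : 'I_(2 ^ M.+1)) := HC d T P X fbm _ _
  (tj M j (ltn_ord j)).1 (h0 M) (tj M j (ltn_ord j)).2 _ (y01 M).
pose Bj M : 'I_(2 ^ M.+1) -> set T := projT1 (choice (EB M)).
have HBj M := projT2 (choice (EB M)).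
have cy0 M : 0 <= C * y M ^+ q by rewrite mulr_ge0 ?(ltW C0)// exprn_ge0// ltW.
have HB M := @union_bound _ _ _ P _ (index_enum 'I_(2 ^ M.+1)) xpredT (Bj M)
  (C * y M ^+ q) (cy0 M) (fun j _ => let: And3 mB _ PB := HBj M j in conj mB PB).
pose BM M := \big[setU/set0]_(j < 2 ^ M.+1) Bj M j.
have mBM M : measurable (BM M) by have [] := HB M.
exists (\bigcup_M BM M); split.
- exact: bigcup_measurable.
- move=> w Lw; apply: contrapT => nB.
  suff Lx : holder_rough_with theta x (X w).
    have : (x%:E <= roughness theta (X w))%E by apply: ereal_sup_ubound; right; exists x.
    by move/(lt_le_trans Lw); rewrite ltxx.
  apply: (@rough_of_increments _ _ theta x k) => //; first by rewrite th0.
  move=> M j phi jM phi1 /=; rewrite -/(b M); apply: contrapT => Hn; apply: nB.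
  exists M => //; rewrite /BM (bigD1 (Ordinal jM))//=; left.
  have [_ Bad _] := HBj M (Ordinal jM); apply: (Bad w phi phi1) => l lk /=.
  rewrite leNgt yh; apply/negP => Hl; apply: Hn; exists l => //.
- apply: (@le_trans _ _ (\sum_(0 <= M <oo) P (BM M))%E).
    by apply: measure_sigma_subadditive => //; exact: bigcup_measurable.
  pose A := C * ((4 * k%:R) ^+ q * x ^+ p).
  have A0 : 0 <= A by rewrite !mulr_ge0 ?exprn_ge0 ?mulr_ge0 ?(ltW C0) ?(ltW xgt0).
  apply: (@le_trans _ _ A%:E); last first.
    rewrite lee_fin mulrDl /A mulrA lerDl mulr_ge0 ?invr_ge0 ?exprn_ge0//.
      exact: ltW.
    exact: ltW.
  apply: le_trans (epsilon_trick0 xpredT A0); apply: lee_nneseries => // M _.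
  have [_ +] := HB M; move/le_trans; apply; rewrite lee_fin size_index_enum card_ord.
  have -> : A / (2 ^ M.+1)%:R = (2 ^ M.+1)%:R * (C * ((4 * k%:R) ^+ q * x ^+ p * b M ^+ 2)).
    have -> : (2 ^ M.+1)%:R = (b M)^-1 :> R.
      by apply: (mulIf (lt0r_neq0 (b0 M))); rewrite bE mulVf// lt0r_neq0.
    by rewrite /A; field; rewrite gt_eqF.
  by do 2! (apply: ler_wpM2l; first by rewrite ?ler0n ?(ltW C0)).
Qed.

(** * From tail bounds to inverse moments *)

(** For 2^-(m+1) <= L < 2^-m the integrand is at most 2^((m+1) p), which is charged to
    the event covering L < 2^-m; where L = 0 all the charges are paid, and their sum
    is infinite like the integrand. *)
Lemma inverse_moment_of_tail (R : realType) (d : measure_display)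
    (T : measurableType d) (P : probability T R) (L : T -> \bar R) (p C : R) (q : nat) :
  0 < p -> p + 1 <= q%:R -> 0 < C -> (forall w, (0 <= L w)%E) ->
  measurable_fun setT (fun w => poweR (inve (L w)) p) ->
  (forall x : R, 0 < x -> exists B : set T,
    [/\ measurable B, forall w, (L w < x%:E)%E -> B w
      & (P B <= (C * x ^+ q)%:E)%E]) ->
  P.-integrable setT (fun w => poweR (inve (L w)) p).
Proof.
move=> p0 pq C0 L0 mL tail; apply/integrableP; split => //.
under eq_integral do rewrite gee0_abs ?poweR_ge0//.
pose x m : R := 2^-1 ^+ m.
have x0 m : 0 < x m by rewrite exprn_gt0.
pose B m : set T := projT1 (cid (tail (x m) (x0 m))).
have HB m := projT2 (cid (tail (x m) (x0 m))); rewrite -/(B _) in HB.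
have mB m : measurable (B m) by have [] := HB m.
pose c m : R := (2 ^+ m.+1) `^ p.
have c0 m : 0 <= c m by exact: powR_ge0.
pose u m w : \bar R := (c m * \1_(B m) w)%:E.
have u0 m w : (0 <= u m w)%E by rewrite lee_fin mulr_ge0// indicE.
have mu m : measurable_fun setT (u m).
  by apply/measurable_EFinP; apply: measurable_funM => //; exact: measurable_indic.
have uge m w : B m w -> ((c m)%:E <= \sum_(0 <= i <oo) u i w)%E.
  move=> Bw; apply: le_trans (@nneseries_lim_ge _ _ xpredT 0 m.+1 _) => //.
  rewrite big_nat_recr//= /u indicE mem_set// mulr1 leeDr//.
  by apply: sume_ge0 => i _; exact: u0.
have S0 w : (0 <= \sum_(0 <= i <oo) u i w)%E by apply: nneseries_ge0.
have mono := @gt0_ler_poweR R p (ltW p0).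
have dom w : (poweR (inve (L w)) p <= 1 + \sum_(0 <= i <oo) u i w)%E.
  have [L1|L1] := leP 1%E (L w).
    apply: (@le_trans _ _ 1%E); last by rewrite leeDl.
    rewrite -[leRHS](@poweR1r R p); apply: mono.
    - by rewrite in_itv/= inve_ge0 L0 leey.
    - by rewrite in_itv/= lee_fin ler01 leey.
    - by rewrite -[leRHS]inve1 lee_pV2// inE// lee_fin.
  have [L00|L00] := eqVneq (L w) 0%E.
    suff -> : (\sum_(0 <= i <oo) u i w = +oo)%E by rewrite addey ?leey.
    apply/eqyP => A A0.
    have Ap0 : 0 <= A `^ p^-1 by exact: powR_ge0.
    have /andP[_ t2] := truncn_itv Ap0.
    pose m := Num.truncn (A `^ p^-1).
    have Bm : B m w by have [_ + _] := HB m; apply; rewrite L00 lte_fin.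
    apply: le_trans (uge m w Bm); rewrite lee_fin.
    have -> : A = (A `^ p^-1) `^ p by rewrite -powRrM mulVf ?gt_eqF// powRr1// ltW.
    apply: powR_mono => //; first exact: ltW.
    apply: (le_trans (ltW t2)); rewrite -natrX ler_nat; apply: ltnW.
    exact: ltn_expl.
  have Lfin : L w \is a fin_num.
    by rewrite ge0_fin_numE// (lt_trans L1)// ltry.
  have [r Lr] : exists r, L w = r%:E by exists (fine (L w)); rewrite fineK.
  have r0 : 0 < r by rewrite -lte_fin -Lr lt_def L00 L0.
  have r1 : r < 1 by rewrite -lte_fin -Lr.
  have [m /andP[m1 m2]] : exists m, x m.+1 <= r < x m.
    have [r2|r2] := leP (2^-1) r; first by exists 0%N; rewrite /x expr1 expr0 r2 r1.
    have : 0 < r <= 2^-1 by rewrite r0 ltW.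
    move=> /dyadic_below[M /andP[M1 M2]]; exists M.
    by rewrite /x M1/=; move: M2; rewrite exprS mulrA mulfV// mul1r.
  have Bm : B m w by have [_ + _] := HB m; apply; rewrite Lr lte_fin.
  apply: le_trans (leeDr _ _) => //; apply: le_trans (uge m w Bm).
  rewrite Lr inver gt_eqF// poweR_EFin lee_fin; apply: powR_mono.
  - exact: ltW.
  - by rewrite invr_ge0 ltW.
  - by rewrite invf_ple ?posrE ?exprn_gt0// -exprVn.
have ms : measurable_fun setT (fun w => \sum_(0 <= i <oo) u i w)%E.
  by apply: ge0_emeasurable_sum.
apply: (@le_lt_trans _ _ (\int[P]_w (1 + \sum_(0 <= i <oo) u i w))%E).
  apply: ge0_le_integral => //.
  - by move=> w _; exact: poweR_ge0.
  - exact: emeasurable_funD.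
rewrite ge0_integralD// integral_cst// mul1e.
rewrite integral_nneseries//.
pose K := 2 `^ p * C * 2.
have K0 : 0 <= K by rewrite !mulr_ge0 ?powR_ge0 ?ltW.
apply: (@le_lt_trans _ _ (1 + K%:E)%E); last by rewrite -EFinD ltry.
apply: leeD; first exact: (probability_le1 P measurableT).
apply: le_trans (epsilon_trick0 xpredT K0).
apply: lee_nneseries => [i _ _|m _]; first by apply: integral_ge0.
rewrite /u; under eq_integral do rewrite EFinM.
rewrite ge0_integralZl ?lee_fin//; last first.
  by apply/measurable_EFinP; exact: measurable_indic.
rewrite integral_indic// setIT; have [_ _ PB] := HB m.
apply: le_trans (lee_wpmul2l _ PB) _; first by rewrite lee_fin.
rewrite -EFinM lee_fin /K /c exprS powRM ?exprn_ge0//.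
have x1 : 0 <= x m <= 1 by rewrite (ltW (x0 m)) exprn_ile1// invf_le1// ler1n.
have xq : (2 ^+ m) `^ p * x m ^+ q <= x m.
  have -> : 2 ^+ m = (x m)^-1 :> R by rewrite /x exprVn invrK.
  rewrite -powR_inv1 ?(ltW (x0 m))// -powRrM mulN1r powRN mulrC ler_pdivrMr ?powR_gt0//.
  rewrite -[X in _ <= X * _]powRr1 ?(ltW (x0 m))// -powRD; last by rewrite (gt_eqF (x0 m)) implybT.
  rewrite -powR_mulrn ?(ltW (x0 m))//; apply: powR_anti => //; last by rewrite addrC.
  by rewrite addr_gt0.
have -> : 2 `^ p * C * 2 / (2 ^ m.+1)%:R = 2 `^ p * C * x m.
  rewrite natrX exprS /x exprVn; field.
  by rewrite expf_neq0.
have -> : 2 `^ p * (2 ^+ m) `^ p * (C * x m ^+ q) = 2 `^ p * C * ((2 ^+ m) `^ p * x m ^+ q).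
  by ring.
by rewrite ler_wpM2l// mulr_ge0 ?powR_ge0 ?ltW.
Qed.

(** * Measurability of the modulus of roughness *)

Section countable_quantifiers.
Context {d : measure_display} {T : measurableType d}.

Lemma measurable_exists (I : countType) (Q : I -> T -> Prop) :
  (forall i, measurable [set w | Q i w]) -> measurable [set w | exists i, Q i w].
Proof.
move=> mQ; rewrite (_ : [set w | _] = \bigcup_i [set w | Q i w]).
  by apply: countable_bigcupT_measurable => //; exact: countableP.
by apply/seteqP; split => w /= [i Qi]; [exists i|move=> Qw; exists i].
Qed.

Lemma measurable_forall (I : countType) (Q : I -> T -> Prop) :
  (forall i, measurable [set w | Q i w]) -> measurable [set w | forall i, Q i w].
Proof.
move=> mQ; rewrite (_ : [set w | _] = ~` [set w | exists i, ~ Q i w]).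
  apply: measurableC; apply: measurable_exists => i.
  exact: (measurableC (mQ i)).
apply/seteqP; split => w /= H; first by case=> i; apply.
by move=> i; apply: contrapT => nQ; apply: H; exists i.
Qed.

Lemma measurable_implies (A : Prop) (Q : T -> Prop) :
  (A -> measurable [set w | Q w]) -> measurable [set w | A -> Q w].
Proof.
move=> mQ; have [a|na] := pselect A.
  rewrite (_ : [set w | _] = [set w | Q w]); first exact: mQ.
  by apply/seteqP; split => w /= H; [exact: H|].
rewrite (_ : [set w | _] = setT); first exact: measurableT.
by apply/seteqP; split => w //= _ a; case: na.
Qed.

Lemma measurable_and (A : Prop) (Q : T -> Prop) :
  (A -> measurable [set w | Q w]) -> measurable [set w | A /\ Q w].
Proof.
move=> mQ; have [a|na] := pselect A.
  rewrite (_ : [set w | _] = [set w | Q w]); first exact: mQ.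
  by apply/seteqP; split => w /=; [case|].
rewrite (_ : [set w | _] = set0); first exact: measurable0.
by apply/seteqP; split => w //= [].
Qed.

End countable_quantifiers.

Section rational_roughness.
Context {R : realType} {n : nat}.
Implicit Types (X : R -> 'cV[R]_n) (z : 'cV[int]_n).

Local Notation vec z := (map_mx intr z : 'cV[R]_n).

(** Integer directions suffice because the condition is homogeneous in the
    direction. *)
Definition rationally_rough (theta L : R) X : Prop :=
  forall (s e : rat) z, 0 <= (ratr s : R) <= 1 /\ 0 < (ratr e : R) <= 2^-1 /\
    0 < enorm (vec z) ->
  exists t : rat, (0 <= (ratr t : R) <= 1 /\ `|ratr t - ratr s : R| <= ratr e) /\
    L * ratr e `^ theta * enorm (vec z) < `|dotv (vec z) (X (ratr t) - X (ratr s))|.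

Lemma holder_rough_with_mono theta (a b : R) X : a <= b ->
  holder_rough_with theta b X -> holder_rough_with theta a X.
Proof.
move=> ab Hb s e phi s01 e01 phi1; have [t [t01 ts Ht]] := Hb s e phi s01 e01 phi1.
by exists t; split => //; apply: le_lt_trans Ht; rewrite ler_wpM2r ?powR_ge0.
Qed.

Lemma rational_near (lo hi t rho : R) : lo < hi -> lo <= t <= hi -> 0 < rho ->
  exists q : rat, lo <= ratr q <= hi /\ `|ratr q - t| <= rho.
Proof.
move=> lohi /andP[lot thi] rho0.
have : Num.max lo (t - rho) < Num.min hi (t + rho).
  rewrite lt_min !gt_max lohi; apply/andP; split; apply/andP; split; lra.
move=> /rat_in_itvoo[q]; rewrite in_itv/= gt_max lt_min.
move=> /andP[/andP[q1 q2] /andP[q3 q4]]; exists q; split.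
  by rewrite (ltW q1) (ltW q3).
by rewrite ler_norml; apply/andP; split; lra.
Qed.

Variables (X : R -> 'cV[R]_n) (K g theta : R).
Hypothesis g_gt0 : 0 < g.
Hypothesis K_ge0 : 0 <= K.
Hypothesis theta_gt0 : 0 < theta.
Hypothesis X_holder : forall (s t : R) i, 0 <= s <= 1 -> 0 <= t <= 1 ->
  `|(X t - X s) i 0| <= K * `|t - s| `^ g.

Let dotv_small (phi : 'cV[R]_n) (c : R) : 0 < c -> exists2 rho : R, 0 < rho &
  forall s t : R, 0 <= s <= 1 -> 0 <= t <= 1 -> `|t - s| <= rho ->
    `|dotv phi (X t - X s)| < c.
Proof.
move=> c0; pose S := \sum_i `|phi i 0| * K.
have S0 : 0 <= S by apply: sumr_ge0 => i _; exact: mulr_ge0.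
have d0 : 0 < c / (S + 1) by rewrite divr_gt0// ltr_wpDl.
exists ((c / (S + 1)) `^ g^-1) => [|s t s01 t01 st]; first exact: powR_gt0.
have stg : `|t - s| `^ g <= c / (S + 1).
  have := powR_mono (ltW g_gt0) (normr_ge0 _) st.
  by rewrite -powRrM mulVf ?gt_eqF// powRr1// ltW.
apply: (@le_lt_trans _ _ (S * `|t - s| `^ g)).
  rewrite /dotv; apply: le_trans (ler_norm_sum _ _ _) _.
  rewrite /S mulr_suml; apply: ler_sum => i _; rewrite normrM -mulrA.
  by apply: ler_wpM2l => //; exact: X_holder.
apply: le_lt_trans (ler_wpM2l S0 stg) _.
rewrite mulrA ltr_pdivrMr ?ltr_wpDl// mulrC ltr_pM2l//; lra.
Qed.

(** The time found by roughness is moved to a nearby rational of the same closed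
    interval; the strict inequality survives by continuity. *)
Lemma rationally_rough_of (L : R) : holder_rough_with theta L X ->
  rationally_rough theta L X.
Proof.
move=> HL s e z [s01 [/andP[e0 e2] z0]].
set v := vec z in z0 *; set S := ratr s in s01 *; set E := ratr e in e0 e2 *.
have nv : enorm ((enorm v)^-1 *: v) = 1.
  by rewrite enormZ ?invr_ge0 ?enorm_ge0// mulVf// gt_eqF.
have S01 : S \in `[0, 1] by rewrite in_itv.
have E01 : 0 < E <= 2^-1 by rewrite e0.
have [t [t01 ts Ht]] := HL S E _ S01 E01 nv.
rewrite in_itv/= in t01.
have {}Ht : L * E `^ theta * enorm v < `|dotv v (X t - X S)|.
  move: Ht; rewrite dotvZ normrM ger0_norm ?invr_ge0 ?enorm_ge0//.
  by rewrite [ltRHS]mulrC ltr_pdivlMr.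
set c := _ * enorm v in Ht *.
have c0 : 0 < `|dotv v (X t - X S)| - c by rewrite subr_gt0.
have [rho rho0 Hrho] := dotv_small v c0.
have lohi : Num.max 0 (S - E) < Num.min 1 (S + E).
  move/andP: s01 => [? ?].
  by rewrite lt_min !gt_max ltr01; apply/andP; split; apply/andP; split; lra.
have tJ : Num.max 0 (S - E) <= t <= Num.min 1 (S + E).
  move/andP: t01 => [? ?]; move: ts; rewrite ler_norml => /andP[? ?].
  by rewrite le_min !ge_max; apply/andP; split; apply/andP; split; lra.
have [q [qJ qt]] := rational_near lohi tJ rho0.
exists q; move: qJ; rewrite le_min !ge_max => /andP[/andP[q0 q1] /andP[q2 q3]].
have q01 : 0 <= (ratr q : R) <= 1 by rewrite q0.
split; first by split => //; rewrite ler_norml; apply/andP; split; lra.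
have := Hrho _ _ q01 t01; rewrite distrC => /(_ qt).
have -> : dotv v (X t - X S) = dotv v (X t - X (ratr q)) + dotv v (X (ratr q) - X S).
  by rewrite !dotvB; ring.
have := ler_normD (dotv v (X t - X (ratr q))) (dotv v (X (ratr q) - X S)).
rewrite -/S; lra.
Qed.

(** A slightly smaller rational radius, a nearby rational base point and a rounded
    direction lose less than the gap between a and b. *)
Lemma rough_of_rationally_rough (a b : R) : 0 < b -> b < a ->
  rationally_rough theta a X -> holder_rough_with theta b X.
Proof.
move=> b0 ba Ha s e phi s01 /andP[e0 e2] phi1.
rewrite in_itv/= in s01.
pose m := (a + b) / 2.
have a0 : 0 < a by exact: lt_trans ba.
have m0 : 0 < m by rewrite /m; lra.
have ma : m / a < 1 by rewrite ltr_pdivrMr// /m; lra.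
have ma0 : 0 < m / a by rewrite divr_gt0.
(* at radius e1 the constant a already gives m e^theta *)
pose e1 := e * (m / a) `^ theta^-1.
have e10 : 0 < e1 by rewrite mulr_gt0// powR_gt0.
have e1e : e1 < e.
  have : (m / a) `^ theta^-1 < 1 `^ theta^-1.
    by apply: gt0_ltr_powR; rewrite ?invr_gt0 ?nnegrE ?(ltW ma0).
  by rewrite powR1 /e1 gtr_pMr.
have [q /= ] := rat_in_itvoo e1e; rewrite in_itv/= => /andP[e1q qe].
set E := ratr q in e1q qe.
have E0 : 0 < E by exact: lt_trans e1q.
have mE : m * e `^ theta <= a * E `^ theta.
  have : e1 `^ theta <= E `^ theta by apply: powR_mono; exact: ltW.
  rewrite /e1 powRM ?powR_ge0 ?(ltW e0)// -powRrM mulVf ?gt_eqF// powRr1 ?(ltW ma0)//.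
  move/(ler_wpM2l (ltW a0)); apply: le_trans.
  by rewrite le_eqVlt; apply/orP; left; apply/eqP; field; rewrite gt_eqF.
pose gam := (m - b) * e `^ theta.
have gam0 : 0 < gam by rewrite mulr_gt0 ?powR_gt0// /m; lra.
have [rho rho0 Hrho] := dotv_small phi (divr_gt0 gam0 (ltr0n R 2)).
have r0 : 0 < Num.min rho (e - E) by rewrite lt_min rho0 subr_gt0.
have [p [p01 ps]] := rational_near (@ltr01 R) s01 r0.
set S := ratr p in p01 ps; move: ps; rewrite le_min => /andP[ps1 ps2].
pose N := (Num.truncn (2 * n%:R * K / gam)).+1.
have N0 : 0 < N%:R :> R by rewrite ltr0n.
have NK : n%:R * (K / N%:R) < gam / 2.
  have t0 : 0 <= 2 * n%:R * K / gam.
    by rewrite divr_ge0 ?(ltW gam0)// !mulr_ge0.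
  have /andP[_] := truncn_itv t0; rewrite -/N ltr_pdivrMr// => H.
  by rewrite mulrA ltr_pdivrMr//; move: H; lra.
have phi_le1 i : `|phi i 0| <= 1 by rewrite -phi1; exact: coord_le_enorm.
pose zz i := projT1 (cid (@round_away R N (phi i 0) isT (phi_le1 i))).
have Hz i := projT2 (cid (@round_away R N (phi i 0) isT (phi_le1 i))).
rewrite -/(zz _) in Hz.
pose z : 'cV[int]_n := \col_i ((zz i)%:Z - N%:Z).
pose G : 'cV[R]_n := N%:R^-1 *: vec z.
have GE i : G i 0 = ((zz i)%:R - N%:R) / N%:R.
  by rewrite !mxE mulrC rmorphB.
have G1 : 1 <= enorm G.
  rewrite -phi1 /enorm ler_wsqrtr// ler_sum// => i _; rewrite !big_ord1 GE.
  by have [] := Hz i.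
have Gphi i : `|G i 0 - phi i 0| <= N%:R^-1 by rewrite GE; have [] := Hz i.
have zG : vec z = N%:R *: G by rewrite scalerA mulfV ?scale1r// gt_eqF.
have z0 : 0 < enorm (vec z).
  by rewrite zG enormZ ?(ltW N0)// mulr_gt0// (lt_le_trans ltr01).
have E2 : 0 < E <= 2^-1 by rewrite E0 (le_trans (ltW qe)).
have [t [[t01 tS] Ht]] := Ha p q z (conj p01 (conj E2 z0)).
have {}Ht : a * E `^ theta < `|dotv G (X (ratr t) - X S)|.
  move: Ht; rewrite zG enormZ ?(ltW N0)// dotvZ normrM (gtr0_norm N0).
  rewrite mulrCA ltr_pM2l//; apply: le_lt_trans.
  by rewrite ler_peMr// mulr_ge0 ?powR_ge0// ltW.
have xb i : `|(X (ratr t) - X S) i 0| <= K.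
  apply: le_trans (X_holder i p01 t01) _; rewrite ler_piMr//.
  apply: powR_le1 => //; first exact: ltW.
  by apply: le_trans tS _; rewrite (le_trans (ltW qe))// (le_trans e2)// invf_le1// ler1n.
have H1 := dotv_rounding Gphi xb.
have H2 := Hrho _ _ s01 p01 ps1.
exists (ratr t); split.
- by rewrite in_itv.
- have := ler_distD S (ratr t) s; rewrite -/E in tS; lra.
have D : dotv phi (X (ratr t) - X S) =
    dotv phi (X (ratr t) - X s) - dotv phi (X S - X s).
  by rewrite !dotvB; ring.
have := ler_normB (dotv phi (X (ratr t) - X s)) (dotv phi (X S - X s)).
rewrite -D => H3.
have gE : gam = m * e `^ theta - b * e `^ theta by rewrite /gam mulrBl.
lra.
Qed.

(** Roughness above a threshold is witnessed by a rational constant, for which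
    the countable condition is equivalent up to an arbitrarily small loss. *)
Lemma roughness_gtP (a : R) : 0 <= a ->
  ((a%:E < roughness theta X)%E <->
   exists q : rat, a < ratr q /\ rationally_rough theta (ratr q) X).
Proof.
move=> a0; split => [|[q [aq Hq]]].
  move=> /ereal_sup_gt[_ /= [->|[L [L0 HL] <-]]]; rewrite lte_fin => aL.
    by move: aL; rewrite ltNge a0.
  have [q] := rat_in_itvoo aL; rewrite in_itv/= => /andP[aq qL].
  exists q; split => //; apply: rationally_rough_of.
  exact: holder_rough_with_mono (ltW qL) HL.
pose b := (a + ratr q) / 2.
have b0 : 0 < b by rewrite /b; lra.
have bq : b < ratr q by rewrite /b; lra.
have Hb := rough_of_rationally_rough b0 bq Hq.
apply: (@lt_le_trans _ _ b%:E); first by rewrite lte_fin /b; lra.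
by apply: ereal_sup_ubound; right; exists b.
Qed.

End rational_roughness.

(** The set where the modulus exceeds a real number is a countable union of sets
    defined by countable quantifiers over measurable conditions. *)
Lemma measurable_inverse_roughness (R : realType) (n : nat) (d : measure_display)
    (T : measurableType d) (X : T -> R -> 'cV[R]_n) (theta g p : R) :
  0 < theta -> 0 < g ->
  (forall (t : R) i, t \in `[0, 1] -> measurable_fun setT (fun w => X w t i 0)) ->
  (forall w, exists2 K : R, 0 <= K &
    forall (s t : R) i, 0 <= s <= 1 -> 0 <= t <= 1 ->
      `|(X w t - X w s) i 0| <= K * `|t - s| `^ g) ->
  measurable_fun setT (fun w => poweR (inve (roughness theta (X w))) p).
Proof.
move=> th0 g0 mX HX; pose L w := roughness theta (X w).
have mR (q : R) : measurable [set w | rationally_rough theta q (X w)].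
  apply: measurable_forall => s; apply: measurable_forall => e.
  apply: measurable_forall => z; apply: measurable_implies => -[s01 _].
  apply: measurable_exists => t; apply: measurable_and => -[t01 _].
  set c := q * _ * _; set v := map_mx _ z.
  have md : measurable_fun setT (fun w => `|dotv v (X w (ratr t) - X w (ratr s))|).
    apply: measurableT_comp => //; apply: measurable_sum => i.
    apply: measurable_funM => //.
    rewrite [X in measurable_fun _ X](_ : _ =
      (fun w => X w (ratr t) i 0 - X w (ratr s) i 0)); last first.
      by apply/funext => w; rewrite !mxE.
    by apply: measurable_funB; apply: mX; rewrite in_itv.
  rewrite (_ : [set w | _] = setT `&`
    (fun w => `|dotv v (X w (ratr t) - X w (ratr s))|) @^-1` `]c, +oo[%classic).
    exact: md.
  by apply/seteqP; split => w /=; rewrite in_itv/= andbT// => -[].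
have mL : measurable_fun setT L.
  apply: (measurability _ (ErealGenOInfty.measurableE R)) => // _ [_ [a ->] <-].
  rewrite setTI; have [a0|a0] := leP 0 a; last first.
    rewrite (_ : _ @^-1` _ = setT); first exact: measurableT.
    apply/seteqP; split => w //= _; rewrite in_itv/= andbT.
    by apply: lt_le_trans (roughness_ge0 theta (X w)); rewrite lte_fin.
  rewrite (_ : _ @^-1` _ = [set w | exists q : rat, a < ratr q /\
      rationally_rough theta (ratr q) (X w)]).
    by apply: measurable_exists => q; apply: measurable_and => _.
  apply/seteqP; split => w /=; rewrite in_itv/= andbT; have [K K0 HK] := HX w;
    by move=> H; apply/(roughness_gtP g0 K0 th0 HK a0).
have mI : measurable_fun setT (fun w => inve (L w)).
  apply: (measurability _ (ErealGenOInfty.measurableE R)) => // _ [_ [a ->] <-].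
  rewrite setTI; have [a0|a0] := leP 0 a; last first.
    rewrite (_ : _ @^-1` _ = setT); first exact: measurableT.
    apply/seteqP; split => w //= _; rewrite in_itv/= andbT.
    apply: (@lt_le_trans _ _ 0%E); first by rewrite lte_fin.
    by rewrite inve_ge0; exact: roughness_ge0.
  rewrite (_ : _ @^-1` _ = setT `&` [set w | (L w < inve a%:E)%E]).
    exact: emeasurable_fun_infty_o.
  apply/seteqP; split => w /=; rewrite in_itv/= andbT => H; last first.
    by case: H => _ H; rewrite inve_pgt ?inE ?lee_fin//; exact: roughness_ge0.
  by split => //; rewrite -inve_pgt ?inE ?lee_fin//; exact: roughness_ge0.
exact: (measurableT_comp (@measurable_poweR R p) mI).
Qed.

(** * Inverse moments for fractional Brownian motion *)

Lemma fbm_inverse_roughness_integrable (R : realType) (n : nat) (H theta p : R) :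
  3^-1 < H <= 2^-1 -> H < theta < 1 -> 0 < p ->
  forall (d : measure_display) (T : measurableType d) (P : probability T R)
    (X : T -> R -> 'cV[R]_n) (XX : T -> R -> R -> 'M[R]_n),
  is_canonical_fbm_rough_path P H X XX ->
  P.-integrable setT (fun w => poweR (inve (roughness theta (X w))) p).
Proof.
move=> /andP[H3 H2] /andP[Hth th1] p0 d T P X XX can.
have i3 : 0 < 3^-1 :> R by rewrite invr_gt0.
have H01 : 0 < H <= 2^-1 by rewrite (lt_trans i3).
have fbm := canonical_fbm can.
pose q := (Num.truncn (p + 1)).+1.
have pq : p + 1 <= q%:R.
  have p10 : 0 <= p + 1 by rewrite addr_ge0// ltW.
  by have /andP[_ /ltW] := truncn_itv p10.
have [|C C0 HC] := @fbm_roughness_tail R n H theta q H01; first by rewrite Hth.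
apply: (inverse_moment_of_tail p0 pq C0) => [w||].
- exact: roughness_ge0.
- pose g := (3^-1 + H) / 2.
  have g3 : 3^-1 < g < H by rewrite /g; apply/andP; split; lra.
  have g0 : 0 < g by case/andP: g3 => g3 _; exact: lt_trans g3.
  apply: (measurable_inverse_roughness p _ g0).
  + by case/andP: H01 => H0 _; exact: lt_trans Hth.
  + by move=> t i t01; exact: fbm_measurable fbm t i t01.
  move=> w; have [_ _ _ _] := canonical_rough_path can g3 w.
  rewrite /rough_path_norm; set h := holder _ _ _ => hfin.
  have h0 : (0 <= h)%E by apply: holder2_ge0 => M; exact: enorm_ge0.
  have h20 : (0 <= holder2 (@enorm R n n) (2 * g) (XX w))%E.
    by apply: holder2_ge0 => M; exact: enorm_ge0.
  have hh : (h < +oo)%E by apply: le_lt_trans hfin; rewrite leeDl.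
  exists (fine h); first exact: fine_ge0.
  move=> s t i s01 t01; apply: (@holder_coord _ _ _ g (fine h) (X w)) => //.
    exact: fine_ge0.
  by rewrite fineK// ge0_fin_numE.
- exact: HC.
Qed.

(* The notations of mpoly clash with those in use; its ring structure is needed. *)
Import (canonicals, coercions) mpoly.

Theorem theorem1p1 (R : realType) (n : nat) (hn : (0 < n)%N) :
  (forall gamma theta : R,
     3^-1 < gamma <= 2^-1 -> 0 < theta < 1 -> theta < 2 * gamma ->
     exists r q : R, [/\ 0 < r, 0 < q &
       exists poly : mpoly.mpoly 3 R,
       forall (X : R -> 'cV[R]_n) (XX : R -> R -> 'M[R]_n)
              (A : R -> 'cV[R]_n) (A' : R -> 'M[R]_n) (B : R -> R),
         is_rough_path gamma X XX ->
         is_controlled gamma X A A' ->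
         (holder (@Num.norm R R) gamma B < +oo)%E ->
         holder_rough theta X ->
         exists2 M : R,
           M <= mpoly.meval (tnth [tuple fine (rough_path_norm gamma X XX);
                                         fine (controlled_norm gamma X A A');
                                         fine (holder_norm (@Num.norm R R) gamma B)])
                  poly
         & (sup_norm (@enorm R n 1) A + sup_norm (@Num.norm R R) B
            <= M%:E * poweR (inve (roughness theta X)) q
               * poweR (sup_norm (@Num.norm R R)
                          (rough_process X XX A A' B)) r)%E])
  /\
  (forall H theta p : R,
     3^-1 < H <= 2^-1 -> H < theta < 1 -> 0 < p ->
     forall (d : measure_display) (T : measurableType d)
            (P : probability T R)
            (X : T -> R -> 'cV[R]_n) (XX : T -> R -> R -> 'M[R]_n),
       is_canonical_fbm_rough_path P H X XX ->
       P.-integrable setT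
         (fun w => poweR (inve (roughness theta (X w))) p)).
Proof.
split.
- move=> gamma theta g_range th01 thg.
  have [r r0 [C C0 H]] := rough_norris hn g_range th01 thg.
  exists r, 26; split => //.
  pose v (i : 'I_3) : mpoly.mpoly 3 R := mpoly.mpolyX R (mpoly.mnm1 i).
  exists (mpoly.mpolyC 3 C * (1 + v ord0 + v (lift ord0 ord0) + v ord_max) ^+ 52).
  move=> X XX A A' B HX HA HB HXr.
  set x := fine (rough_path_norm _ _ _).
  set c := fine (controlled_norm _ _ _ _).
  set b := fine (holder_norm _ _ _).
  exists (C * (1 + x + c + b) ^+ 52); last exact: H.
  rewrite rmorphM/= rmorphXn/= !rmorphD/= rmorph1 mpoly.mevalC !mpoly.mevalXU.
  by rewrite !(tnth_nth 0).
- by move=> H theta p; exact: fbm_inverse_roughness_integrable.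
Qed.
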